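(* Let $(B,g_B)$ be a nondegenerate semi-Riemannian manifold, $(F,g_F)$ a semi-regular semi-Riemannian manifold and $f\in C^\infty(B)$, so that $B\times_fF$ is a semi-regular warped product. Let $X,Y,Z,T\in\Gamma(TB)$ and $U,V,W,Q\in\Gamma(TF)$ (lifted), let $H^f$ be the Hessian of $f$, and let $P\in\Gamma(TB)$ (lifted). Let $\widehat R$ be the curvature of the semi-symmetric non-metric covariant derivative on $B\times_fF$ associated with $P$, $\widehat R_B$ the one on $B$ associated with $P$, and $R_F$ the Riemann curvature of $F$. Then: (1) $\widehat R(X,Y,Z,T)=\widehat R_B(X,Y,Z,T)$; (2) $\widehat R(X,Y,Z,Q)=\widehat R(Z,Q,X,Y)=\widehat R(X,Y,Q,Z)=0$; (3) $\widehat R(X,Y,W,Q)=\widehat R(W,Q,X,Y)=0$; (4) $\widehat R(X,V,W,T)=-fH^f(X,T)g_F(V,W)+2fX(f)g_F(V,W)g_B(P,T)$; (5) $\widehat R(X,V,T,W)=fH^f(X,T)g_F(V,W)+f^2g_F(V,W)X(g_B(P,T))$; (6) $\widehat R(U,V,Z,Q)=\widehat R(Z,Q,U,V)=0$; (7) $\widehat R(U,V,Q,Z)=f^2g_B(P,Z)\big[\mathcal K_F(U,Q,V)-\mathcal K_F(V,Q,U)\big]$; (8) $\widehat R(U,V,W,Q)=f^2R_F(U,V,W,Q)+f^2g_B^*(df,df)\big[g_F(U,W)g_F(V,Q)-g_F(V,W)g_F(U,Q)\big]$.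
   Context: A singular semi-Riemannian manifold $(M,g)$ is a smooth manifold with a smooth symmetric $(0,2)$-tensor field $g=\langle\cdot,\cdot\rangle$, possibly degenerate and of varying signature. The Koszul form is $\mathcal K(X,Y,Z)=\tfrac12\{X\langle Y,Z\rangle+Y\langle Z,X\rangle-Z\langle X,Y\rangle-\langle X,[Y,Z]\rangle+\langle Y,[Z,X]\rangle+\langle Z,[X,Y]\rangle\}$; for a vector field $P$, $\widehat{\mathcal K}(X,Y,Z)=\mathcal K(X,Y,Z)+g(Y,P)g(X,Z)$. Put $\nabla^\flat_XY:=\mathcal K(X,Y,\cdot)$ and $\widehat\nabla^\flat_XY:=\widehat{\mathcal K}(X,Y,\cdot)$. $\mathcal A^\bullet(M)$ is the set of smooth 1-forms $\omega$ such that for each $p$ there is $u\in T_pM$ with $\omega_p=\langle u,\cdot\rangle$. For covectors $\omega_p=\langle u,\cdot\rangle$, $\tau_p=\langle v,\cdot\rangle$ put $\langle\langle\omega,\tau\rangle\rangle_\bullet=\langle u,v\rangle$. For radical-stationary manifolds (i.e. $\nabla^\flat_XY\in\mathcal A^\bullet(M)$ for all $X,Y$) and $\omega\in\mathcal A^\bullet(M)$, $(\nabla_X\omega)(Y)=X(\omega(Y))-\langle\langle\nabla^\flat_XY,\omega\rangle\rangle_\bullet$ and $(\widehat\nabla_X\omega)(Y)=X(\omega(Y))-\langle\langle\widehat\nabla^\flat_XY,\omega\rangle\rangle_\bullet$, smooth on the regions of constant signature (an open dense set); elsewhere values are understood by smooth extension when it exists. $(M,g)$ is semi-regular if $\nabla^\flat_XY\in\mathcal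 A^\bullet(M)$ and $\nabla_Z(\nabla^\flat_XY)\in\mathcal A^\bullet(M)$ for all $X,Y,Z$. Curvatures: $R(X,Y,Z,T)=(\nabla_X\nabla^\flat_YZ)(T)-(\nabla_Y\nabla^\flat_XZ)(T)-(\nabla^\flat_{[X,Y]}Z)(T)$ and $\widehat R(X,Y,Z,T)=(\widehat\nabla_X\widehat\nabla^\flat_YZ)(T)-(\widehat\nabla_Y\widehat\nabla^\flat_XZ)(T)-(\widehat\nabla^\flat_{[X,Y]}Z)(T)$. For singular semi-Riemannian manifolds $(B,g_B)$, $(F,g_F)$ and $f\in C^\infty(B)$ (possibly with zeros), $B\times_fF$ is $B\times F$ with the metric $\pi_B^*(g_B)+(f\circ\pi_B)^2\pi_F^*(g_F)$. Objects on $B$, $F$ are identified with their lifts. Subscripts $B$, $F$ denote the objects of the factors ($\mathcal K_F$ is the Koszul form of $F$). $g_B^*$ is the inner product induced by the nondegenerate $g_B$ on 1-forms, and $H^f(X,T)=X(T(f))-(\nabla^B_XT)(f)$ with $\nabla^B$ the Levi-Civita connection of $g_B$. *)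

(* Defs.v *)
From mathcomp Require Import all_boot all_order all_algebra.
From mathcomp Require Import all_classical all_reals all_analysis.
Set Implicit Arguments.
Unset Strict Implicit.
Unset Printing Implicit Defensive.
Import Order.TTheory GRing.Theory Num.Theory.
Import numFieldNormedType.Exports.
Local Open Scope classical_set_scope.
Local Open Scope ring_scope.

Fixpoint Ck (R : realType) (n k : nat) (O : set 'rV[R]_n) (f : 'rV[R]_n -> R)
    : Prop :=
  (forall x, O x -> {for x, continuous f}) /\
  if k is k'.+1 then
    forall i : 'I_n, (forall x, O x -> derivable f x 'e_i) /\
                     Ck k' O (fun x => 'D_('e_i) f x)
  else True.

Definition smooth_on (R : realType) (n : nat) (O : set 'rV[R]_n)
    (f : 'rV[R]_n -> R) : Prop := forall k, Ck k O f.

(* The values of [chart_map] off [chart_dom], and of [chart_inv] off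
   [chart_map @` chart_dom], are irrelevant. *)
Record chart (R : realType) (M : Type) (n : nat) := Chart {
  chart_dom : set M ;
  chart_map : M -> 'rV[R]_n ;
  chart_inv : 'rV[R]_n -> M }.

Definition chart_img (R : realType) (M : Type) (n : nat) (c : chart R M n) :=
  chart_map c @` chart_dom c.

(* [A] makes [M] an n-dimensional smooth manifold. [A] need not be maximal. *)
Definition smooth_manifold (R : realType) (M : topologicalType) (n : nat)
    (A : set (chart R M n)) : Prop :=
  [/\ hausdorff_space M,
      @second_countable M,
      forall p, exists2 c, A c & chart_dom c p,
      forall c, A c ->
        [/\ open (chart_dom c), open (chart_img c),
            forall p, chart_dom c p -> chart_inv c (chart_map c p) = p,
            forall p, chart_dom c p -> {for p, continuous (chart_map c)} &
            forall x, chart_img c x -> {for x, continuous (chart_inv c)}] &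
      forall c d, A c -> A d -> forall i : 'I_n,
        smooth_on (chart_map c @` (chart_dom c `&` chart_dom d))
          (fun x => chart_map d (chart_inv c x) 0 i)].

Definition smooth (R : realType) (M : Type) (n : nat) (A : set (chart R M n))
    (h : M -> R) : Prop :=
  forall c, A c -> smooth_on (chart_img c) (h \o chart_inv c).

(* Tangent vectors at p are the operators sum_i a_i d/dx_i at p on smooth
   functions, extended by 0 to all functions. Thus two tangent vectors are
   equal as soon as they agree on smooth functions. *)
Definition functional (R : realType) (M : Type) := (M -> R) -> R.

Definition tangent (R : realType) (M : Type) (n : nat) (A : set (chart R M n))
    (p : M) (v : functional R M) : Prop :=
  exists2 c, A c /\ chart_dom c p &
  exists a : 'rV[R]_n, forall h : M -> R,
    v h = if `[< smooth A h >]
          then \sum_(i < n) a 0 i * 'D_('e_i) (h \o chart_inv c) (chart_map c p)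
          else 0.

(* A vector field X acts on functions: X h p is X_p applied to h. *)
Definition operator (R : realType) (M : Type) := (M -> R) -> M -> R.

Definition at_point (R : realType) (M : Type) (X : operator R M) (p : M)
  : functional R M := fun h => X h p.

Definition vfield (R : realType) (M : Type) (n : nat) (A : set (chart R M n))
    (X : operator R M) : Prop :=
  (forall p, tangent A p (at_point X p)) /\
  (forall h, smooth A h -> smooth A (X h)).

Definition vadd (R : realType) (M : Type) (X Y : operator R M) : operator R M :=
  fun h p => X h p + Y h p.

Definition vscale (R : realType) (M : Type) (phi : M -> R) (X : operator R M)
  : operator R M := fun h p => phi p * X h p.

Definition bracket (R : realType) (M : Type) (X Y : operator R M)
  : operator R M := fun h p => X (Y h) p - Y (X h) p.

(* A (0,2)-tensor g; only the values of [g p] on tangent vectors at p matter. *)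
Definition tensor02 (R : realType) (M : Type) :=
  M -> functional R M -> functional R M -> R.

Definition inner (R : realType) (M : Type) (g : tensor02 R M)
    (X Y : operator R M) : M -> R :=
  fun p => g p (at_point X p) (at_point Y p).

Definition sing_metric (R : realType) (M : Type) (n : nat)
    (A : set (chart R M n)) (g : tensor02 R M) : Prop :=
  [/\ forall p u v, tangent A p u -> tangent A p v -> g p u v = g p v u,
      forall p (a : R) u u' v,
        tangent A p u -> tangent A p u' -> tangent A p v ->
        g p (fun h => a * u h + u' h) v = a * g p u v + g p u' v &
      forall X Y, vfield A X -> vfield A Y -> smooth A (inner g X Y)].

Definition nondegenerate_metric (R : realType) (M : Type) (n : nat)
    (A : set (chart R M n)) (g : tensor02 R M) : Prop :=
  forall p u, tangent A p u ->
    (forall v, tangent A p v -> g p u v = 0) -> u = (fun=> 0).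

(* g_p has s positive, t negative and n - s - t zero diagonal entries in an
   orthogonal basis e of T_p M. *)
Definition has_signature (R : realType) (M : Type) (n : nat)
    (A : set (chart R M n)) (g : tensor02 R M) (p : M) (s t : nat) : Prop :=
  exists (e : 'I_n -> functional R M) (eps : 'I_n -> R),
  [/\ forall i, tangent A p (e i),
      forall v, tangent A p v ->
        exists! a : 'rV[R]_n, v = (fun h => \sum_(i < n) a 0 i * e i h),
      forall i j, g p (e i) (e j) = if i == j then eps i else 0,
      #|[pred i | 0 < eps i]| = s &
      #|[pred i | eps i < 0]| = t].

Definition regular_point (R : realType) (M : topologicalType) (n : nat)
    (A : set (chart R M n)) (g : tensor02 R M) (p : M) : Prop :=
  exists s t, \forall q \near p, has_signature A g q s t.

Definition koszul (R : realType) (M : Type) (g : tensor02 R M)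
    (X Y Z : operator R M) : M -> R :=
  fun p => 2^-1 *
    (X (inner g Y Z) p + Y (inner g Z X) p - Z (inner g X Y) p
     - inner g X (bracket Y Z) p + inner g Y (bracket Z X) p
     + inner g Z (bracket X Y) p).

Definition koszul_hat (R : realType) (M : Type) (g : tensor02 R M)
    (P X Y Z : operator R M) : M -> R :=
  fun p => koszul g X Y Z p + inner g Y P p * inner g X Z p.

(* 1-forms, as C^oo(M)-linear maps from vector fields to smooth functions. *)
Definition form1 (R : realType) (M : Type) := operator R M -> M -> R.

Definition is_form1 (R : realType) (M : Type) (n : nat)
    (A : set (chart R M n)) (w : form1 R M) : Prop :=
  [/\ forall X, vfield A X -> smooth A (w X),
      forall X Y, vfield A X -> vfield A Y ->
        forall p, w (vadd X Y) p = w X p + w Y p &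
      forall phi X, smooth A phi -> vfield A X ->
        forall p, w (vscale phi X) p = phi p * w X p].

(* w_p = <u, .> *)
Definition represents (R : realType) (M : Type) (n : nat)
    (A : set (chart R M n)) (g : tensor02 R M) (p : M) (u : functional R M)
    (w : form1 R M) : Prop :=
  tangent A p u /\ forall X, vfield A X -> w X p = g p u (at_point X p).

Definition Abullet (R : realType) (M : Type) (n : nat)
    (A : set (chart R M n)) (g : tensor02 R M) (w : form1 R M) : Prop :=
  is_form1 A w /\ forall p, exists u, represents A g p u w.

(* << w, w' >> at p; the value does not depend on the representatives u, v. *)
Definition cometric (R : realType) (M : Type) (n : nat)
    (A : set (chart R M n)) (g : tensor02 R M) (w w' : form1 R M) : M -> R :=
  fun p => xget 0 [set x | exists u v,
    [/\ represents A g p u w, represents A g p v w' & x = g p u v]].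

(* The smooth function agreeing with h on the regions of constant signature,
   if it exists, and h itself otherwise. *)
Definition smooth_extension (R : realType) (M : topologicalType) (n : nat)
    (A : set (chart R M n)) (g : tensor02 R M) (h : M -> R) : M -> R :=
  xget h [set k | smooth A k /\ forall p, regular_point A g p -> k p = h p].

(* (D_X w)(Y), where D is the lower derivative given by [K] *)
Definition cov_der (R : realType) (M : topologicalType) (n : nat)
    (A : set (chart R M n)) (g : tensor02 R M)
    (K : operator R M -> operator R M -> form1 R M)
    (X : operator R M) (w : form1 R M) (Y : operator R M) : M -> R :=
  smooth_extension A g (fun p => X (w Y) p - cometric A g (K X Y) w p).

Definition curvature (R : realType) (M : topologicalType) (n : nat)
    (A : set (chart R M n)) (g : tensor02 R M)
    (K : operator R M -> operator R M -> form1 R M)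
    (X Y Z T : operator R M) : M -> R :=
  fun p => cov_der A g K X (K Y Z) T p - cov_der A g K Y (K X Z) T p
           - K (bracket X Y) Z T p.

Definition riemann (R : realType) (M : topologicalType) (n : nat)
    (A : set (chart R M n)) (g : tensor02 R M) :=
  curvature A g (koszul g).

Definition riemann_hat (R : realType) (M : topologicalType) (n : nat)
    (A : set (chart R M n)) (g : tensor02 R M) (P : operator R M) :=
  curvature A g (koszul_hat g P).

Definition semi_regular (R : realType) (M : topologicalType) (n : nat)
    (A : set (chart R M n)) (g : tensor02 R M) : Prop :=
  (forall X Y, vfield A X -> vfield A Y -> Abullet A g (koszul g X Y)) /\
  (forall X Y Z, vfield A X -> vfield A Y -> vfield A Z ->
     Abullet A g (cov_der A g (koszul g) Z (koszul g X Y))).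

Definition levi_civita (R : realType) (M : Type) (n : nat)
    (A : set (chart R M n)) (g : tensor02 R M)
    (D : operator R M -> operator R M -> operator R M) : Prop :=
  (forall X Y, vfield A X -> vfield A Y -> vfield A (D X Y)) /\
  (forall X X' Y, vfield A X -> vfield A X' -> vfield A Y ->
     D (vadd X X') Y = vadd (D X Y) (D X' Y)) /\
  (forall phi X Y, smooth A phi -> vfield A X -> vfield A Y ->
     D (vscale phi X) Y = vscale phi (D X Y)) /\
  (forall X Y Y', vfield A X -> vfield A Y -> vfield A Y' ->
     D X (vadd Y Y') = vadd (D X Y) (D X Y')) /\
  (forall phi X Y, smooth A phi -> vfield A X -> vfield A Y ->
     D X (vscale phi Y) = vadd (vscale (X phi) Y) (vscale phi (D X Y))) /\
  (forall X Y, vfield A X -> vfield A Y ->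
     forall h p, D X Y h p - D Y X h p = bracket X Y h p) /\
  (forall X Y Z, vfield A X -> vfield A Y -> vfield A Z ->
     forall p, X (inner g Y Z) p = inner g (D X Y) Z p + inner g Y (D X Z) p).

Definition hessian (R : realType) (M : Type)
    (D : operator R M -> operator R M -> operator R M) (f : M -> R)
    (X T : operator R M) : M -> R :=
  fun p => X (T f) p - D X T f p.

Definition differential (R : realType) (M : Type) (f : M -> R) : form1 R M :=
  fun X => X f.

Definition prod_chart (R : realType) (B F : Type) (m n : nat)
    (c : chart R B m) (d : chart R F n) : chart R (B * F)%type (m + n) :=
  Chart (chart_dom c `*` chart_dom d)
        (fun x => row_mx (chart_map c x.1) (chart_map d x.2))
        (fun y => (chart_inv c (lsubmx y), chart_inv d (rsubmx y))).

Definition prod_atlas (R : realType) (B F : Type) (m n : nat)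
    (AB : set (chart R B m)) (AF : set (chart R F n))
  : set (chart R (B * F)%type (m + n)) :=
  [set e | exists c d, [/\ AB c, AF d & e = prod_chart c d]].

Definition pushforward (R : realType) (M N : Type) (phi : M -> N)
    (v : functional R M) : functional R N := fun h => v (h \o phi).

Definition warped_metric (R : realType) (B F : Type)
    (gB : tensor02 R B) (gF : tensor02 R F) (f : B -> R)
  : tensor02 R (B * F)%type :=
  fun x u v =>
    gB x.1 (pushforward fst u) (pushforward fst v)
    + f x.1 ^+ 2 * gF x.2 (pushforward snd u) (pushforward snd v).

(* The lifts of X in Gamma(TB) and V in Gamma(TF): (X_b, 0) and (0, V_q) at
   (b, q), extended by 0 to nonsmooth functions as in [tangent]. *)
Definition liftB (R : realType) (B F : Type) (m n : nat)
    (AB : set (chart R B m)) (AF : set (chart R F n)) (X : operator R B)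
  : operator R (B * F)%type :=
  fun h x => if `[< smooth (prod_atlas AB AF) h >]
             then X (fun b => h (b, x.2)) x.1 else 0.

Definition liftF (R : realType) (B F : Type) (m n : nat)
    (AB : set (chart R B m)) (AF : set (chart R F n)) (V : operator R F)
  : operator R (B * F)%type :=
  fun h x => if `[< smooth (prod_atlas AB AF) h >]
             then V (fun q => h (x.1, q)) x.2 else 0.

(* Main.v *)
(** On lifts, every [koszul_hat X Y] is represented at the regular points of the
    warped product: by [D X Y + g(Y, P) X] for two horizontal fields, by
    [(X f / f) V] and [(X f / f + g(X, P)) V] for mixed ones, and by
    [- f g(V, W) grad f] plus a vertical vector representing the Koszul form of
    [F] for two vertical ones. Cometrics of such forms are then inner products,
    which gives each covariant derivative at regular points. At a zero of [f]
    the mixed vertical terms need not be defined; but if the point is regular,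
    the rank there is [dim B], so either [gF] vanishes or [f] vanishes nearby, and
    the formula persists. Regular points are dense, because the rank is lower
    semicontinuous, so the smooth extension in [cov_der] is the one smooth
    function with these values. The curvatures are combinations of the
    derivatives so obtained. *)
From HB Require Import structures.
Require Import Defs.
From mathcomp Require Import all_boot all_order all_algebra fingroup perm.
From mathcomp Require Import all_classical all_reals all_analysis.
From mathcomp Require Import ring lra.
Import Order.TTheory GRing.Theory Num.Theory.
Import numFieldNormedType.Exports.
Local Open Scope classical_set_scope.
Local Open Scope ring_scope.
Set Implicit Arguments.
Unset Strict Implicit.
Unset Printing Implicit Defensive.

(** * Differential calculus on open sets of R^n *)

Section Calculus.
Context {R : realType}.

(** Tangent vectors and fields act only on globally defined functions, so local objects
    (coordinates, partial derivatives, frames) must be cut off by a plateau function before use.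
    This is why calculus, bump functions and global fields forming a frame near one point precede
    the geometry. [smooth_extension] and [cometric] are choices: the second becomes computable
    because the pairing does not depend on representatives, the first because a continuous function
    is determined by its values on a dense set. Regularity is phrased by signatures, so density and
    the behaviour at zeros of [f] both rest on a semicontinuous form of the law of inertia. The
    delicate point is the quotient [S f / f]. With 0 as the inverse of 0, mixed forms have
    representatives at every point, but the pairing of two of them is then 0 at a zero of [f], while
    the smooth formula gives a product of two derivatives of [f] times [gF]. They agree only because
    this product vanishes at regular points. Semi-regularity of [F] enters twice: it supplies
    vertical representatives and the smoothness of the covariant derivative on [F] in the last
    formula. *)

Lemma ler_norm_coord n (h : 'rV[R]_n) j : `|h 0 j| <= `|h|.
Proof.
rewrite [leRHS]mx_normrE.
exact: (le_bigmax _ (fun ij => `|h ij.1 ij.2|) (ord0, j)).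
Qed.

Lemma rV_norm_le n (h : 'rV[R]_n) e :
  0 <= e -> (forall j, `|h 0 j| <= e) -> `|h| <= e.
Proof.
move=> e0 he; rewrite [leLHS]mx_normrE; apply: bigmax_le => // -[i j] _ /=.
by rewrite ord1.
Qed.

Lemma norm_delta_le n (j : 'I_n) : `|'e_j : 'rV[R]_n| <= 1.
Proof.
apply: rV_norm_le => // k; rewrite mxE eqxx /=.
by case: (k == j); rewrite ?normr1 ?normr0.
Qed.

Lemma rV_continuous (T : topologicalType) n (f : T -> 'rV[R]_n) x :
  (forall j, {for x, continuous (fun y => f y 0 j)}) -> {for x, continuous f}.
Proof.
move=> fj; apply/cvgrPdist_le => e e0.
have : \forall y \near x, forall j, `|f x 0 j - f y 0 j| <= e.
  apply: filter_forall => j.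
  by have /cvgrPdist_le /(_ e e0) := fj j.
apply: filterS => y fy; apply: rV_norm_le (ltW e0) _ => j.
by rewrite !mxE.
Qed.

Lemma derive_line (V : normedModType R) (f : V -> R) a v c :
  derivable f (a + c *: v) v ->
  is_derive c 1 (fun s : R => f (a + s *: v)) ('D_v f (a + c *: v)).
Proof.
have E : (fun h : R => h^-1 *: (((fun s => f (a + s *: v)) \o shift c) (h *: 1)
            - f (a + c *: v))) =
         (fun h : R => h^-1 *: ((f \o shift (a + c *: v)) (h *: v) - f (a + c *: v))).
  apply/funext => h /=; congr (_ *: (f _ - _)).
  by rewrite [h *: 1]mulr1 scalerDl addrCA.
by move=> df; split; rewrite /derivable /derive E.
Qed.

(** The bound on [|s|] covers both signs of [t]: the one-variable theorem is applied on the interval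
    from 0 to [t] or from [t] to 0. Later increments along a coordinate axis have no known sign. *)
Lemma mvt_line (V : normedModType R) (f : V -> R) a v (t : R) :
  (forall s, `|s| <= `|t| -> derivable f (a + s *: v) v) ->
  exists2 s, `|s| <= `|t| & f (a + t *: v) - f a = t * 'D_v f (a + s *: v).
Proof.
move=> df; pose g (s : R) := f (a + s *: v).
have dg (s : R) : `|s| <= `|t| -> is_derive s 1 g ('D_v f (a + s *: v)).
  by move=> /df; exact: derive_line.
have cg (p q : R) : (forall s, s \in `[p, q] -> `|s| <= `|t|) ->
    {within `[p, q], continuous g}.
  move=> pq; apply: derivable_within_continuous => s /pq /dg [] //.
have g0 : g 0 = f a by rewrite /g scale0r addr0.
have [t0|t0] := leP 0 t.
  have pq (s : R) : s \in `[0, t] -> `|s| <= `|t|.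
    by rewrite in_itv /= => /andP[? ?]; rewrite !ger0_norm.
  have dg' (s : R) : s \in `]0, t[ -> is_derive s 1 g ('D_v f (a + s *: v)).
    by move=> /subset_itv_oo_cc /pq /dg.
  have [s /pq sb] := MVT_segment t0 dg' (cg _ _ pq).
  by rewrite g0 subr0 mulrC => ->; exists s.
have pq (s : R) : s \in `[t, 0] -> `|s| <= `|t|.
  by rewrite in_itv /= => /andP[? ?]; rewrite !ler0_norm ?lerN2 // ltW.
have dg' (s : R) : s \in `]t, 0[ -> is_derive s 1 g ('D_v f (a + s *: v)).
  by move=> /subset_itv_oo_cc /pq /dg.
have [s /pq sb] := MVT_segment (ltW t0) dg' (cg _ _ pq).
rewrite g0 sub0r => e; exists s => //.
by rewrite -[LHS]opprB e; ring.
Qed.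

Lemma open_near (T : topologicalType) (O : set T) x :
  open O -> O x -> \forall y \near x, O y.
Proof. by move=> oO Ox; apply: open_nbhs_nbhs. Qed.

Lemma near_and (T : topologicalType) (P Q : T -> Prop) (x : T) :
  (\forall y \near x, P y) -> (\forall y \near x, Q y) ->
  \forall y \near x, P y /\ Q y.
Proof. by move=> nP nQ; exact: filterI. Qed.

Lemma near_forall (T : topologicalType) (I : finType) (P : I -> T -> Prop) (x : T) :
  (forall i, \forall y \near x, P i y) -> \forall y \near x, forall i, P i y.
Proof. by move=> nP; exact: filter_forall. Qed.

Lemma near_eq_continuous (T U : topologicalType) (f g : T -> U) x :
  (\forall y \near x, f y = g y) ->
  {for x, continuous f} -> {for x, continuous g}.
Proof.
move=> fg; rewrite /prop_for /continuous_at (nbhs_singleton fg) => cf.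
apply: cvg_trans cf; apply: near_eq_cvg.
by apply: filterS fg => y /=.
Qed.

(** * Closure properties of functions of class C^k *)

Section Ck_closure.
Context {n : nat}.
Implicit Types (f g : 'rV[R]_n -> R) (O : set 'rV[R]_n).

Lemma Ck_continuous k O f x : Ck k O f -> O x -> {for x, continuous f}.
Proof. by case: k => [|k] [cf _]; exact: cf. Qed.

Lemma Ck_derivable k O f i x : Ck k.+1 O f -> O x -> derivable f x 'e_i.
Proof. by move=> [_ /(_ i) [df _]]; exact: df. Qed.

Lemma Ck_derive k O f i : Ck k.+1 O f -> Ck k O (fun x => 'D_('e_i) f x).
Proof. by move=> [_ /(_ i) []]. Qed.

(** Openness turns agreement on [O] into agreement near each of its points, which all partial
    derivatives inherit. *)
Lemma Ck_eq k O f g : open O -> (forall x, O x -> f x = g x) ->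
  Ck k O f -> Ck k O g.
Proof.
move=> oO; elim: k f g => [|k IH] f g fg [cf df].
  split=> // x Ox; apply: near_eq_continuous (cf x Ox).
  by apply: filterS (open_near oO Ox).
have nfg x : O x -> \forall y \near x, f y = g y.
  by move=> Ox; apply: filterS (open_near oO Ox).
split=> [x Ox|i]; first by apply: near_eq_continuous (cf x Ox); exact: nfg.
have [dfi cki] := df i; split=> [x Ox|].
  by apply: near_eq_derivable (dfi x Ox); exact: nfg.
by apply: IH cki => x Ox; apply: near_eq_derive; exact: nfg.
Qed.

Lemma Ck_sub k O O' f : O' `<=` O -> Ck k O f -> Ck k O' f.
Proof.
move=> sO; elim: k f => [|k IH] f [cf df]; split=> //; do ?by move=> x /sO /cf.
by move=> i; have [dfi cki] := df i; split; [move=> x /sO /dfi|exact: IH].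
Qed.

Lemma Ck_leS k O f : Ck k.+1 O f -> Ck k O f.
Proof.
elim: k f => [|k IH] f [cf df]; first by split.
by split=> // i; have [? ?] := df i; split => //; exact: IH.
Qed.

Lemma Ck_local k O f :
  (forall x, O x -> exists N, [/\ N x & Ck k N f]) -> Ck k O f.
Proof.
elim: k f => [|k IH] f H.
  by split=> //; move=> x /H [N [Nx [cf _]]]; exact: cf.
split=> [x /H [N [Nx [cf _]]]|i]; first exact: cf.
split=> [x /H [N [Nx [_ /(_ i) [df _]]]]|]; first exact: df.
by apply: IH => x /H [N [Nx [_ /(_ i) [_ ck]]]]; exists N.
Qed.

(** The induction step of the closure lemmas: the partial derivative may be replaced by any [g]
    equal to it on [O], so that the formula given by a product or chain rule can be fed to the
    induction hypothesis. *)
Lemma Ck_succ k O f : open O ->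
  (forall x, O x -> {for x, continuous f}) ->
  (forall i, exists2 g, Ck k O g & forall x, O x -> is_derive x 'e_i f (g x)) ->
  Ck k.+1 O f.
Proof.
move=> oO cf H; split=> // i; have [g ckg dfg] := H i; split.
  by move=> x /dfg [].
by apply: Ck_eq ckg => // x /dfg [].
Qed.

Lemma Ck_is_derive k O f i x : Ck k.+1 O f -> O x ->
  is_derive x 'e_i f ('D_('e_i) f x).
Proof. by move=> ckf Ox; split=> //; exact: Ck_derivable ckf Ox. Qed.

Lemma Ck_cst k O c : open O -> Ck k O (fun=> c).
Proof.
move=> oO; elim: k c => [|k IH] c.
  by split=> // x _; exact: cst_continuous.
apply: Ck_succ => // [x _|i]; first exact: cst_continuous.
by exists (fun=> 0) => // x _; exact: is_derive_cst.
Qed.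

Lemma Ck_add k O f g : open O -> Ck k O f -> Ck k O g ->
  Ck k O (fun x => f x + g x).
Proof.
move=> oO; elim: k f g => [|k IH] f g ckf ckg.
  split=> // x Ox; apply: (@continuousD _ _ _ f g).
    exact: Ck_continuous ckf Ox.
  exact: Ck_continuous ckg Ox.
apply: Ck_succ => // [x Ox|i].
  apply: (@continuousD _ _ _ f g).
    exact: Ck_continuous ckf Ox.
  exact: Ck_continuous ckg Ox.
exists (fun x => 'D_('e_i) f x + 'D_('e_i) g x).
  by apply: IH; exact: Ck_derive.
by move=> x Ox; apply: (@is_deriveD _ _ _ f g);
  [exact: Ck_is_derive ckf Ox|exact: Ck_is_derive ckg Ox].
Qed.

Lemma Ck_mul k O f g : open O -> Ck k O f -> Ck k O g ->
  Ck k O (fun x => f x * g x).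
Proof.
move=> oO; elim: k f g => [|k IH] f g ckf ckg.
  split=> // x Ox; apply: (@continuousM _ _ f g).
    exact: Ck_continuous ckf Ox.
  exact: Ck_continuous ckg Ox.
apply: Ck_succ => // [x Ox|i].
  apply: (@continuousM _ _ f g).
    exact: Ck_continuous ckf Ox.
  exact: Ck_continuous ckg Ox.
exists (fun x => f x * 'D_('e_i) g x + g x * 'D_('e_i) f x).
  apply: Ck_add => //; apply: IH; [exact: Ck_leS| exact: Ck_derive|
    exact: Ck_leS| exact: Ck_derive].
by move=> x Ox; apply: (@is_deriveM _ _ f g);
  [exact: Ck_is_derive ckf Ox|exact: Ck_is_derive ckg Ox].
Qed.

Lemma Ck_inv k O f : open O -> (forall x, O x -> f x != 0) -> Ck k O f ->
  Ck k O (fun x => (f x)^-1).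
Proof.
move=> oO f0; elim: k => [|k IH] ckf.
  split=> // x Ox; apply: (@continuousV _ _ f); first exact: f0.
  exact: Ck_continuous ckf Ox.
apply: Ck_succ => // [x Ox|i].
  apply: (@continuousV _ _ f); first exact: f0.
  exact: Ck_continuous ckf Ox.
exists (fun x => -1 * ((f x)^-1 * (f x)^-1) * 'D_('e_i) f x).
  have ck := IH (Ck_leS ckf).
  apply: Ck_mul => //; last exact: Ck_derive.
  by apply: Ck_mul => //; [exact: Ck_cst|exact: Ck_mul].
move=> x Ox; have df := Ck_derivable ckf Ox.
split; first by apply: derivableV => //; exact: f0.
rewrite deriveV //; last exact: f0.
by rewrite mulN1r -exprVn expr2.
Qed.

Lemma Ck_sum k O (I : Type) (r : seq I) (P : pred I) (F : I -> 'rV[R]_n -> R) :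
  open O -> (forall i, P i -> Ck k O (F i)) -> Ck k O (fun x => \sum_(i <- r | P i) F i x).
Proof.
move=> oO ckF; elim: r => [|i r IH].
  by apply: Ck_eq (Ck_cst k 0 oO) => // x _; rewrite big_nil.
case Pi: (P i); last by apply: Ck_eq IH => // x _; rewrite big_cons Pi.
apply: (Ck_eq oO (f := fun x => F i x + \sum_(j <- r | P j) F j x)).
  by move=> x _; rewrite big_cons Pi.
by apply: Ck_add => //; exact: ckF.
Qed.

Lemma is_derive_coord (i : 'I_n) (x v : 'rV[R]_n) :
  is_derive x v (fun x : 'rV[R]_n => x 0 i) (v 0 i).
Proof.
have e : (fun h : R => h^-1 *: (((fun x : 'rV[R]_n => x 0 i) \o shift x) (h *: v)
     - x 0 i)) @ 0^' --> v 0 i.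
  apply: cvg_near_cst; near=> h.
  rewrite /= !mxE addrK /GRing.scale /= mulrA mulVf ?mul1r //.
  by near: h; exact: nbhs_dnbhs_neq.
by split; [apply/cvg_ex; eexists; exact: e|exact: cvg_lim e].
Unshelve. all: by end_near. Qed.

Lemma derive_coord (i : 'I_n) (x v : 'rV[R]_n) :
  'D_v (fun x : 'rV[R]_n => x 0 i) x = v 0 i.
Proof. by have [] := is_derive_coord i x v. Qed.

Lemma Ck_coord k O i : open O -> Ck k O (fun x : 'rV[R]_n => x 0 i).
Proof.
move=> oO; have cc x : {for x, continuous (fun x : 'rV[R]_n => x 0 i)}.
  exact: coord_continuous.
case: k => [|k]; first by split.
apply: Ck_succ => // j; exists (fun=> ('e_j : 'rV[R]_n) 0 i).
  exact: Ck_cst.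
by move=> x _; exact: is_derive_coord.
Qed.

End Ck_closure.

(** [Ck] only speaks of partial derivatives, while the chain rule needs a total differential. The
    increment is split along the coordinate axes, and each piece is compared with the partial
    derivative at [a] by the mean value theorem and continuity of the partials. *)
Lemma C1_differentiable n (O : set 'rV[R]_n) (f : 'rV[R]_n -> R) a :
  open O -> Ck 1 O f -> O a -> differentiable f a.
Proof.
move=> oO ckf Oa.
pose L (h : 'rV[R]_n) : R := \sum_j h 0 j * 'D_('e_j) f a.
have lL : linear L.
  move=> k u v; rewrite /L scaler_sumr -big_split; apply: eq_bigr => j _ /=.
  by rewrite !mxE mulrDl /GRing.scale /= mulrA.
pose LL := GRing.isLinear.Build _ _ _ _ L lL.
pose Ll : {linear 'rV[R]_n -> R} := HB.pack L LL.
have cL : continuous Ll.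
  move=> x; have oT : open [set: 'rV[R]_n] by exact: openT.
  have : Ck 0 [set: 'rV[R]_n] L.
    apply: Ck_sum => // j _; apply: Ck_mul => //; first exact: Ck_coord.
    exact: Ck_cst.
  by move=> /Ck_continuous; exact.
have key e : 0 < e -> \forall h \near (0 : 'rV[R]_n),
    `|(f \o shift a - (cst (f a) + Ll)) h| <= e * `|h|.
  move=> e0.
  (* The [n] coordinate errors of relative size [e'] add up to at most [e]; [n.+1] keeps the divisor
     nonzero in dimension 0. *)
  pose e' := e / n.+1%:R.
  have e'0 : 0 < e' by rewrite divr_gt0.
  have : \forall y \near a, O y /\ forall j, `|'D_('e_j) f a - 'D_('e_j) f y| <= e'.
    apply: near_and; first exact: open_near.
    apply: near_forall => j.
    have [c _] := Ck_derive j ckf.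
    by have /cvgrPdist_le /(_ _ e'0) := c _ Oa.
  move=> /nbhs_ballP [d /= d0 dP].
  have dP' h : `|h| < d -> O (a + h) /\ forall j, `|'D_('e_j) f a - 'D_('e_j) f (a + h)| <= e'.
    move=> hd; apply: dP; rewrite -ball_normE /ball_ /=.
    by rewrite opprD addNKr normrN.
  have : \forall h \near (0 : 'rV[R]_n), `|h| < d.
    apply: filterS (nbhsx_ballx (0 : 'rV[R]_n) _ d0) => h.
    by rewrite -ball_normE /ball_ /= sub0r normrN.
  apply: filterS => h hd.
  (* The corners of the path from 0 to [h] along the axes: [p k] keeps the first [k] coordinates. *)
  pose p (k : nat) : 'rV[R]_n := \row_j (if (j < k)%N then h 0 j else 0).
  have pS (k : 'I_n) : p k.+1 = p k + h 0 k *: 'e_k.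
    apply/rowP => j; rewrite !mxE eqxx /= ltnS.
    have [->|jk] := eqVneq j k; first by rewrite leqnn ltnn mulr1 add0r.
    by rewrite mulr0 addr0 leq_eqVlt (negbTE (jk : val j != val k)).
  have pn : p n = h by apply/rowP => j; rewrite mxE ltn_ord.
  have p0 : p 0 = 0 by apply/rowP => j; rewrite !mxE.
  have pb (k : 'I_n) s : `|s| <= `|h 0 k| -> `|p k + s *: 'e_k| <= `|h|.
    move=> sh; apply: rV_norm_le => // j; rewrite !mxE eqxx /=.
    have [->|jk] := eqVneq j k.
      by rewrite ltnn add0r mulr1 (le_trans sh) // ler_norm_coord.
    by rewrite mulr0 addr0; case: ifP => _; rewrite ?normr0 // ler_norm_coord.
  have step (k : 'I_n) : `|f (a + p k.+1) - f (a + p k) - h 0 k * 'D_('e_k) f a|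
      <= e' * `|h|.
    have [s sh] : exists2 s, `|s| <= `|h 0 k| &
        f ((a + p k) + h 0 k *: 'e_k) - f (a + p k) = h 0 k * 'D_('e_k) f ((a + p k) + s *: 'e_k).
      apply: mvt_line => s sh; rewrite -addrA.
      apply: (Ck_derivable ckf); apply: (dP' _ _).1.
      by apply: le_lt_trans hd; exact: pb.
    have -> : a + p k.+1 = a + p k + h 0 k *: 'e_k by rewrite pS addrA.
    move=> ->; rewrite -mulrBr normrM mulrC.
    apply: ler_pM => //; last exact: ler_norm_coord.
    have hk : `|p k + s *: 'e_k| < d by apply: le_lt_trans hd; exact: pb.
    by have := (dP' _ hk).2 k; rewrite addrA distrC.
  have -> : (f \o shift a - (cst (f a) + Ll)) h =
      \sum_(k < n) (f (a + p k.+1) - f (a + p k) - h 0 k * 'D_('e_k) f a).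
    rewrite sumrB -/(L h).
    rewrite -(big_mkord xpredT (fun k => f (a + p k.+1) - f (a + p k))) telescope_sumr //.
    by rewrite pn p0 addr0 !fctE /= opprD addrA [h + a]addrC.
  apply: le_trans (ler_norm_sum _ _ _) _.
  apply: le_trans (ler_sum _ (fun k _ => step k)) _.
  rewrite sumr_const card_ord -[leLHS]mulr_natr mulrAC ler_wpM2r //.
  by rewrite /e' -mulrA ger_pMr // mulrC ler_pdivrMr // mul1r ler_nat.
have key' := (eqaddoP _ _ _ _).2 key.
by apply/diff_locallyP; rewrite (diff_unique cL key'); split.
Qed.

(** Only a directional derivative of [u] is available, so differentiability is applied to the curve
    [c] obtained by restricting [u] to the line through [x] in direction [v]. *)
Lemma derive_comp_curve (V W : normedModType R) (f : W -> R) (u : V -> W) x v :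
  differentiable f (u x) -> derivable u x v ->
  is_derive x v (f \o u) ('d f (u x) ('D_v u x)).
Proof.
move=> df du; pose c (t : R) := u (x + t *: v).
have c0 : c 0 = u x by rewrite /c scale0r addr0.
have ec : (fun h : R => h^-1 *: ((c \o shift 0) (h *: 1) - c 0)) =
     (fun h : R => h^-1 *: ((u \o shift x) (h *: v) - u x)).
  apply/funext => h; rewrite c0 /c /=; congr (_ *: (u _ - _)).
  by rewrite ?addr0 [h *: 1]mulr1 addrC.
have dc : derivable c 0 1 by rewrite /derivable ec.
have Dc : 'D_1 c 0 = 'D_v u x by rewrite /derive ec.
have dc' : differentiable c 0 by apply/derivable1_diffP.
have dfc : differentiable (f \o c) 0.
  by apply: differentiable_comp => //; rewrite c0.
have key : is_derive (0 : R) 1 (f \o c) ('d f (u x) ('D_v u x)).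
  split; first exact: diff_derivable.
  rewrite deriveE // diff_comp //; last by rewrite c0.
  by rewrite -Dc deriveE //= c0.
have e : (fun h : R => h^-1 *: (((f \o c) \o shift 0) (h *: 1) - (f \o c) 0)) =
     (fun h : R => h^-1 *: (((f \o u) \o shift x) (h *: v) - (f \o u) x)).
  apply/funext => h; rewrite /= c0 /c; congr (_ *: (f (u _) - _)).
  by rewrite ?addr0 [h *: 1]mulr1 addrC.
by case: key; rewrite /derivable /derive e; split.
Qed.

Lemma deriv_comp n (V : normedModType R) (O : set 'rV[R]_n) (f : 'rV[R]_n -> R)
    (u : V -> 'rV[R]_n) (x v : V) :
  open O -> Ck 1 O f -> O (u x) ->
  (forall j, derivable (fun y => u y 0 j) x v) ->
  is_derive x v (f \o u)
    (\sum_j 'D_('e_j) f (u x) * 'D_v (fun y => u y 0 j) x).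
Proof.
move=> oO ckf Ox du.
have df := C1_differentiable oO ckf Ox.
have du' : derivable u x v by apply/derivable_mxP => i j; rewrite ord1.
have Du : 'D_v u x = \row_j 'D_v (fun y => u y 0 j) x.
  by rewrite derive_mx //; apply/rowP => j; rewrite !mxE.
apply: is_derive_eq (derive_comp_curve df du') _.
rewrite Du [X in 'd _ _ X]row_sum_delta linear_sum; apply: eq_bigr => j _ /=.
by rewrite mxE [LHS]linearZ /= -(deriveE 'e_j df) /GRing.scale /= mulrC.
Qed.

(** Induction on [k] for all [f] at once, since the chain rule replaces [f] by its partial
    derivatives while [u] stays the same. *)
Lemma Ck_comp k n p (O : set 'rV[R]_n) (O' : set 'rV[R]_p) (f : 'rV[R]_p -> R)
    (u : 'rV[R]_n -> 'rV[R]_p) :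
  open O -> open O' -> (forall x, O x -> O' (u x)) ->
  Ck k O' f -> (forall j, Ck k O (fun x => u x 0 j)) -> Ck k O (f \o u).
Proof.
move=> oO oO' uO; elim: k f => [|k IH] f ckf cku.
  split=> // x Ox; apply: continuous_comp.
    by apply: rV_continuous => j; exact: Ck_continuous (cku j) Ox.
  exact: Ck_continuous ckf (uO _ Ox).
have cku' j : Ck k O (fun x => u x 0 j) by exact: Ck_leS.
apply: Ck_succ => // [x Ox|i].
  apply: continuous_comp.
    by apply: rV_continuous => j; exact: Ck_continuous (cku j) Ox.
  exact: Ck_continuous ckf (uO _ Ox).
exists (fun x => \sum_j 'D_('e_j) f (u x) * 'D_('e_i) (fun y => u y 0 j) x).
  apply: Ck_sum => // j _; apply: Ck_mul => //.
    by apply: (IH (fun y => 'D_('e_j) f y)) => //; exact: Ck_derive.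
  exact: Ck_derive.
move=> x Ox; apply: deriv_comp (uO _ Ox) _ => //.
  by move: ckf; clear; elim: k f => // k IH f /Ck_leS; exact: IH.
by move=> j; exact: Ck_derivable (cku j) Ox.
Qed.

Lemma distl_half (x y u e : R) :
  `|x - u| <= e / 2 -> `|y - u| <= e / 2 -> `|x - y| <= e.
Proof.
rewrite !ler_norml => /andP[? ?] /andP[? ?].
by apply/andP; split; lra.
Qed.

(** The second difference of [f] over a square of side [t] is symmetric in [i] and [j], and equals
    [t ^+ 2] times either mixed derivative at some point close to [a]. Continuity of the mixed
    derivatives at [a] then identifies them up to any [e]. *)
Lemma schwarz n (O : set 'rV[R]_n) (f : 'rV[R]_n -> R) a i j :
  open O -> Ck 2 O f -> O a ->
  'D_('e_i) (fun x => 'D_('e_j) f x) a = 'D_('e_j) (fun x => 'D_('e_i) f x) a.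
Proof.
move=> oO ckf Oa.
pose A k l y := 'D_('e_k) (fun x => 'D_('e_l) f x) y.
have Ac k l y : O y -> {for y, continuous (A k l)}.
  by apply: Ck_continuous; apply: Ck_derive; apply: Ck_derive ckf.
apply/eqP; rewrite -subr_eq0 -normr_le0; apply/ler_addgt0Pl => e e0; rewrite addr0.
pose e' := e / 2.
have e'0 : 0 < e' by rewrite divr_gt0.
have : \forall y \near a, O y /\ (`|A i j a - A i j y| <= e' /\ `|A j i a - A j i y| <= e').
  apply: near_and; first exact: open_near.
  by apply: near_and; [have /cvgrPdist_le /(_ _ e'0) := Ac i j _ Oa
    |have /cvgrPdist_le /(_ _ e'0) := Ac j i _ Oa].
move=> /nbhs_ballP [d /= d0 dP].
have dP' h : `|h| < d -> O (a + h) /\ (`|A i j a - A i j (a + h)| <= e' /\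
    `|A j i a - A j i (a + h)| <= e').
  move=> hd; apply: dP; rewrite -ball_normE /ball_ /=.
  by rewrite opprD addNKr normrN.
(* A third of the radius: two displacements of length at most [t] together stay strictly inside the
   ball of radius [d]. *)
pose t := d / 3.
have t0 : 0 < t by rewrite divr_gt0.
have sml k l s s' : `|s| <= `|t| -> `|s'| <= `|t| ->
    `|s *: ('e_k : 'rV[R]_n) + s' *: 'e_l| < d.
  rewrite (gtr0_norm t0) => st st'.
  apply: le_lt_trans (ler_normD _ _) _; rewrite !normrZ.
  have bd (s1 : R) k1 : `|s1| <= t -> `|s1| * `|'e_k1 : 'rV[R]_n| <= t.
    by move=> h; rewrite -[leRHS]mulr1 ler_pM // norm_delta_le.
  have := bd s k st; have := bd s' l st'.
  rewrite /t => h1 h2; move: d0; lra.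
(* The mean value theorem is used twice, first for the difference [g] in direction [k], then for its
   derivative in direction [l]. *)
have main k l : exists2 y, (exists2 h, `|h| < d & y = a + h) &
    f (a + t *: 'e_k + t *: 'e_l) - f (a + t *: 'e_k) - (f (a + t *: 'e_l) - f a)
    = t * (t * A l k y).
  pose g y := f (y + t *: 'e_l) - f y.
  have dg s : `|s| <= `|t| -> is_derive (a + s *: 'e_k) 'e_k g
      ('D_('e_k) f (a + s *: 'e_k + t *: 'e_l) - 'D_('e_k) f (a + s *: 'e_k)).
    move=> st; apply: (@is_deriveB _ _ _ (fun y => f (y + t *: 'e_l)) f).
      have dft : derivable f (a + s *: 'e_k + t *: 'e_l) 'e_k.
        rewrite -addrA; apply: (Ck_derivable ckf); apply: (dP' _ _).1.
        exact: sml.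
      have e1 : (fun h : R => h^-1 *: (((fun y => f (y + t *: 'e_l)) \o shift (a + s *: 'e_k))
            (h *: 'e_k)
          - f (a + s *: 'e_k + t *: 'e_l)))
          = (fun h : R => h^-1 *: ((f \o shift (a + s *: 'e_k + t *: 'e_l)) (h *: 'e_k)
            - f (a + s *: 'e_k + t *: 'e_l))).
        by apply/funext => h /=; rewrite !addrA.
      by split; rewrite /derivable /derive e1.
    apply: (Ck_is_derive _ ckf); apply: (dP' _ _).1.
    by have := @sml k k s 0 st; rewrite scale0r addr0; apply; rewrite normr0.
  have [s st] : exists2 s, `|s| <= `|t| & g (a + t *: 'e_k) - g a = t * 'D_('e_k) g (a + s *: 'e_k).
    by apply: mvt_line => s /dg [].
  rewrite (@derive_val _ _ _ _ _ _ _ (dg _ st)) /g => ->.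
  have [s' st'] : exists2 s', `|s'| <= `|t| &
      'D_('e_k) f (a + s *: 'e_k + t *: 'e_l) - 'D_('e_k) f (a + s *: 'e_k)
      = t * A l k (a + s *: 'e_k + s' *: 'e_l).
    apply: (@mvt_line _ (fun y => 'D_('e_k) f y)) => s' st'; rewrite -addrA.
    apply: (Ck_derivable (Ck_derive _ ckf)); apply: (dP' _ _).1.
    exact: sml.
  move=> ->; exists (a + s *: 'e_k + s' *: 'e_l) => //.
  by exists (s *: 'e_k + s' *: 'e_l); [exact: sml|rewrite addrA].
have [y1 [h1 h1d y1E] E1] := main i j.
have [y2 [h2 h2d y2E] E2] := main j i.
have : A j i y1 = A i j y2.
  have tn : t != 0 by rewrite gt_eqF.
  have swap (p q r w : R) : p - q - (r - w) = p - r - (q - w) by ring.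
  apply: (mulfI tn); apply: (mulfI tn).
  apply: etrans (esym E1) (etrans _ E2).
  by rewrite (addrAC a (t *: 'e_j)); exact: swap.
rewrite y1E y2E => EA.
have [_ [_]] := dP' _ h1d; have [_ [+ _]] := dP' _ h2d.
rewrite EA => b1 b2; exact: distl_half b1 b2.
Qed.

End Calculus.

(** * Smooth plateau functions *)

Section Bump.
Context {R : realType}.

(* The functions [flat k] vanish to infinite order at 0, and are closed under
   differentiation up to linear combination. *)
Definition flat (k : nat) (t : R) : R :=
  if 0 < t then t^-1 ^+ k * expR (- t^-1) else 0.

Lemma flat_gt0 k t : 0 < t -> 0 < flat k t.
Proof. by move=> t0; rewrite /flat t0 mulr_gt0 ?expR_gt0 ?exprn_gt0 ?invr_gt0. Qed.

Lemma flat_le0 k t : t <= 0 -> flat k t = 0.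
Proof. by move=> t0; rewrite /flat ltNge t0. Qed.

Lemma flat_ge0 k t : 0 <= flat k t.
Proof. by have [/(flat_le0 k) ->|/(flat_gt0 k)/ltW] := leP t 0. Qed.

(** The exponential of [t^-1] dominates its Taylor term of degree [k.+2]; the two spare powers leave
    [t ^+ 2], which makes the difference quotient at 0 tend to 0. *)
Lemma flat_bound k t : flat k t <= (k.+2)`!%:R * t ^+ 2.
Proof.
have [/(flat_le0 k) ->|t0] := leP t 0; first by rewrite mulr_ge0 // sqr_ge0.
have u0 : 0 < t^-1 by rewrite invr_gt0.
have f0 : 0 < (k.+2)`!%:R :> R by rewrite ltr0n fact_gt0.
rewrite /flat t0 expRN.
have h : t^-1 ^+ k.+2 / (k.+2)`!%:R <= expR t^-1.
  by apply: le_trans (expR_ge1Dxn k.+1 (ltW u0)); rewrite lerDr.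
rewrite ler_pdivrMr ?expR_gt0 //.
have -> : t^-1 ^+ k = (k.+2)`!%:R * t ^+ 2 * (t^-1 ^+ k.+2 / (k.+2)`!%:R).
  have -> : t^-1 ^+ k.+2 = t^-1 ^+ k * t^-1 ^+ 2 by rewrite -exprD addn2.
  have -> : t ^- 1 ^+ 2 = (t ^+ 2)^-1 by rewrite exprVn.
  by rewrite exprVn; field; rewrite !gt_eqF //= exprn_gt0.
by rewrite ler_wpM2l // mulr_ge0 ?sqr_ge0 // ltW.
Qed.

Lemma is_derive_flat k (t : R) :
  is_derive t 1 (flat k) (flat k.+2 t - k%:R * flat k.+1 t).
Proof.
have [t0|t0|->] := ltgtP t 0.
- rewrite !flat_le0 ?ltW // mulr0 subr0.
  apply: near_eq_is_derive (is_derive_cst (0 : R) t (1 : R)).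
  have : \forall y \near t, y < 0 by exact: lt_nbhsl.
  by apply: filterS => y y0; rewrite flat_le0 // ltW.
- have tn : t != 0 by rewrite gt_eqF.
  apply: (@near_eq_is_derive _ _ _
    ((fun y : R => y^-1) ^+ k * (expR \o (- (fun y : R => y^-1))))).
    have : \forall y \near t, 0 < y by exact: lt_nbhsr.
    by apply: filterS => y y0; rewrite /flat y0 !fctE.
  have dV : is_derive t 1 (fun y : R => y^-1) (- t ^- 2).
    have dt : derivable (@id R) t 1 by exact: derivable_id.
    split; first exact: derivableV.
    by rewrite deriveV // derive_id [LHS]mulr1.
  have dN : is_derive t 1 (- (fun y : R => y^-1)) (- (- t ^- 2)) by exact: is_deriveN.
  have dE := is_derive1_comp (is_derive_expR ((- (fun y : R => y^-1)) t)) dN.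
  apply: is_derive_eq (is_deriveM (is_deriveX k dV) dE) _.
  rewrite /flat t0 !fctE /GRing.scale /= -exprVn.
  set u := t^-1; set e := expR _.
  case: k => [|k]; first by rewrite !expr0; ring.
  by rewrite !exprS /=; ring.
rewrite !flat_le0 // mulr0 subr0.
suff h : h^-1 *: ((flat k \o shift 0) (h *: 1) - flat k 0) @[h --> 0^'] --> (0 : R).
  by split; [apply/cvg_ex; exists 0|exact: cvg_lim h].
set C : R := (k.+2)`!%:R.
have C0 : 0 < C by rewrite ltr0n fact_gt0.
apply/cvgrPdist_le => e e0; near=> h.
have hn : h != 0 by near: h; exact: nbhs_dnbhs_neq.
rewrite /= addr0 [h *: 1]mulr1 [flat k 0]flat_le0 // subr0 sub0r normrN.
rewrite /GRing.scale /= normrM normfV ger0_norm ?flat_ge0 //.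
rewrite mulrC ler_pdivrMr ?normr_gt0 //.
apply: le_trans (flat_bound k h) _.
have -> : h ^+ 2 = `|h| * `|h| by rewrite -normrM -expr2 ger0_norm // sqr_ge0.
rewrite -/C mulrA ler_wpM2r // mulrC -ler_pdivlMr //.
near: h; apply: dnbhs0_le; exact: divr_gt0.
Unshelve. all: by end_near. Qed.

Lemma Ck_flat_comp n (O : set 'rV[R]_n) (u : 'rV[R]_n -> R) j k : open O ->
  Ck k O u -> Ck k O (fun x => flat j (u x)).
Proof.
move=> oO.
have cf i (t : R) : {for t, continuous (flat i)}.
  apply: differentiable_continuous; apply/derivable1_diffP.
  by case: (is_derive_flat i t).
elim: k j => [|k IH] j cku.
  split=> // x Ox; apply: (@continuous_comp _ _ _ u (flat j)) => //.
  exact: Ck_continuous cku Ox.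
apply: Ck_succ => // [x Ox|i].
  apply: (@continuous_comp _ _ _ u (flat j)) => //.
  exact: Ck_continuous cku Ox.
exists (fun x => (flat j.+2 (u x) + (- j%:R) * flat j.+1 (u x)) * 'D_('e_i) u x).
  have cku' := Ck_leS cku.
  apply: Ck_mul => //; last exact: Ck_derive.
  apply: Ck_add => //; first exact: IH.
  by apply: Ck_mul => //; [exact: Ck_cst|exact: IH].
move=> x Ox.
have dF := is_derive_flat j (u x).
have df : differentiable (flat j) (u x) by apply/derivable1_diffP; case: dF.
have du := Ck_derivable (i := i) cku Ox.
apply: is_derive_eq (derive_comp_curve df du) _.
rewrite -[X in 'd _ _ X]mulr1 [LHS]linearZ /= -(deriveE (1 : R) df).
by rewrite (@derive_val _ _ _ _ _ _ _ dF) /GRing.scale /= mulrC mulNr.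
Qed.

Lemma plateau n (a : 'rV[R]_n) (O : set 'rV[R]_n) : open O -> O a ->
  exists (chi : 'rV[R]_n -> R) (K : set 'rV[R]_n),
  [/\ forall k, Ck k setT chi, compact K, K `<=` O,
      forall x, ~ K x -> chi x = 0 & \forall x \near a, chi x = 1].
Proof.
move=> oO Oa.
have /nbhs_ballP[e /= e0 eO] := open_near oO Oa.
(* Squared Euclidean distance to [a]: it is polynomial, hence smooth, unlike the sup norm that
   defines the balls. *)
pose N (x : 'rV[R]_n) := \sum_i (x 0 i - a 0 i) * (x 0 i - a 0 i).
(* [N x <= r] bounds each coordinate of [x - a] by [e / 2], which keeps the support strictly inside
   the ball of radius [e]. *)
pose r := e ^+ 2 / 4.
have r0 : 0 < r by rewrite divr_gt0 // exprn_gt0.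
have oT : open [set: 'rV[R]_n] by exact: openT.
have cc k i : Ck k setT (fun x : 'rV[R]_n => x 0 i - a 0 i).
  by apply: Ck_add => //; [exact: Ck_coord|exact: Ck_cst].
have ckN k : Ck k setT N.
  by apply: Ck_sum => // i _; apply: Ck_mul.
have Nc : continuous N by move=> x; exact: Ck_continuous (ckN 0) _.
have Na : N a = 0 by rewrite /N big1 // => i _; rewrite subrr mulr0.
have Ne x : N x <= r -> `|x - a| <= e / 2.
  move=> Nr; apply: rV_norm_le => [|i]; first by rewrite divr_ge0 // ltW.
  rewrite -(@ler_pXn2r _ 2) ?nnegrE ?divr_ge0 ?(ltW e0) // -normrX ger0_norm ?sqr_ge0 //.
  have -> : (e / 2) ^+ 2 = r by rewrite /r; field.
  apply: le_trans Nr; rewrite /N (bigD1 i) //= !mxE -expr2 lerDl.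
  by apply: sumr_ge0 => j _; rewrite -expr2 sqr_ge0.
pose K := [set x | N x <= r].
(* The denominator of the plateau function. It never vanishes, because [N x < r] or [N x > r / 2];
   where [N x <= r / 2] its second term is 0, so numerator and denominator agree there. *)
pose d x := flat 0 (r - N x) + flat 0 (N x - r / 2).
have dp x : 0 < d x.
  rewrite /d; have [h|h] := ltP (N x) r.
    by rewrite ltr_pwDl ?flat_ge0 // flat_gt0 // subr_gt0.
  rewrite ltr_wpDl ?flat_ge0 // flat_gt0 // subr_gt0 (lt_le_trans _ h) //.
  by rewrite ltr_pdivrMr // ltr_pMr // ltr1n.
exists (fun x => flat 0 (r - N x) * (d x)^-1), K; split.
- move=> k.
  have c1 : Ck k setT (fun x => flat 0 (r - N x)).
    apply: Ck_flat_comp => //.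
    apply: (Ck_eq oT (f := fun x => r + (-1) * N x)); first by move=> x _; ring.
    by apply: Ck_add => //; [exact: Ck_cst|apply: Ck_mul => //; exact: Ck_cst].
  have c2 : Ck k setT (fun x => flat 0 (N x - r / 2)).
    by apply: Ck_flat_comp => //; apply: Ck_add => //; exact: Ck_cst.
  apply: Ck_mul => //; apply: Ck_inv => //; last exact: Ck_add.
  by move=> x _; rewrite gt_eqF.
- apply: bounded_closed_compact.
    exists (`|a| + e / 2); split; first exact: num_real.
    move=> M HM x Kx; apply: le_trans (ltW HM).
    rewrite -[x](subrK a) addrC; apply: le_trans (ler_normD _ _) _.
    by rewrite lerD2l Ne.
  apply: (@closed_comp _ _ N [set y | y <= r]); last exact: closed_le.
  by move=> x _; exact: Nc.
- move=> x Kx; apply: eO; rewrite -ball_normE /ball_ /= distrC.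
  apply: le_lt_trans (Ne _ Kx) _.
  by rewrite ltr_pdivrMr // ltr_pMr // ltr1n.
- move=> x /negP; rewrite -ltNge => h; rewrite flat_le0 ?mul0r //.
  by rewrite subr_le0 ltW.
have : \forall x \near a, N x < r / 2.
  have h : 0 < r / 2 by rewrite divr_gt0.
  have := Nc a; rewrite /continuous_at Na => /cvgrPdist_lt /(_ _ h).
  apply: filterS => x; rewrite sub0r normrN; exact: le_lt_trans (ler_norm _).
apply: filterS => x h.
have e2 : flat 0 (N x - r / 2) = 0 by rewrite flat_le0 // subr_le0 ltW.
have := dp x; rewrite /d e2 addr0 => d0.
by rewrite mulfV // gt_eqF.
Qed.

End Bump.

(** * Smooth functions on manifolds *)

Section Manifold.
Context {R : realType}.

(** The axioms on charts and separation, in the form that is later re-established for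
    [prod_atlas]. *)
Definition atlas (M : topologicalType) n (A : set (chart R M n)) : Prop :=
  [/\ hausdorff_space M,
      forall p, exists2 c, A c & chart_dom c p,
      forall c, A c ->
        [/\ open (chart_dom c), open (chart_img c),
            forall p, chart_dom c p -> chart_inv c (chart_map c p) = p,
            forall p, chart_dom c p -> {for p, continuous (chart_map c)} &
            forall x, chart_img c x -> {for x, continuous (chart_inv c)}] &
      forall c d, A c -> A d -> forall i : 'I_n,
        smooth_on (chart_map c @` (chart_dom c `&` chart_dom d))
          (fun x => chart_map d (chart_inv c x) 0 i)].

Lemma smooth_manifold_atlas (M : topologicalType) n (A : set (chart R M n)) :
  smooth_manifold A -> atlas A.
Proof. by case. Qed.

Definition coord (M : Type) n (c : chart R M n) i (q : M) := chart_map c q 0 i.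

Definition pd (M : Type) n (c : chart R M n) i (h : M -> R) (q : M) : R :=
  'D_('e_i) (h \o chart_inv c) (chart_map c q).

Context {M : topologicalType} {n : nat} (A : set (chart R M n)) (hA : atlas A).
Implicit Types (c d : chart R M n) (p q : M) (h k : M -> R).

Lemma chart_ex p : exists2 c, A c & chart_dom c p.
Proof. by case: hA. Qed.

Section OneChart.
Context (c : chart R M n) (Ac : A c).

Lemma chart_domo : open (chart_dom c).
Proof. by have [_ _ /(_ c Ac) [? ? ? ? ?] _] := hA. Qed.

Lemma chart_imgo : open (chart_img c).
Proof. by have [_ _ /(_ c Ac) [? ? ? ? ?] _] := hA. Qed.

Lemma chart_mapK p : chart_dom c p -> chart_inv c (chart_map c p) = p.
Proof. by have [_ _ /(_ c Ac) [? ? h ? ?] _] := hA; exact: h. Qed.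

Lemma chart_map_continuous p : chart_dom c p -> {for p, continuous (chart_map c)}.
Proof. by have [_ _ /(_ c Ac) [? ? ? h ?] _] := hA; exact: h. Qed.

Lemma chart_inv_continuous x : chart_img c x -> {for x, continuous (chart_inv c)}.
Proof. by have [_ _ /(_ c Ac) [? ? ? ? h] _] := hA; exact: h. Qed.

Lemma chart_img_map p : chart_dom c p -> chart_img c (chart_map c p).
Proof. by move=> cp; exists p. Qed.

Lemma chart_invK x : chart_img c x ->
  chart_dom c (chart_inv c x) /\ chart_map c (chart_inv c x) = x.
Proof. by move=> [p cp <-]; rewrite chart_mapK. Qed.

Lemma near_chart_dom p : chart_dom c p -> \forall q \near p, chart_dom c q.
Proof. by move=> cp; apply: open_near => //; exact: chart_domo. Qed.

Lemma near_chart_map p (P : set 'rV[R]_n) : chart_dom c p ->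
  (\forall x \near chart_map c p, P x) -> \forall q \near p, P (chart_map c q).
Proof. by move=> /chart_map_continuous cc /cc. Qed.

Lemma near_chart_inv p (P : set M) : chart_dom c p ->
  (\forall q \near p, P q) -> \forall x \near chart_map c p, P (chart_inv c x).
Proof.
move=> cp nP; have := chart_inv_continuous (chart_img_map cp).
by rewrite /prop_for /continuous_at chart_mapK //; exact.
Qed.

Lemma near_chart_img p : chart_dom c p -> \forall x \near chart_map c p, chart_img c x.
Proof. by move=> cp; apply: open_near; [exact: chart_imgo|exact: chart_img_map]. Qed.

End OneChart.

Lemma transition_smooth c d i (k : nat) : A c -> A d ->
  Ck k (chart_map c @` (chart_dom c `&` chart_dom d))
    (fun x => chart_map d (chart_inv c x) 0 i).
Proof. by have [_ _ _ h] := hA => Ac Ad; exact: h. Qed.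

Lemma near_overlap c d p : A c -> A d -> chart_dom c p -> chart_dom d p ->
  \forall x \near chart_map c p, (chart_map c @` (chart_dom c `&` chart_dom d)) x.
Proof.
move=> Ac Ad cp dp.
have h1 := near_chart_img Ac cp.
have h2 := near_chart_inv Ac cp (near_chart_dom Ad dp).
apply: filterS (near_and h1 h2) => x [/(chart_invK Ac) [? e] ?].
by exists (chart_inv c x).
Qed.

Lemma nbhs_open (T : topologicalType) (x : T) (P : set T) :
  nbhs x P -> exists N, [/\ open N, N x & N `<=` P].
Proof. by rewrite nbhsE => -[N [oN Nx] NP]; exists N. Qed.

Lemma smooth_chart h c (k : nat) : smooth A h -> A c -> Ck k (chart_img c) (h \o chart_inv c).
Proof. by move=> sh Ac; exact: sh. Qed.

(** [smooth] asks about every chart. In another chart [d] the function is its expression in [c]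
    composed with a transition map, so one chart around each point is enough. *)
Lemma smooth_localP h :
  (forall p, exists c, [/\ A c, chart_dom c p &
     exists O, [/\ open O, O (chart_map c p) & smooth_on O (h \o chart_inv c)]]) ->
  smooth A h.
Proof.
move=> H d Ad k; apply: Ck_local => y dy.
have [dp yE] := chart_invK Ad dy.
set p := chart_inv d y in dp yE.
have [c [Ac cp [N' [oO Op sO]]]] := H p.
have h1 : \forall x \near y, (chart_map d @` (chart_dom d `&` chart_dom c)) x.
  by rewrite -yE; exact: near_overlap.
have h2 : \forall x \near y, N' (chart_map c (chart_inv d x)).
  rewrite -yE; apply: (near_chart_inv Ad dp (P := fun q => N' (chart_map c q))).
  by apply: near_chart_map => //; exact: open_near.
have [N [oN Ny NP]] := nbhs_open (near_and h1 h2).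
exists N; split=> //.
apply: (Ck_eq oN (f := (h \o chart_inv c) \o (fun x => chart_map c (chart_inv d x)))).
  move=> x /NP [[q [dq cq] <-] _] /=.
  by rewrite !(chart_mapK Ad) // (chart_mapK Ac).
apply: (Ck_comp oN oO) => [x /NP [] //| |j]; first exact: sO.
apply: Ck_sub (transition_smooth j k Ad Ac).
by move=> x /NP [].
Qed.

Lemma smooth_nearP h :
  (forall p, exists2 k, smooth A k & \forall q \near p, h q = k q) -> smooth A h.
Proof.
move=> H; apply: smooth_localP => p; have [c Ac cp] := chart_ex p.
exists c; split=> //; have [k sk hk] := H p.
have h1 := near_chart_inv Ac cp hk.
have [N [oO Op OP]] := nbhs_open (near_and h1 (near_chart_img Ac cp)).
exists N; split=> // j; apply: (Ck_eq oO (f := k \o chart_inv c)).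
  by move=> x /OP [].
apply: Ck_sub (smooth_chart j sk Ac).
by move=> x /OP [].
Qed.

Lemma smooth_cst (a : R) : smooth A (fun=> a).
Proof. by move=> c Ac k; apply: Ck_cst; exact: chart_imgo. Qed.

Lemma smooth_add h k : smooth A h -> smooth A k -> smooth A (fun p => h p + k p).
Proof.
by move=> sh sk c Ac j; apply: (Ck_add (chart_imgo Ac) (sh c Ac j) (sk c Ac j)).
Qed.

Lemma smooth_mul h k : smooth A h -> smooth A k -> smooth A (fun p => h p * k p).
Proof.
by move=> sh sk c Ac j; apply: (Ck_mul (chart_imgo Ac) (sh c Ac j) (sk c Ac j)).
Qed.

Lemma smooth_opp h : smooth A h -> smooth A (fun p => - h p).
Proof.
move=> sh; have := smooth_mul (smooth_cst (-1)) sh.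
by congr smooth; apply/funext => p; rewrite mulN1r.
Qed.

Lemma smooth_sub h k : smooth A h -> smooth A k -> smooth A (fun p => h p - k p).
Proof. by move=> sh sk; apply: smooth_add => //; exact: smooth_opp. Qed.

Lemma smooth_sum (I : Type) (r : seq I) (P : pred I) (F : I -> M -> R) :
  (forall i, P i -> smooth A (F i)) -> smooth A (fun p => \sum_(i <- r | P i) F i p).
Proof.
move=> sF c Ac k; apply: (Ck_sum r (F := fun i => F i \o chart_inv c)).
  exact: chart_imgo.
by move=> i Pi; exact: sF.
Qed.

Lemma smooth_prod (I : Type) (r : seq I) (P : pred I) (F : I -> M -> R) :
  (forall i, P i -> smooth A (F i)) -> smooth A (fun p => \prod_(i <- r | P i) F i p).
Proof.
move=> sF; elim: r => [|i r IH].
  have := smooth_cst 1; congr smooth.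
  by apply/funext => p; rewrite big_nil.
case Pi: (P i); last first.
  by move: IH; congr smooth; apply/funext => p; rewrite big_cons Pi.
have := smooth_mul (sF i Pi) IH; congr smooth.
by apply/funext => p; rewrite big_cons Pi.
Qed.

Lemma smooth_continuous h : smooth A h -> continuous h.
Proof.
move=> sh p; have [c Ac cp] := chart_ex p.
apply: (@near_eq_continuous _ _ ((h \o chart_inv c) \o chart_map c)).
  apply: filterS (near_chart_dom Ac cp) => q cq /=.
  by rewrite chart_mapK.
apply: continuous_comp; first exact: chart_map_continuous.
exact: Ck_continuous (smooth_chart 0 sh Ac) (chart_img_map cp).
Qed.

Lemma smooth_inv h : smooth A h -> (forall p, h p != 0) ->
  smooth A (fun p => (h p)^-1).
Proof.
move=> sh h0 c Ac k; apply: (Ck_inv (chart_imgo Ac)) (sh c Ac k).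
by move=> x _ /=.
Qed.

(** The last clause says more than vanishing off [O]: a product of [rho] with something smooth on
    [O] is smooth everywhere, because each point either lies in [O] or has a neighbourhood on which
    the product is 0. *)
Lemma bump p (O : set M) : (\forall q \near p, O q) ->
  exists rho, [/\ smooth A rho, \forall q \near p, rho q = 1 &
    forall q, O q \/ \forall q' \near q, rho q' = 0].
Proof.
move=> nO; have [c Ac cp] := chart_ex p.
have h1 := near_chart_inv Ac cp nO.
have [N [oN Np NP]] := nbhs_open (near_and h1 (near_chart_img Ac cp)).
have [chi [K [schi cK KN chi0 chi1]]] := plateau oN Np.
pose rho q := if `[< chart_dom c q >] then chi (chart_map c q) else 0.
pose L := chart_inv c @` K.
have KI x : K x -> chart_img c x by move=> /KN /NP [].
(* The image of the compact [K] is closed in all of [M] because [M] is Hausdorff; this is what makes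
   the extension by 0 smooth at points outside the chart. *)
have cL : closed L.
  apply: compact_closed; first by case: hA.
  apply: continuous_compact => //; apply: continuous_in_subspaceT => x.
  by rewrite inE => /KI; exact: chart_inv_continuous.
have LO q : L q -> O q /\ chart_dom c q.
  by move=> [x Kx <-]; split; [case: (NP _ (KN _ Kx))|case: (chart_invK Ac (KI _ Kx))].
have rho0 q : ~ L q -> rho q = 0.
  rewrite /rho; case: asboolP => // cq Lq; apply: chi0 => Kq; apply: Lq.
  by exists (chart_map c q) => //; rewrite chart_mapK.
have nL q : ~ L q -> \forall q' \near q, rho q' = 0.
  move=> Lq; have : \forall q' \near q, (~` L) q'.
    by apply: open_near => //; exact: closed_openC.
  by apply: filterS => q' /rho0.
exists rho; split.
- apply: smooth_localP => q; have [Lq|Lq] := pselect (L q).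
    have [_ cq] := LO _ Lq; exists c; split=> //; exists (chart_img c).
    split; [exact: chart_imgo|exact: chart_img_map|] => k.
    apply: (Ck_eq (chart_imgo Ac) (f := chi)).
      move=> x /(chart_invK Ac) [cx e] /=; rewrite /rho asboolT // e.
      by [].
    by apply: Ck_sub (schi k).
  have [d Ad dq] := chart_ex q; exists d; split=> //.
  have h2 := near_chart_inv Ad dq (nL _ Lq).
  have [N' [oO' O'p O'P]] := nbhs_open h2.
  exists N'; split=> // k; apply: (Ck_eq oO' (f := cst 0)).
    by move=> x /O'P /= ->.
  exact: Ck_cst.
- have := near_chart_map Ac cp chi1.
  move=> h2; apply: filterS (near_and h2 (near_chart_dom Ac cp)) => q [e cq].
  by rewrite /rho asboolT.
move=> q; have [/LO [Oq _]|Lq] := pselect (L q); first by left.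
by right; exact: nL.
Qed.

(** * Partial derivatives in a chart *)

Section PD.
Context (c : chart R M n) (Ac : A c).
Implicit Types (i j : 'I_n).

Lemma pd_derivable i h p : smooth A h -> chart_dom c p ->
  derivable (h \o chart_inv c) (chart_map c p) 'e_i.
Proof.
by move=> sh cp; apply: Ck_derivable (smooth_chart 1 sh Ac) (chart_img_map cp).
Qed.

Lemma pd_near i h k p : chart_dom c p -> (\forall q \near p, h q = k q) ->
  pd c i h p = pd c i k p.
Proof.
by move=> cp hk; apply: near_eq_derive; apply: near_chart_inv hk.
Qed.

Lemma pd_add i h k p : smooth A h -> smooth A k -> chart_dom c p ->
  pd c i (fun q => h q + k q) p = pd c i h p + pd c i k p.
Proof.
move=> sh sk cp.
exact: (deriveD (pd_derivable sh cp) (pd_derivable sk cp)).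
Qed.

Lemma pd_mul i h k p : smooth A h -> smooth A k -> chart_dom c p ->
  pd c i (fun q => h q * k q) p = h p * pd c i k p + k p * pd c i h p.
Proof.
move=> sh sk cp.
have dh : derivable (h \o chart_inv c) (chart_map c p) 'e_i by exact: pd_derivable.
have := deriveM dh (pd_derivable sk cp).
by rewrite /pd /= chart_mapK.
Qed.

Lemma pd_cst i (a : R) p : pd c i (fun=> a) p = 0.
Proof. exact: derive_cst. Qed.

Lemma pd_chart d i h p : A d -> smooth A h -> chart_dom c p -> chart_dom d p ->
  pd c i h p = \sum_j pd c i (coord d j) p * pd d j h p.
Proof.
move=> Ad sh cp dp.
pose u x := chart_map d (chart_inv c x).
have up : u (chart_map c p) = chart_map d p by rewrite /u chart_mapK.
have du j : derivable (fun x => u x 0 j) (chart_map c p) 'e_i.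
  apply: (Ck_derivable (transition_smooth j 1 Ac Ad)).
  by exists p.
have dI : chart_img d (u (chart_map c p)) by rewrite up; exact: chart_img_map.
have key := deriv_comp (chart_imgo Ad) (smooth_chart 1 sh Ad) dI du.
rewrite /pd.
have -> : 'D_('e_i) (h \o chart_inv c) (chart_map c p) =
   'D_('e_i) ((h \o chart_inv d) \o u) (chart_map c p).
  apply: near_eq_derive; apply: filterS (near_overlap Ac Ad cp dp).
  move=> x [q [cq dq] <-] /=; rewrite /u !(chart_mapK Ac) //.
  by rewrite (chart_mapK Ad).
rewrite (@derive_val _ _ _ _ _ _ _ key); apply: eq_bigr => j _.
by rewrite up mulrC.
Qed.

Lemma pd_coord i j p : chart_dom c p -> pd c i (coord c j) p = (i == j)%:R.
Proof.
move=> cp; rewrite /pd.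
have -> : 'D_('e_i) (coord c j \o chart_inv c) (chart_map c p) =
    'D_('e_i) (fun x : 'rV[R]_n => x 0 j) (chart_map c p).
  apply: near_eq_derive; apply: filterS (near_chart_img Ac cp) => x.
  by move=> /(chart_invK Ac) [_ e]; rewrite /coord /= e.
by rewrite derive_coord mxE eqxx /= eq_sym.
Qed.

(** The functions [k] and [l] stand for partial derivatives that agree with [pd] only near [p]: a
    partial derivative is meaningful on the chart domain only, and the frame fields reproduce it
    locally. *)
Lemma pd_schwarz i j h k l p : smooth A h -> chart_dom c p ->
  (\forall q \near p, k q = pd c j h q) -> (\forall q \near p, l q = pd c i h q) ->
  pd c i k p = pd c j l p.
Proof.
move=> sh cp hk hl.
have e a f : (\forall q \near p, f q = pd c a h q) -> forall b,
    pd c b f p = 'D_('e_b) (fun x => 'D_('e_a) (h \o chart_inv c) x) (chart_map c p).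
  move=> hf b; apply: near_eq_derive.
  apply: filterS (near_and (near_chart_inv Ac cp hf) (near_chart_img Ac cp)).
  by move=> x [/= -> /(chart_invK Ac) [_ e]]; rewrite /pd e.
rewrite (e _ _ hk) (e _ _ hl).
exact: schwarz (chart_imgo Ac) (smooth_chart 2 sh Ac) (chart_img_map cp).
Qed.

End PD.

End Manifold.

(** * Tangent vectors, vector fields and frames *)

Section Tangent.
Context {R : realType} {M : topologicalType} {n : nat}.
Context (A : set (chart R M n)) (hA : atlas A).
Implicit Types (c d : chart R M n) (p q : M) (h k : M -> R).
Implicit Types (X Y Z : operator R M) (u v : functional R M).

Lemma tangentE c p v : A c -> chart_dom c p -> tangent A p v ->
  exists a : 'rV[R]_n, forall h, v h =
    if `[< smooth A h >] then \sum_i a 0 i * pd c i h p else 0.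
Proof.
move=> Ac cp [d [Ad dp] [b vE]].
exists (\row_j \sum_i b 0 i * pd d i (coord c j) p) => h; rewrite vE.
case: asboolP => // sh.
under eq_bigr => i _.
  rewrite (_ : 'D_('e_i) _ _ = pd d i h p) // (pd_chart hA Ad i Ac sh dp cp).
  over.
rewrite (eq_bigr (fun i => \sum_j b 0 i * pd d i (coord c j) p * pd c j h p)).
  rewrite exchange_big; apply: eq_bigr => j _ /=.
  by rewrite mxE mulr_suml.
by move=> i _; rewrite mulr_sumr; apply: eq_bigr => j _; rewrite mulrA.
Qed.

Lemma tangentI c p (a : 'rV[R]_n) : A c -> chart_dom c p ->
  tangent A p (fun h => if `[< smooth A h >] then \sum_i a 0 i * pd c i h p else 0).
Proof. by move=> Ac cp; exists c => //; exists a. Qed.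

Section OneTangent.
Context (p : M) (v : functional R M) (hv : tangent A p v).

Lemma tangent_nonsmooth h : ~ smooth A h -> v h = 0.
Proof. by have [c [Ac cp] [a ->]] := hv => nh; rewrite asboolF. Qed.

Lemma tangent_near h k : smooth A h -> smooth A k ->
  (\forall q \near p, h q = k q) -> v h = v k.
Proof.
have [c [Ac cp] [a vE]] := hv => sh sk hk; rewrite !vE !asboolT //.
by apply: eq_bigr => i _; congr (_ * _); exact: (pd_near hA Ac).
Qed.

Lemma tangent_add h k : smooth A h -> smooth A k ->
  v (fun q => h q + k q) = v h + v k.
Proof.
have [c [Ac cp] [a vE]] := hv => sh sk; rewrite !vE !asboolT //.
  rewrite -big_split; apply: eq_bigr => i _ /=.
  transitivity (a 0 i * pd c i (fun q => h q + k q) p) => //.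
  by rewrite (pd_add Ac) // mulrDr.
exact: smooth_add.
Qed.

Lemma tangent_mul h k : smooth A h -> smooth A k ->
  v (fun q => h q * k q) = h p * v k + k p * v h.
Proof.
have [c [Ac cp] [a vE]] := hv => sh sk; rewrite !vE !asboolT //.
  rewrite !mulr_sumr -big_split; apply: eq_bigr => i _ /=.
  transitivity (a 0 i * pd c i (fun q => h q * k q) p) => //.
  rewrite (pd_mul hA Ac) // /pd; ring.
exact: smooth_mul.
Qed.

Lemma tangent_cst (a : R) : v (fun=> a) = 0.
Proof.
have [c [Ac cp] [b ->]] := hv; case: asboolP => // _.
by rewrite big1 // => i _; rewrite [X in _ * X](pd_cst c i a p) mulr0.
Qed.

Lemma tangent_scale (a : R) h : smooth A h -> v (fun q => a * h q) = a * v h.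
Proof.
move=> sh; rewrite (tangent_mul (smooth_cst hA a) sh) tangent_cst.
by rewrite mulr0 addr0.
Qed.

Lemma tangent_opp h : smooth A h -> v (fun q => - h q) = - v h.
Proof.
move=> sh; rewrite -mulN1r -tangent_scale //.
by congr v; apply/funext => q; rewrite mulN1r.
Qed.

Lemma tangent_sum (I : Type) (r : seq I) (F : I -> M -> R) :
  (forall i, smooth A (F i)) -> v (fun q => \sum_(i <- r) F i q) = \sum_(i <- r) v (F i).
Proof.
move=> sF; elim: r => [|i r IH].
  rewrite [RHS]big_nil; transitivity (v (fun=> 0)); last exact: tangent_cst.
  by congr v; apply/funext => q; rewrite big_nil.
rewrite big_cons -IH -tangent_add //; last exact: smooth_sum.
by congr v; apply/funext => q; rewrite big_cons.
Qed.

End OneTangent.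

Lemma tangent0 p : tangent A p (fun=> 0).
Proof.
have [c Ac cp] := chart_ex hA p.
have := tangentI (0 : 'rV[R]_n) Ac cp; congr tangent.
apply/funext => h; case: ifP => // _; rewrite big1 // => i _.
by rewrite mxE mul0r.
Qed.

Lemma tangent_lin p (a : R) u v : tangent A p u -> tangent A p v ->
  tangent A p (fun h => a * u h + v h).
Proof.
move=> tu tv; have [c Ac cp] := chart_ex hA p.
have [b uE] := tangentE Ac cp tu; have [b' vE] := tangentE Ac cp tv.
have := tangentI (a *: b + b') Ac cp; congr tangent.
apply/funext => h; rewrite uE vE; case: ifP => _; last by rewrite mulr0 addr0.
rewrite mulr_sumr -big_split; apply: eq_bigr => i _ /=.
by rewrite !mxE mulrDl mulrA.
Qed.

Lemma tangent_lincomb p (I : Type) (r : seq I) (a : I -> R) (w : I -> functional R M) :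
  (forall i, tangent A p (w i)) -> tangent A p (fun h => \sum_(i <- r) a i * w i h).
Proof.
move=> tw; elim: r => [|i r IH].
  by have := tangent0 p; congr tangent; apply/funext => h; rewrite big_nil.
have := tangent_lin (a i) (tw i) IH; congr tangent.
by apply/funext => h; rewrite big_cons.
Qed.

Lemma vfield_tangent X p : vfield A X -> tangent A p (at_point X p).
Proof. by case. Qed.

Lemma vfield_smooth X h : vfield A X -> smooth A h -> smooth A (X h).
Proof. by case => _; exact. Qed.

Lemma vfield_nonsmooth X h p : vfield A X -> ~ smooth A h -> X h p = 0.
Proof. by move=> /(vfield_tangent p) /tangent_nonsmooth; exact. Qed.

Lemma vfield_near X h k p : vfield A X -> smooth A h -> smooth A k ->
  (\forall q \near p, h q = k q) -> X h p = X k p.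
Proof. by move=> /(vfield_tangent p) /tangent_near h1 *; exact: h1. Qed.

Lemma vfield_add X h k p : vfield A X -> smooth A h -> smooth A k ->
  X (fun q => h q + k q) p = X h p + X k p.
Proof. by move=> /(vfield_tangent p) /tangent_add h1 *; exact: h1. Qed.

Lemma vfield_mul X h k p : vfield A X -> smooth A h -> smooth A k ->
  X (fun q => h q * k q) p = h p * X k p + k p * X h p.
Proof. by move=> /(vfield_tangent p) /tangent_mul h1 *; exact: h1. Qed.

Lemma vfield_cst X (a : R) p : vfield A X -> X (fun=> a) p = 0.
Proof. by move=> /(vfield_tangent p) /tangent_cst; exact. Qed.

Lemma vfield_sum X (I : Type) (r : seq I) (F : I -> M -> R) p : vfield A X ->
  (forall i, smooth A (F i)) ->
  X (fun q => \sum_(i <- r) F i q) p = \sum_(i <- r) X (F i) p.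
Proof. by move=> /(vfield_tangent p) /tangent_sum h1 *; exact: h1. Qed.

Lemma vfield_lincomb (I : Type) (r : seq I) (phi : I -> M -> R) (E : I -> operator R M) :
  (forall i, smooth A (phi i)) -> (forall i, vfield A (E i)) ->
  vfield A (fun h p => \sum_(i <- r) phi i p * E i h p).
Proof.
move=> sphi vE; split=> [p|h sh].
  apply: (@tangent_lincomb p I r (fun i => phi i p) (fun i => at_point (E i) p)).
  by move=> i; exact: vfield_tangent.
apply: smooth_sum => // i _; apply: smooth_mul => //.
exact: vfield_smooth.
Qed.

Lemma vfield_vadd X Y : vfield A X -> vfield A Y -> vfield A (vadd X Y).
Proof.
move=> vX vY; split=> [p|h sh].
  have := tangent_lin 1 (vfield_tangent p vX) (vfield_tangent p vY).
  by congr tangent; apply/funext => h; rewrite mul1r.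
by apply: smooth_add => //; exact: vfield_smooth.
Qed.

Lemma vfield_vscale phi X : smooth A phi -> vfield A X -> vfield A (vscale phi X).
Proof.
move=> sphi vX; split=> [p|h sh].
  have := tangent_lin (phi p) (vfield_tangent p vX) (tangent0 p).
  by congr tangent; apply/funext => h; rewrite addr0.
by apply: smooth_mul => //; exact: vfield_smooth.
Qed.

(** Fields and functions are global, but dual to each other only near [p]. The functions [xi] play
    the role of local coordinates, so that the coefficients of a tangent vector [v] are simply
    [v (xi i)]. *)
Definition frame_at p (E : 'I_n -> operator R M) (xi : 'I_n -> M -> R) : Prop :=
  [/\ forall i, vfield A (E i), forall i, smooth A (xi i) &
      \forall q \near p, (forall i j, E i (xi j) q = (i == j)%:R) /\
        forall v, tangent A q v -> v = (fun h => \sum_i v (xi i) * E i h q)].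

(** Coordinate fields and coordinate functions are multiplied by a bump function and extended by
    0. *)
Lemma chart_frame c p : A c -> chart_dom c p ->
  exists E xi, frame_at p E xi /\
    \forall q \near p, chart_dom c q /\
      forall i h, smooth A h -> E i h q = pd c i h q.
Proof.
move=> Ac cp; have [rho [srho rho1 rho0]] := bump hA (near_chart_dom hA Ac cp).
pose E (i : 'I_n) : operator R M := fun h q =>
  if `[< smooth A h >] then rho q * pd c i h q else 0.
pose xi (i : 'I_n) q := rho q * coord c i q.
have sxi i : smooth A (xi i).
  apply: smooth_localP => // q; have [cq|r0] := rho0 q.
    exists c; split=> //; exists (chart_img c).
    split; [exact: (chart_imgo hA Ac)|exact: chart_img_map|] => k.
    apply: (Ck_eq (chart_imgo hA Ac) (f := fun x => (rho \o chart_inv c) x * x 0 i)).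
      by move=> x /(chart_invK hA Ac) [_ e]; rewrite /xi /coord /= e.
    apply: (Ck_mul (chart_imgo hA Ac)); first exact: (smooth_chart k srho Ac).
    exact: (Ck_coord _ _ (chart_imgo hA Ac)).
  have [d Ad dq] := chart_ex hA q; exists d; split=> //.
  have [N [oN Nq NP]] := nbhs_open (near_chart_inv hA Ad dq r0).
  exists N; split=> // k; apply: (Ck_eq oN (f := cst 0)).
    by move=> x /NP; rewrite /xi /= => ->; rewrite mul0r.
  exact: Ck_cst.
have vE i : vfield A (E i).
  split=> [q|h sh].
    have [cq|r0] := rho0 q.
      have := tangentI (rho q *: 'e_i) Ac cq; congr tangent.
      apply/funext => h; rewrite /at_point /E; case: ifP => // _.
      rewrite (bigD1 i) //= !mxE !eqxx mulr1 big1 ?addr0 // => j ji.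
      by rewrite !mxE eqxx /= (negbTE ji) mulr0 mul0r.
    have := tangent0 q; congr tangent; apply/funext => h.
    by rewrite /at_point /E (nbhs_singleton r0) mul0r if_same.
  apply: smooth_localP => // q; have [cq|r0] := rho0 q.
    exists c; split=> //; exists (chart_img c).
    split; [exact: (chart_imgo hA Ac)|exact: chart_img_map|] => k.
    apply: (Ck_eq (chart_imgo hA Ac) (f := fun x => (rho \o chart_inv c) x *
        'D_('e_i) (h \o chart_inv c) x)).
      by move=> x /(chart_invK hA Ac) [_ e]; rewrite /E /= asboolT // /pd e.
    apply: (Ck_mul (chart_imgo hA Ac)); first exact: (smooth_chart k srho Ac).
    exact: Ck_derive (smooth_chart k.+1 sh Ac).
  have [d Ad dq] := chart_ex hA q; exists d; split=> //.
  have [N [oN Nq NP]] := nbhs_open (near_chart_inv hA Ad dq r0).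
  exists N; split=> // k; apply: (Ck_eq oN (f := cst 0)).
    by move=> x /NP; rewrite /E /= => ->; rewrite mul0r if_same.
  exact: Ck_cst.
(* Duality at [q] involves derivatives of [xi], so [rho] has to be 1 on a whole neighbourhood of
   [q], not only at [q]. *)
have near1 : \forall q \near p, chart_dom c q /\ \forall q' \near q, rho q' = 1.
  by apply: near_and; [exact: (near_chart_dom hA Ac)|exact: near_join].
have Eh q : (\forall q' \near q, rho q' = 1) -> forall i h, smooth A h ->
    E i h q = pd c i h q.
  by move=> r1 i h sh; rewrite /E asboolT // (nbhs_singleton r1) mul1r.
have pdxi q i j : chart_dom c q -> (\forall q' \near q, rho q' = 1) ->
    pd c i (xi j) q = (i == j)%:R.
  move=> cq r1; rewrite -(pd_coord hA Ac i j cq); apply: (pd_near hA Ac) => //.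
  by apply: filterS r1 => q'; rewrite /xi => ->; rewrite mul1r.
exists E, xi; split; last first.
  by apply: filterS near1 => q [cq /Eh ?].
split=> //; apply: filterS near1 => q [cq r1]; split=> [i j|v tv].
  by rewrite Eh // pdxi.
have [a va] := tangentE Ac cq tv; apply/funext => h; rewrite (va h).
case: asboolP => sh; last first.
  by rewrite big1 // => i _; rewrite vfield_nonsmooth // mulr0.
apply: eq_bigr => i _; rewrite (va (xi i)) asboolT // Eh //; congr (_ * _).
rewrite (bigD1 i) //= pdxi // eqxx mulr1 big1 ?addr0 // => j ji.
by rewrite pdxi // (negbTE ji) mulr0.
Qed.

Lemma frame_ex p : exists E xi, frame_at p E xi.
Proof.
have [c Ac cp] := chart_ex hA p.
by have [E [xi [fE _]]] := chart_frame Ac cp; exists E, xi.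
Qed.

(** A priori the bracket is a second-order operator. In a frame of coordinate fields its
    second-order part is symmetric, by equality of mixed partials, and cancels; what remains is the
    combination of the [E i] with coefficients [bracket X Y (xi i)]. *)
Lemma vfield_bracket X Y : vfield A X -> vfield A Y -> vfield A (bracket X Y).
Proof.
move=> vX vY; split=> [p|h sh]; last first.
  by apply: smooth_sub => //; do 2!apply: vfield_smooth => //.
have [c Ac cp] := chart_ex hA p.
have [E [xi [[vE sxi fE] nE]]] := chart_frame Ac cp.
have sE i h : smooth A h -> smooth A (E i h) by move=> sh; exact: vfield_smooth.
have dec Z h : vfield A Z -> smooth A h ->
    \forall q \near p, Z h q = \sum_i Z (xi i) q * E i h q.
  move=> vZ sh; apply: filterS fE => q [_ /(_ _ (vfield_tangent q vZ)) e].
  by rewrite -[LHS]/(at_point Z q h) e.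
have com i j h : smooth A h -> E i (E j h) p = E j (E i h) p.
  move=> sh; have [_ e] := nbhs_singleton nE.
  rewrite !e //; do ?exact: sE.
  apply: (pd_schwarz hA Ac sh) => //;
    by apply: filterS nE => q [_ e']; exact: e'.
have key V W h : vfield A V -> vfield A W -> smooth A h ->
    V (W h) p = \sum_i V (W (xi i)) p * E i h p +
      \sum_i \sum_j W (xi i) p * V (xi j) p * E j (E i h) p.
  move=> vV vW sh.
  have sW i : smooth A (W (xi i)) by exact: vfield_smooth.
  rewrite (vfield_near vV _ _ (dec W h vW sh)); first last.
  - by apply: smooth_sum => // i _; apply: smooth_mul => //; exact: sE.
  - exact: vfield_smooth.
  rewrite vfield_sum //; last by move=> i; apply: smooth_mul => //; exact: sE.
  rewrite -big_split; apply: eq_bigr => i _ /=.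
  rewrite vfield_mul //; last exact: sE.
  rewrite addrC [E i h p * _]mulrC; congr (_ + _).
  rewrite (nbhs_singleton (dec V (E i h) vV (sE _ _ sh))) mulr_sumr.
  by apply: eq_bigr => j _; rewrite mulrA.
have := @tangent_lincomb p _ (index_enum 'I_n) (fun i => bracket X Y (xi i) p)
  (fun i => at_point (E i) p) (fun i => vfield_tangent p (vE i)).
congr tangent; apply/funext => h; rewrite /at_point.
have [sh|nh] := pselect (smooth A h); last first.
  rewrite big1; last by move=> i _; rewrite (vfield_nonsmooth p (vE i) nh) mulr0.
  have z Z : vfield A Z -> Z h = (fun=> 0).
    by move=> vZ; apply/funext => q; exact: vfield_nonsmooth.
  by rewrite /bracket !z // !vfield_cst // subrr.
rewrite [RHS]/bracket !key //.
have -> : \sum_i \sum_j X (xi i) p * Y (xi j) p * E j (E i h) p =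
     \sum_i \sum_j Y (xi i) p * X (xi j) p * E j (E i h) p.
  rewrite exchange_big; apply: eq_bigr => i _; apply: eq_bigr => j _ /=.
  by rewrite com // [X _ _ * _]mulrC.
rewrite opprD addrACA subrr addr0 -sumrB; apply: eq_bigr => i _.
by rewrite /bracket mulrBl.
Qed.

Lemma vfield_extend p v : tangent A p v ->
  exists2 X, vfield A X & at_point X p = v.
Proof.
move=> tv; have [E [xi [vE sxi fE]]] := frame_ex p.
exists (fun h q => \sum_i (fun=> v (xi i)) q * E i h q).
  by apply: vfield_lincomb => // i; exact: smooth_cst.
by have [_ /(_ _ tv) e] := nbhs_singleton fE; exact: esym e.
Qed.

Definition linear_form (w : form1 R M) : Prop :=
  (forall X Y, vfield A X -> vfield A Y ->
     forall p, w (vadd X Y) p = w X p + w Y p) /\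
  (forall phi X, smooth A phi -> vfield A X ->
     forall p, w (vscale phi X) p = phi p * w X p).

Lemma linear_form_sum w (I : Type) (r : seq I) (phi : I -> M -> R)
    (E : I -> operator R M) p :
  linear_form w -> (forall i, smooth A (phi i)) -> (forall i, vfield A (E i)) ->
  w (fun h q => \sum_(i <- r) phi i q * E i h q) p = \sum_(i <- r) phi i p * w (E i) p.
Proof.
move=> [wD wZ] sphi vE; elim: r => [|i r IH].
  pose Z0 : operator R M := fun h q => \sum_(i <- [::]) phi i q * E i h q.
  have v0 : vfield A Z0 by exact: vfield_lincomb.
  (* The zero field equals 0 times itself, so homogeneity of [w] gives the value 0. *)
  rewrite [RHS]big_nil; transitivity (0 * w Z0 p); last by rewrite mul0r.
  rewrite -(wZ (fun=> 0)) //; last exact: smooth_cst.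
  by congr (w _ p); do 2!apply/funext => ?; rewrite /vscale /Z0 !big_nil mul0r.
rewrite big_cons -IH -wZ // -wD; first last.
- exact: vfield_lincomb.
- exact: vfield_vscale.
by congr (w _ p); do 2!apply/funext => ?; rewrite /vadd /vscale big_cons.
Qed.

(** The decomposition of [X] in the frame holds only near [p], whereas [w] is linear on global
    fields. Multiplication by a bump function turns it into an identity of global fields, to which
    linearity applies. *)
Lemma linear_form_frame w p E xi X : linear_form w -> frame_at p E xi ->
  vfield A X -> \forall q \near p, w X q = \sum_i X (xi i) q * w (E i) q.
Proof.
move=> lw [vE sxi fE] vX; have := near_join fE; apply: filterS => p' fE'.
have [rho [srho rho1 rho0]] := bump hA fE'.
have sX i : smooth A (fun q => rho q * X (xi i) q).
  by apply: smooth_mul => //; exact: vfield_smooth.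
have e : vscale rho X = (fun h q => \sum_i (rho q * X (xi i) q) * E i h q).
  apply/funext => h; apply/funext => q; rewrite /vscale.
  have [[_ /(_ _ (vfield_tangent q vX)) e]|r0] := rho0 q.
    rewrite -[X h q]/(at_point X q h) e mulr_sumr.
    by apply: eq_bigr => i _; rewrite mulrA.
  rewrite (nbhs_singleton r0) mul0r big1 // => i _.
  by rewrite !mul0r.
have r1 := nbhs_singleton rho1.
have [_ wZ] := lw.
have := wZ rho X srho vX p'; rewrite r1 mul1r => <-.
rewrite e linear_form_sum //; apply: eq_bigr => i _.
by rewrite r1 mul1r.
Qed.

(** Tensoriality: in a frame, the value at [p] involves a field only through its derivatives of the
    [xi i] at [p]. *)
Lemma linear_form_at w X Y p : linear_form w -> vfield A X -> vfield A Y ->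
  at_point X p = at_point Y p -> w X p = w Y p.
Proof.
move=> lw vX vY e; have [E [xi fE]] := frame_ex p.
rewrite (nbhs_singleton (linear_form_frame lw fE vX)).
rewrite (nbhs_singleton (linear_form_frame lw fE vY)).
apply: eq_bigr => i _; congr (_ * _).
by rewrite -[LHS]/(at_point X p (xi i)) e.
Qed.

End Tangent.

(** * Metrics and Koszul forms *)

Section Metric.
Context {R : realType} {M : topologicalType} {n : nat}.
Context (A : set (chart R M n)) (hA : atlas A).
Implicit Types (p q : M) (h k : M -> R).
Implicit Types (X Y Z P : operator R M) (u v : functional R M).

(** A field gives 0 on a function that is not smooth. Identities of operators, such as those for
    brackets, can therefore be proved for every [h]. *)
Lemma vfield_apply_smooth X h : vfield A X -> smooth A (X h).
Proof.
move=> vX; have [sh|nh] := pselect (smooth A h); first exact: vfield_smooth.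
have := smooth_cst hA 0; congr smooth; apply/funext => q.
by rewrite (vfield_nonsmooth q vX nh).
Qed.

Lemma bracket_vaddr Y Z Z' : vfield A Y -> vfield A Z -> vfield A Z' ->
  bracket Y (vadd Z Z') = vadd (bracket Y Z) (bracket Y Z').
Proof.
move=> vY vZ vZ'; apply/funext => h; apply/funext => p.
rewrite /bracket /vadd (vfield_add hA p vY); do ?exact: vfield_apply_smooth.
ring.
Qed.

Lemma bracket_vscaler Y phi Z : vfield A Y -> vfield A Z -> smooth A phi ->
  bracket Y (vscale phi Z) = vadd (vscale phi (bracket Y Z)) (vscale (Y phi) Z).
Proof.
move=> vY vZ sphi; apply/funext => h; apply/funext => p.
rewrite /bracket /vadd /vscale (vfield_mul hA p vY sphi); last exact: vfield_apply_smooth.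
ring.
Qed.

Lemma bracketC X Y : bracket X Y = vscale (fun=> -1) (bracket Y X).
Proof.
apply/funext => h; apply/funext => p; rewrite /bracket /vscale; ring.
Qed.

Context (g : tensor02 R M) (hg : sing_metric A g).

Lemma metricC p u v : tangent A p u -> tangent A p v -> g p u v = g p v u.
Proof. by have [+ _ _] := hg; apply. Qed.

Lemma metric_linl p (a : R) u u' v : tangent A p u -> tangent A p u' ->
  tangent A p v -> g p (fun h => a * u h + u' h) v = a * g p u v + g p u' v.
Proof. by have [_ + _] := hg; apply. Qed.

Lemma metric0l p v : tangent A p v -> g p (fun=> 0) v = 0.
Proof.
move=> tv; have t0 := tangent0 hA p.
have := metric_linl 1 t0 t0 tv; rewrite mul1r.
rewrite (_ : (fun h => _) = (fun=> 0)) => [e|]; last first.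
  by apply/funext => h; rewrite ?mul1r ?mulr0 addr0.
by move: e; lra.
Qed.

Lemma metric0r p v : tangent A p v -> g p v (fun=> 0) = 0.
Proof. by move=> tv; rewrite metricC //; [exact: metric0l|exact: tangent0]. Qed.

Lemma metric_suml p (I : Type) (r : seq I) (a : I -> R) (w : I -> functional R M) v :
  (forall i, tangent A p (w i)) -> tangent A p v ->
  g p (fun h => \sum_(i <- r) a i * w i h) v = \sum_(i <- r) a i * g p (w i) v.
Proof.
move=> tw tv; elim: r => [|i r IH].
  rewrite [RHS]big_nil -[RHS](metric0l tv); congr (g p _ v); apply/funext => h.
  by rewrite big_nil.
rewrite big_cons -IH -metric_linl //; last exact: tangent_lincomb.
by congr (g p _ v); apply/funext => h; rewrite big_cons.
Qed.

Lemma metric_sumr p (I : Type) (r : seq I) (a : I -> R) (w : I -> functional R M) v :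
  (forall i, tangent A p (w i)) -> tangent A p v ->
  g p v (fun h => \sum_(i <- r) a i * w i h) = \sum_(i <- r) a i * g p v (w i).
Proof.
move=> tw tv; rewrite metricC //; last exact: tangent_lincomb.
by rewrite metric_suml //; apply: eq_bigr => i _; rewrite metricC.
Qed.

Lemma smooth_inner X Y : vfield A X -> vfield A Y -> smooth A (inner g X Y).
Proof. by have [_ _] := hg; apply. Qed.

Lemma innerC X Y : vfield A X -> vfield A Y -> inner g X Y = inner g Y X.
Proof.
by move=> vX vY; apply/funext => p; apply: metricC; exact: vfield_tangent.
Qed.

Lemma inner_vaddl X X' Y : vfield A X -> vfield A X' -> vfield A Y ->
  inner g (vadd X X') Y = (fun p => inner g X Y p + inner g X' Y p).
Proof.
move=> vX vX' vY; apply/funext => p.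
have := metric_linl 1 (vfield_tangent p vX) (vfield_tangent p vX') (vfield_tangent p vY).
rewrite mul1r => <-; congr (g p _ _); apply/funext => h.
by rewrite mul1r.
Qed.

Lemma inner_vscalel phi X Y : vfield A X -> vfield A Y ->
  inner g (vscale phi X) Y = (fun p => phi p * inner g X Y p).
Proof.
move=> vX vY; apply/funext => p.
have := metric_linl (phi p) (vfield_tangent p vX) (tangent0 hA p) (vfield_tangent p vY).
rewrite (metric0l (vfield_tangent p vY)) addr0 => <-; congr (g p _ _).
by apply/funext => h; rewrite addr0.
Qed.

Lemma inner_vaddr X X' Y : vfield A X -> vfield A X' -> vfield A Y ->
  inner g Y (vadd X X') = (fun p => inner g Y X p + inner g Y X' p).
Proof.
move=> vX vX' vY; rewrite innerC //; last exact: vfield_vadd.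
by rewrite inner_vaddl //; apply/funext => p; rewrite !(innerC vY).
Qed.

Lemma inner_vscaler phi X Y : smooth A phi -> vfield A X -> vfield A Y ->
  inner g Y (vscale phi X) = (fun p => phi p * inner g Y X p).
Proof.
move=> sphi vX vY; rewrite innerC //; last exact: vfield_vscale.
by rewrite inner_vscalel //; apply/funext => p; rewrite (innerC vY).
Qed.

Lemma inner_bracketC X Y Z : vfield A X -> vfield A Y -> vfield A Z ->
  forall p, inner g Z (bracket X Y) p = - inner g Z (bracket Y X) p.
Proof.
move=> vX vY vZ p; rewrite bracketC inner_vscaler //; first by rewrite mulN1r.
  exact: smooth_cst.
exact: vfield_bracket.
Qed.

Lemma inner_lincombr (a b : M -> R) V W Z p : smooth A a -> smooth A b ->
  vfield A V -> vfield A W -> vfield A Z ->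
  inner g V (vadd (vscale a W) (vscale b Z)) p =
    a p * inner g V W p + b p * inner g V Z p.
Proof.
move=> sa sb vV vW vZ.
rewrite (inner_vaddr (vfield_vscale hA sa vW) (vfield_vscale hA sb vZ) vV).
by rewrite !inner_vscaler.
Qed.

Lemma smooth_koszul X Y Z : vfield A X -> vfield A Y -> vfield A Z ->
  smooth A (koszul g X Y Z).
Proof.
move=> vX vY vZ; have vb V W : vfield A V -> vfield A W -> vfield A (bracket V W).
  exact: vfield_bracket.
rewrite /koszul; apply: (smooth_mul hA); first exact: smooth_cst.
apply: (smooth_add hA); last by apply: smooth_inner => //; exact: vb.
apply: (smooth_add hA); last by apply: smooth_inner => //; exact: vb.
apply: smooth_sub => //; last by apply: smooth_inner => //; exact: vb.
apply: smooth_sub => //; last by apply: vfield_smooth => //; exact: smooth_inner.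
by apply: smooth_add => //; apply: vfield_smooth => //; exact: smooth_inner.
Qed.

(** The derivatives of [phi] produced by differentiating inner products cancel against those
    produced by the brackets. *)
Lemma linear_koszul X Y : vfield A X -> vfield A Y -> linear_form A (koszul g X Y).
Proof.
move=> vX vY; have vb V W : vfield A V -> vfield A W -> vfield A (bracket V W).
  exact: vfield_bracket.
split=> [Z Z' vZ vZ' p|phi Z sphi vZ p]; rewrite /koszul.
  rewrite (inner_vaddr vZ vZ' vY) (inner_vaddl vZ vZ' vX).
  rewrite (vfield_add hA p vX); do ?exact: smooth_inner.
  rewrite (vfield_add hA p vY); do ?exact: smooth_inner.
  rewrite (inner_vaddl vZ vZ' (vb _ _ vX vY)).
  rewrite (bracket_vaddr vY vZ vZ') (inner_vaddr (vb _ _ vY vZ) (vb _ _ vY vZ') vX).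
  rewrite !(@inner_bracketC _ X) //; last exact: vfield_vadd.
  rewrite (bracket_vaddr vX vZ vZ') (inner_vaddr (vb _ _ vX vZ) (vb _ _ vX vZ') vY).
  rewrite {1}/vadd; ring.
have vs W : vfield A W -> vfield A (vscale phi W) by exact: vfield_vscale.
have sX : smooth A (X phi) by exact: vfield_smooth.
have sY : smooth A (Y phi) by exact: vfield_smooth.
rewrite (inner_vscaler sphi vZ vY) (inner_vscalel phi vZ vX).
rewrite (vfield_mul hA p vX sphi); last exact: smooth_inner.
rewrite (vfield_mul hA p vY sphi); last exact: smooth_inner.
rewrite (inner_vscalel phi vZ (vb _ _ vX vY)).
rewrite !(@inner_bracketC _ X) //; last exact: vs.
rewrite !bracket_vscaler // !inner_lincombr //; do ?exact: vb.
rewrite (innerC vZ vX) {1}/vscale; ring.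
Qed.

Lemma linear_koszul_hat P X Y : vfield A P -> vfield A X -> vfield A Y ->
  linear_form A (koszul_hat g P X Y).
Proof.
move=> vP vX vY; have [kD kZ] := linear_koszul vX vY.
split=> [Z Z' vZ vZ' p|phi Z sphi vZ p]; rewrite /koszul_hat.
  rewrite kD // inner_vaddr //; ring.
rewrite kZ // inner_vscaler //; ring.
Qed.

Lemma smooth_koszul_hat P X Y Z : vfield A P -> vfield A X -> vfield A Y -> vfield A Z ->
  smooth A (koszul_hat g P X Y Z).
Proof.
move=> vP vX vY vZ; apply: smooth_add => //; first exact: smooth_koszul.
by apply: smooth_mul => //; exact: smooth_inner.
Qed.

(** Metric compatibility of the lower derivative. With the torsion identity below, it removes the
    derivatives of [gF] and the bracket from the curvatures with three vertical arguments and one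
    horizontal one. *)
Lemma koszul_metric X Y Z p : vfield A X -> vfield A Y -> vfield A Z ->
  X (inner g Y Z) p = koszul g X Y Z p + koszul g X Z Y p.
Proof.
move=> vX vY vZ; rewrite /koszul (innerC vZ vY) (innerC vX vY) (innerC vX vZ).
rewrite (inner_bracketC vZ vX) // (inner_bracketC vZ vY) // (inner_bracketC vY vX) //.
by field.
Qed.

Lemma koszul_torsion X Y Z p : vfield A X -> vfield A Y -> vfield A Z ->
  koszul g X Y Z p - koszul g Y X Z p = inner g (bracket X Y) Z p.
Proof.
move=> vX vY vZ; rewrite (innerC _ vZ); last exact: vfield_bracket.
rewrite /koszul (innerC vZ vX) (innerC vY vX) (innerC vZ vY).
rewrite (inner_bracketC vZ vX) // (inner_bracketC vZ vY) // (inner_bracketC vY vX) //.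
by field.
Qed.

(** Representatives of one form differ by radical vectors. One argument is exchanged at a time: the
    pairing is the value of one form on a field extending the representative of the other, whatever
    vector represents the first. *)
Lemma cometricE p u v (w w' : form1 R M) :
  represents A g p u w -> represents A g p v w' -> cometric A g w w' p = g p u v.
Proof.
move=> uw vw'; have ex : exists x, exists u v,
    [/\ represents A g p u w, represents A g p v w' & x = g p u v].
  by exists (g p u v), u, v.
rewrite /cometric; have [u' [v' [u'w v'w' ->]]] := xgetPex 0 ex.
have [tu uE] := uw; have [tv vE] := vw'.
have [tu' u'E] := u'w; have [tv' v'E] := v'w'.
have [X vX Xu'] := vfield_extend hA tu'; have [Y vY Yv] := vfield_extend hA tv.
rewrite metricC // -Xu' -v'E // vE // Xu' metricC // -Yv -u'E // uE //.
Qed.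

Definition dense_regular := forall (O : set M) p,
  (\forall q \near p, O q) -> exists2 q, O q & regular_point A g q.

(** Two candidates are continuous and agree on a dense set, so the one chosen by [smooth_extension]
    must be [k]. *)
Lemma smooth_extensionE k h : dense_regular -> smooth A k ->
  (forall p, regular_point A g p -> k p = h p) -> smooth_extension A g h = k.
Proof.
move=> dr sk kh.
have [sK KE] := xgetPex h
  (ex_intro (fun k => smooth A k /\ forall p, regular_point A g p -> k p = h p) k (conj sk kh)).
rewrite -/(smooth_extension A g h) in sK KE *.
set K := smooth_extension A g h in sK KE *.
apply/funext => p; apply/eqP; rewrite -subr_eq0; apply/negPn/negP => Kn.
have sD : smooth A (fun q => K q - k q) by exact: smooth_sub.
have cD := smooth_continuous hA sD.
have : \forall q \near p, `|K p - k p| / 2 < `|K q - k q|.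
  have e0 : 0 < `|K p - k p| / 2 by rewrite divr_gt0 // normr_gt0.
  have /cvgrPdist_lt /(_ _ e0) := cD p; apply: filterS => q hq.
  have := ler_distD 0 (K p - k p) (K q - k q).
  rewrite !subr0; set a := `|K p - k p| in hq *.
  have h1 := lerB_dist (K p - k p) (K q - k q).
  rewrite -/a in h1; move: hq h1; lra.
move=> /dr [q hq rq].
move: hq; rewrite (KE _ rq) (kh _ rq) subrr normr0 => hq.
have : 0 <= `|K p - k p| / 2 by rewrite divr_ge0.
by rewrite leNgt hq.
Qed.

End Metric.

(** * Sylvester's law of inertia *)

Section Inertia.
Context {R : realType}.

Definition congruent n (G H : 'M[R]_n) := exists2 P, P \in unitmx & P *m G *m P^T = H.

Lemma congruent_refl n (G : 'M[R]_n) : congruent G G.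
Proof. by exists 1%:M; rewrite ?unitmx1 // trmx1 mul1mx mulmx1. Qed.

Lemma congruent_trans n (G H K : 'M[R]_n) :
  congruent G H -> congruent H K -> congruent G K.
Proof.
move=> [P uP <-] [Q uQ <-]; exists (Q *m P); first by rewrite unitmx_mul uQ.
by rewrite trmx_mul !mulmxA.
Qed.

Lemma congruent_sym n (G H : 'M[R]_n) : G^T = G -> congruent G H -> H^T = H.
Proof. by move=> sG [P _ <-]; rewrite !trmx_mul trmxK sG mulmxA. Qed.

Lemma congruent_block n (a : 'M[R]_1) (D D' : 'M[R]_n) : congruent D D' ->
  congruent (block_mx a 0 0 D : 'M[R]_(1 + n)) (block_mx a 0 0 D').
Proof.
move=> [P uP <-]; exists (block_mx 1%:M 0 0 P).
  by rewrite unitmxE det_ublock det1 mul1r -unitmxE.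
rewrite tr_block_mx !trmx0 trmx1 !mulmx_block.
by rewrite !(mul0mx, mulmx0, mul1mx, mulmx1, addr0, add0r).
Qed.

(** A nonzero diagonal entry is moved to the corner by a transposition. If the diagonal is 0, adding
    row and column [j] to row and column [i] creates the diagonal entry [2 G i j], which is
    nonzero. *)
Lemma sym_pivot n (G : 'M[R]_n.+1) : G^T = G -> G != 0 ->
  exists2 H, congruent G H & H 0 0 != 0.
Proof.
move=> sG Gn.
have Gs i j : G i j = G j i by rewrite -[in LHS]sG mxE.
have step (H : 'M[R]_n.+1) i : H i i != 0 -> exists2 K : 'M[R]_n.+1, congruent H K & K 0 0 != 0.
  move=> Hi; exists (perm_mx (tperm 0 i) *m H *m (perm_mx (tperm 0 i))^T).
    by exists (perm_mx (tperm 0 i)) => //; exact: unitmx_perm.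
  rewrite -row_permE tr_perm_mx -col_permE !mxE tpermL.
  by [].
have [i Gi|Gd] := pickP (fun i => G i i != 0); first exact: step Gi.
have [[i j] /= Gij|G0] := pickP (fun ij : 'I_n.+1 * 'I_n.+1 => G ij.1 ij.2 != 0); last first.
  case/negP: Gn; apply/eqP/matrixP => i j; rewrite mxE.
  by have /negbFE/eqP := G0 (i, j).
have ij : i != j by apply: contraNneq Gij => ->; have /negbFE := Gd j.
pose P : 'M[R]_n.+1 := 1%:M + delta_mx i j.
have uP : P \in unitmx.
  have h : P *m (1%:M - delta_mx i j) = 1%:M.
    rewrite /P mulmxDl !mulmxBr !mul1mx mulmx1 mul_delta_mx_0 1?eq_sym //.
    by rewrite subr0 subrK.
  by have [] := mulmx1_unit h.
have cP : congruent G (P *m G *m P^T) by exists P.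
suff : (P *m G *m P^T) i i != 0.
  by move=> /step [K cK K0]; exists K => //; exact: congruent_trans cK.
have rP : row i P = 'e_i + 'e_j.
  by apply/rowP => k; rewrite !mxE !eqxx /= eq_sym.
have -> : (P *m G *m P^T) i i = (row i P *m G *m (row i P)^T) 0 0.
  by rewrite -row_mul !mxE; apply: eq_bigr => k _; rewrite !mxE.
have tE : ('e_i + 'e_j : 'rV[R]_n.+1)^T = delta_mx i 0 + delta_mx j 0.
  by rewrite linearD /= !trmx_delta.
rewrite rP tE mulmxDl mulmxDr !mulmxDl.
have E k l : ('e_k *m G *m delta_mx l 0 : 'M[R]_1) 0 0 = G k l.
  by rewrite -rowE -colE !mxE.
have z k : G k k = 0 by have /negbFE/eqP := Gd k.
have D (a b c d : 'M[R]_1) : (a + b + (c + d)) 0 0 = a 0 0 + b 0 0 + (c 0 0 + d 0 0).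
  by rewrite !mxE.
rewrite D !E !z add0r addr0 (Gs j i) -mulr2n mulrn_eq0 negb_or /=.
exact: Gij.
Qed.

Lemma sym_diag n (G : 'M[R]_n) : G^T = G -> exists d, congruent G (diag_mx d).
Proof.
elim: n G => [|n IH] G sG.
  exists 0; have -> : diag_mx 0 = G by apply/matrixP => -[].
  exact: congruent_refl.
have [->|Gn] := eqVneq G 0; first by exists 0; rewrite linear0; exact: congruent_refl.
have [H cH H0] := sym_pivot sG Gn.
have sH := congruent_sym sG cH.
pose H' : 'M[R]_(1 + n) := H.
pose a := ulsubmx H'; pose r := ursubmx H'; pose D := drsubmx H'.
have rT : dlsubmx H' = r^T by rewrite /r trmx_ursub (sH : H'^T = H').
have HE : H' = block_mx a r r^T D by rewrite -rT submxK.
have sD : D^T = D by rewrite trmx_drsub (sH : H'^T = H').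
have aE : a = (H 0 0)%:M.
  by rewrite [LHS]mx11_scalar !mxE; congr (H _ _)%:M; apply: val_inj.
pose k := (H 0 0)^-1.
(* One step of symmetric elimination: it clears the first row and column outside the corner and
   leaves the Schur complement [D']. *)
pose P : 'M[R]_(1 + n) := block_mx 1%:M 0 (- (k *: r^T)) 1%:M.
have uP : P \in unitmx by rewrite unitmxE det_lblock !det1 mulr1 unitr1.
pose D' := D - k *: (r^T *m r).
have PE : P *m H' *m P^T = block_mx a 0 0 D'.
  have tE : (- (k *: r^T))^T = - (k *: r) by apply/matrixP => ? ?; rewrite !mxE.
  rewrite HE /P tr_block_mx !trmx0 !trmx1 tE !mulmx_block.
  rewrite !(mul0mx, mulmx0, mul1mx, mulmx1, addr0, add0r).
  have e1 : a *m - (k *: r) + r = 0.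
    by rewrite aE mul_scalar_mx scalerN scalerA divff // scale1r addNr.
  have e2 : - (k *: r^T) *m a + r^T = 0.
    by rewrite aE mul_mx_scalar scalerN scalerA divff // scale1r addNr.
  rewrite e1 e2 mul0mx add0r; congr block_mx.
  by rewrite mulNmx -scalemxAl addrC.
have sD' : D'^T = D'.
  by rewrite /D' linearB linearZ /= trmx_mul trmxK sD.
have [d cd] := IH D' sD'.
exists (row_mx a d).
have -> : diag_mx (row_mx a d) = block_mx a 0 0 (diag_mx d) :> 'M[R]_(1 + n).
  rewrite diag_mx_row; congr block_mx.
  by rewrite aE; apply/matrixP => i j; rewrite !ord1 !mxE eqxx.
apply: congruent_trans cH _; apply: (@congruent_trans _ _ (block_mx a 0 0 D')).
  by exists P.
exact: congruent_block.
Qed.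

Definition qform n (G : 'M[R]_n) (x : 'rV[R]_n) : R := (x *m G *m x^T) 0 0.

Lemma qform_diag n (d x : 'rV[R]_n) : qform (diag_mx d) x = \sum_i d 0 i * x 0 i ^+ 2.
Proof.
rewrite /qform mul_mx_diag !mxE; apply: eq_bigr => i _.
by rewrite !mxE expr2 mulrAC mulrC mulrA.
Qed.

Lemma qform_congruent n (G P : 'M[R]_n) x : qform (P *m G *m P^T) x = qform G (x *m P).
Proof. by rewrite /qform trmx_mul !mulmxA. Qed.

Definition npos n (d : 'rV[R]_n) := #|[pred i | 0 < d 0 i]|.
Definition nneg n (d : 'rV[R]_n) := #|[pred i | d 0 i < 0]|.

(** The form is positive on a subspace of dimension [#|I|] and nonpositive on one of codimension
    [npos d']; a larger [I] would force a common nonzero vector. Positivity on a coordinate subspace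
    is assumed, instead of diagonality, so that perturbations of a diagonal form are covered too. *)
Lemma inertia_le n (G P P' : 'M[R]_n) (I : {set 'I_n}) d' :
  P \in unitmx -> P' \in unitmx -> P' *m G *m P'^T = diag_mx d' ->
  (forall x : 'rV[R]_n, x != 0 -> (forall i, i \notin I -> x 0 i = 0) ->
     0 < qform (P *m G *m P^T) x) ->
  (#|I| <= npos d')%N.
Proof.
move=> uP uP' PG' pos; rewrite leqNgt; apply/negP => lt.
pose J := finset (fun i => 0 < d' 0 i).
have nJ : npos d' = #|J| by rewrite /npos cardsE.
pose E : 'M[R]_(#|I|, n) := \matrix_(i, j) (enum_val i == j)%:R.
pose B : 'M[R]_(#|I|, #|J|) := \matrix_(i, j) (E *m P *m invmx P') i (enum_val j).
have : kermx B != 0.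
  rewrite -mxrank_eq0 mxrank_ker subn_eq0 -ltnNge.
  by apply: leq_ltn_trans (rank_leq_col B) _; rewrite -nJ.
move=> /rowV0Pn [y /sub_kermxP yB yn].
pose x := y *m E.
have xE i : i \in I -> forall Ii : i \in I, x 0 i = y 0 (enum_rank_in Ii i).
  move=> _ Ii; rewrite mxE (bigD1 (enum_rank_in Ii i)) //= mxE enum_rankK_in // eqxx mulr1.
  rewrite big1 ?addr0 // => j jn; rewrite mxE; case: eqP => [e|]; last by rewrite mulr0.
  by case/eqP: jn; apply: enum_val_inj; rewrite e enum_rankK_in.
have x0 i : i \notin I -> x 0 i = 0.
  move=> Ii; rewrite mxE big1 // => j _; rewrite mxE; case: eqP => [e|]; last by rewrite mulr0.
  by case/negP: Ii; rewrite -e enum_valP.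
have xn : x != 0.
  apply: contra_neq yn => x00; apply/rowP => j.
  have Ij := enum_valP j; have := xE _ Ij Ij.
  by rewrite enum_valK_in x00 !mxE => <-.
have := pos x xn x0.
pose z := x *m P *m invmx P'.
have -> : qform (P *m G *m P^T) x = qform (P' *m G *m P'^T) z.
  by rewrite !qform_congruent /z mulmxKV.
rewrite PG' qform_diag; apply/negP; rewrite -leNgt; apply: sumr_le0 => i _.
have [di|di] := ltP 0 (d' 0 i); last by rewrite mulr_le0_ge0 // sqr_ge0.
have Ji : i \in J by rewrite inE.
have -> : z 0 i = 0; last by rewrite expr0n mulr0.
have <- : (y *m B) 0 (enum_rank_in Ji i) = z 0 i.
  rewrite /z /x -!mulmxA mxE [RHS]mxE; apply: eq_bigr => k _.
  by rewrite mxE enum_rankK_in // !mulmxA.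
by rewrite yB mxE.
Qed.

Lemma qform_stable n (d : 'rV[R]_n) : exists2 e, 0 < e &
  forall H : 'M[R]_n, (forall i j, `|H i j - diag_mx d i j| <= e) ->
  forall x : 'rV[R]_n, x != 0 -> (forall i, ~~ (0 < d 0 i) -> x 0 i = 0) -> 0 < qform H x.
Proof.
(* The least positive diagonal entry, capped by 1; the cap serves as default when there is no
   positive entry. *)
pose m : R := \big[Order.min/1]_(i | 0 < d 0 i) d 0 i.
have m0 : 0 < m by apply/bigmin_gtP; split.
have md i : 0 < d 0 i -> m <= d 0 i by move=> h; exact: bigmin_le_cond.
(* With [S] the squared Euclidean length of [x], an entrywise perturbation by [e] changes the form
   by at most [e * n * S], and this has to stay strictly below [m * S]. *)
exists (m / n.+1%:R); first by rewrite divr_gt0.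
set e := m / _ => H He x xn xs.
pose S := \sum_i x 0 i ^+ 2.
have S0 : 0 < S.
  have [i xi] : exists i, x 0 i != 0.
    apply/existsP; apply: contraNT xn; rewrite negb_exists => /forallP h.
    by apply/eqP/rowP => i; rewrite mxE; have /negPn/eqP := h i.
  rewrite /S (bigD1 i) //= ltr_pwDl ?exprn_even_gt0 //.
  by apply: sumr_ge0 => j _; exact: sqr_ge0.
have e0 : 0 < e by rewrite divr_gt0.
pose D := H - diag_mx d.
have -> : qform H x = qform (diag_mx d) x + qform D x.
  have HE : H = diag_mx d + D by rewrite /D addrC subrK.
  by rewrite {1}HE /qform mulmxDr mulmxDl mxE.
have h1 : m * S <= qform (diag_mx d) x.
  rewrite qform_diag /S mulr_sumr; apply: ler_sum => i _.
  have [di|di] := boolP (0 < d 0 i); last by rewrite xs // expr0n !mulr0.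
  by rewrite ler_wpM2r ?sqr_ge0 // md.
have h2 : - (e * n%:R * S) <= qform D x.
  have -> : qform D x = \sum_i \sum_j x 0 j * D j i * x 0 i.
    rewrite /qform mxE; apply: eq_bigr => i _; rewrite mxE mulr_suml.
    by rewrite mxE; apply: eq_bigr.
  (* The bound is spread over the entries: by the arithmetic-geometric inequality each product of
     two coordinates is at most half the sum of their squares. *)
  have -> : - (e * n%:R * S) = \sum_(i < n) \sum_(j < n) - (e * ((x 0 j ^+ 2 + x 0 i ^+ 2) / 2)).
    transitivity (\sum_(i < n) - (e * ((S + n%:R * x 0 i ^+ 2) / 2))).
      rewrite sumrN -mulr_sumr -mulr_suml big_split /= sumr_const card_ord -mulr_sumr -/S.
      by rewrite -mulr_natl; field.
    apply: eq_bigr => i _; rewrite sumrN -mulr_sumr -mulr_suml big_split /= -/S.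
    have -> // : \sum_(j < n) x 0 i ^+ 2 = n%:R * x 0 i ^+ 2.
    by rewrite sumr_const card_ord mulr_natl.
  apply: ler_sum => i _; apply: ler_sum => j _.
  have : `|x 0 j * D j i * x 0 i| <= e * ((x 0 j ^+ 2 + x 0 i ^+ 2) / 2).
    rewrite !normrM mulrAC mulrC.
    have b1 : `|D j i| <= e by rewrite !mxE; have := He j i; rewrite !mxE.
    apply: ler_pM => //.
    rewrite -[X in _ <= (X + _) / 2]real_normK ?num_real //.
    rewrite -[X in _ <= (_ + X) / 2]real_normK ?num_real //.
    have := sqr_ge0 (`|x 0 j| - `|x 0 i|).
    by rewrite ler_pdivlMr //; nra.
  by rewrite ler_norml => /andP[].
apply: lt_le_trans (lerD h1 h2).
rewrite -mulrBl mulr_gt0 // subr_gt0 /e.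
by rewrite mulrAC ltr_pdivrMr // ltr_pM2l // ltr_nat.
Qed.

Definition signature n (G : 'M[R]_n) (s t : nat) : Prop :=
  exists P d, [/\ P \in unitmx, P *m G *m P^T = diag_mx d, npos d = s & nneg d = t].

Lemma signature_ex n (G : 'M[R]_n) : G^T = G -> exists s t, signature G s t.
Proof.
by move=> /sym_diag [d [P uP e]]; exists (npos d), (nneg d), P, d.
Qed.

Lemma signature_opp n (G : 'M[R]_n) s t : signature G s t -> signature (- G) t s.
Proof.
move=> [P [d [uP e <- <-]]]; exists P, (- d); split=> //.
- by rewrite mulmxN mulNmx e linearN.
- by apply: eq_card => i; rewrite !inE mxE oppr_gt0.
- by apply: eq_card => i; rewrite !inE mxE oppr_lt0.
Qed.

Lemma signature_le n (G : 'M[R]_n) s t : signature G s t -> (s + t <= n)%N.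
Proof.
move=> [P [d [_ _ <- <-]]].
rewrite -[X in (_ <= X)%N](card_ord n) /npos /nneg -cardUI.
rewrite [X in (_ + X)%N]eq_card0 ?addn0 ?max_card // => i.
by rewrite !inE; apply/negP => /andP[h /(lt_trans h)]; rewrite ltxx.
Qed.

Lemma signature_near_pos (T : topologicalType) n (G : T -> 'M[R]_n) q s t :
  (forall i j, {for q, continuous (fun r => G r i j)}) -> signature (G q) s t ->
  \forall r \near q, forall s' t', signature (G r) s' t' -> (s <= s')%N.
Proof.
move=> cG [P [d [uP e <- _]]].
have [e0 e00 key] := qform_stable d.
pose H r := P *m G r *m P^T.
have csum (I : finType) (F : I -> T -> R) :
    (forall i, {for q, continuous (F i)}) -> {for q, continuous (fun r => \sum_i F i r)}.
  move=> cF; rewrite /prop_for /continuous_at; elim: (index_enum I) => [|i l IH].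
    rewrite big_nil; under eq_fun do rewrite big_nil; exact: cvg_cst.
  rewrite big_cons; under eq_fun do rewrite big_cons.
  by apply: cvgD => //; exact: cF.
have cH i j : {for q, continuous (fun r => H r i j)}.
  have -> : (fun r => H r i j) = (fun r => \sum_k (\sum_l P i l * G r l k) * P j k).
    apply/funext => r; rewrite !mxE; apply: eq_bigr => k _.
    by rewrite !mxE.
  apply: (csum _) => k; apply: cvgM; last exact: cvg_cst.
  apply: (csum _) => l; apply: cvgM; first exact: cvg_cst.
  exact: cG.
have : \forall r \near q, forall ij : 'I_n * 'I_n, `|H q ij.1 ij.2 - H r ij.1 ij.2| <= e0.
  apply: near_forall => -[i j] /=.
  by have /cvgrPdist_le /(_ _ e00) := cH i j.
apply: filterS => r Hr s' t' [P' [d' [uP' e' <- _]]].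
have -> : npos d = #|finset (fun i => 0 < d 0 i)| by rewrite /npos cardsE.
apply: (inertia_le uP uP' e') => x xn xs; apply: (key (H r)) => //.
  by move=> i j; rewrite -e distrC; exact: (Hr (i, j)).
by move=> i di; apply: xs; rewrite inE.
Qed.

Lemma signature_near (T : topologicalType) n (G : T -> 'M[R]_n) q s t :
  (forall i j, {for q, continuous (fun r => G r i j)}) -> signature (G q) s t ->
  \forall r \near q, forall s' t', signature (G r) s' t' -> (s <= s')%N /\ (t <= t')%N.
Proof.
move=> cG sG; have cN i j : {for q, continuous (fun r => (- G r) i j)}.
  have -> : (fun r => (- G r) i j) = (fun r => - G r i j).
    by apply/funext => r; rewrite mxE.
  by apply: cvgN; exact: cG.
have h2 := signature_near_pos cN (signature_opp sG).
apply: filterS (near_and (signature_near_pos cG sG) h2) => r [k1 k2] s' t' sr.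
by split; [exact: k1 sr|apply: k2 (signature_opp sr)].
Qed.

(** Sylvester's law, as semicontinuity of both indices applied in both directions to a constant
    family of matrices. *)
Lemma signature_uniq n (G : 'M[R]_n) s t s' t' :
  signature G s t -> signature G s' t' -> s = s' /\ t = t'.
Proof.
have key a b a' b' : signature G a b -> signature G a' b' -> (a <= a')%N /\ (b <= b')%N.
  move=> h; have cc i j : {for (0 : R), continuous (fun=> G i j)} by exact: cvg_cst.
  exact: (nbhs_singleton (signature_near cc h)).
move=> h h'; have [l1 l2] := key _ _ _ _ h h'; have [l3 l4] := key _ _ _ _ h' h.
by split; apply/eqP; rewrite eqn_leq ?l1 ?l2 ?l3 ?l4.
Qed.

Lemma signature0 n : signature (0 : 'M[R]_n) 0 0.
Proof.
exists 1%:M, 0; split; rewrite ?unitmx1 ?mulmx0 ?mul0mx ?linear0 //.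
  by apply: eq_card0 => i; rewrite !inE mxE ltxx.
by apply: eq_card0 => i; rewrite !inE mxE ltxx.
Qed.

Lemma signature_eq0 n (G : 'M[R]_n) : signature G 0 0 -> G = 0.
Proof.
move=> [P [d [uP e p0 n0]]].
have d0 : d = 0.
  apply/rowP => i; rewrite mxE; apply/eqP; rewrite eq_le !leNgt; apply/andP; split.
    by have := card0_eq p0 i; rewrite !inE => ->.
  by have := card0_eq n0 i; rewrite !inE => ->.
rewrite d0 linear0 in e.
have uT : P^T \in unitmx by rewrite unitmx_tr.
have : invmx P *m (P *m G *m P^T) *m invmx P^T = 0 by rewrite e mulmx0 mul0mx.
by rewrite !mulmxA mulVmx // mul1mx mulmxK.
Qed.

Lemma signature_scale n (G : 'M[R]_n) (a : R) s t : 0 < a ->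
  signature G s t -> signature (a *: G) s t.
Proof.
move=> a0 [P [d [uP e <- <-]]]; exists P, (a *: d); split=> //.
- by rewrite -scalemxAr -scalemxAl e linearZ.
- by apply: eq_card => i; rewrite !inE mxE pmulr_rgt0.
- by apply: eq_card => i; rewrite !inE mxE pmulr_rlt0.
Qed.

Lemma signature_block m n (G : 'M[R]_m) (H : 'M[R]_n) s t s' t' :
  signature G s t -> signature H s' t' ->
  signature (block_mx G 0 0 H) (s + s') (t + t').
Proof.
move=> [P [d [uP e <- <-]]] [P' [d' [uP' e' <- <-]]].
exists (block_mx P 0 0 P'), (row_mx d d'); split.
- by rewrite unitmxE det_ublock unitrM -!unitmxE uP.
- rewrite tr_block_mx !trmx0 !mulmx_block !(mul0mx, mulmx0, addr0, add0r) e e'.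
  by rewrite diag_mx_row.
- rewrite /npos -!sum1_card big_mkcond big_split_ord /=.
  by congr (_ + _)%N; rewrite [RHS]big_mkcond; apply: eq_bigr => i _;
    rewrite !inE ?row_mxEl ?row_mxEr.
- rewrite /nneg -!sum1_card big_mkcond big_split_ord /=.
  by congr (_ + _)%N; rewrite [RHS]big_mkcond; apply: eq_bigr => i _;
    rewrite !inE ?row_mxEl ?row_mxEr.
Qed.

Lemma signature_unit n (G : 'M[R]_n) s t : G \in unitmx -> signature G s t -> (s + t)%N = n.
Proof.
move=> uG [P [d [uP e <- <-]]].
have : diag_mx d \in unitmx by rewrite -e !unitmx_mul uP uG unitmx_tr.
rewrite unitmxE det_diag unitfE => /prodf_neq0 dn.
rewrite -[RHS](card_ord n) -cardUI.
rewrite [X in (_ + X)%N]eq_card0 ?addn0.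
  by apply: eq_card => i; rewrite !inE -neq_lt eq_sym dn.
by move=> i; rewrite !inE; apply/negP => /andP[h /(lt_trans h)]; rewrite ltxx.
Qed.

End Inertia.

(** * Density of the regular points *)

Section Regular.
Context {R : realType} {M : topologicalType} {n : nat}.
Context (A : set (chart R M n)) (hA : atlas A).
Context (g : tensor02 R M) (hg : sing_metric A g).
Implicit Types (p q : M) (b : 'I_n -> functional R M).

Definition lincomb (a : 'rV[R]_n) b : functional R M :=
  fun h => \sum_(i < n) a 0 i * b i h.

Definition is_basis q b : Prop :=
  (forall i, tangent A q (b i)) /\
  forall v, tangent A q v -> exists! a : 'rV[R]_n, v = lincomb a b.

Definition gram q b : 'M[R]_n := \matrix_(i, j) g q (b i) (b j).

Lemma tangent_comb q a b : (forall i, tangent A q (b i)) -> tangent A q (lincomb a b).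
Proof. by move=> tb; apply: tangent_lincomb. Qed.

Lemma lincomb_comb (a : 'rV[R]_n) (P : 'M[R]_n) b :
  lincomb a (fun k => lincomb (row k P) b) = lincomb (a *m P) b.
Proof.
apply/funext => h; rewrite /lincomb.
under eq_bigr do rewrite mulr_sumr.
rewrite exchange_big; apply: eq_bigr => l _ /=.
rewrite mxE mulr_suml; apply: eq_bigr => k _.
by rewrite mxE mulrA.
Qed.

Lemma lincomb_delta b i : lincomb 'e_i b = b i.
Proof.
apply/funext => h; rewrite /lincomb (bigD1 i) //= mxE !eqxx mul1r big1 ?addr0 //.
by move=> j ji; rewrite mxE eqxx (negbTE ji) mul0r.
Qed.

Lemma gram_comb q b (P : 'M[R]_n) : (forall i, tangent A q (b i)) ->
  gram q (fun k => lincomb (row k P) b) = P *m gram q b *m P^T.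
Proof.
move=> tb; apply/matrixP => i j; rewrite mxE /lincomb.
rewrite (metric_suml hA hg) //; last exact: tangent_lincomb.
rewrite -[P *m gram q b *m P^T]mulmxA mxE; apply: eq_bigr => k _; rewrite !mxE; congr (_ * _).
rewrite (metric_sumr hA hg) //; apply: eq_bigr => l _.
by rewrite !mxE mulrC.
Qed.

Lemma gram_sym q b : (forall i, tangent A q (b i)) -> (gram q b)^T = gram q b.
Proof. by move=> tb; apply/matrixP => i j; rewrite !mxE (metricC hg). Qed.

(** A change of basis is a congruence of Gram matrices, so the geometric signature can be read off
    the Gram matrix in any basis. *)
Lemma has_signatureP q b s t : is_basis q b ->
  has_signature A g q s t <-> signature (gram q b) s t.
Proof.
move=> [tb bb]; split.
  move=> [e [eps [te ee ge ps ns]]].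
  have [P PE] : exists P : 'M[R]_n, forall i, e i = lincomb (row i P) b.
    have /choice [f fE] : forall i, exists a, e i = lincomb a b.
      by move=> i; have [a [aE _]] := bb _ (te i); exists a.
    by exists (\matrix_i f i) => i; rewrite rowK.
  have [Q QE] : exists Q : 'M[R]_n, forall i, b i = lincomb (row i Q) e.
    have /choice [f fE] : forall i, exists a, b i = lincomb a e.
      by move=> i; have [a [aE _]] := ee _ (tb i); exists a.
    by exists (\matrix_i f i) => i; rewrite rowK.
  have eE : e = (fun k => lincomb (row k P) b) by apply/funext.
  (* Uniqueness of coordinates in [b] makes the two change-of-basis matrices inverse to each
     other. *)
  have QP : Q *m P = 1%:M.
    apply/row_matrixP => i; rewrite row_mul row1.
    have [a [_ aU]] := bb _ (tb i).
    rewrite -(aU (row i Q *m P)); last by rewrite -lincomb_comb -eE.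
    by apply: aU; rewrite lincomb_delta.
  exists P, (\row_i eps i); split.
  - by have [] := mulmx1_unit QP.
  - rewrite -gram_comb // -eE; apply/matrixP => i j; rewrite !mxE ge.
    by have [->|_] := eqVneq i j; rewrite ?mulr1n ?mulr0n.
  - by rewrite -ps; apply: eq_card => i; rewrite !inE mxE.
  - by rewrite -ns; apply: eq_card => i; rewrite !inE mxE.
move=> [P [d [uP PE ps ns]]].
exists (fun k => lincomb (row k P) b), (fun i => d 0 i); split.
- by move=> i; exact: tangent_comb.
- move=> v tv; have [a [aE aU]] := bb _ tv.
  exists (a *m invmx P); split.
    by rewrite -/(lincomb _ _) lincomb_comb mulmxKV.
  move=> c; rewrite -/(lincomb _ _) lincomb_comb => /aU ->.
  by rewrite mulmxK.
- move=> i j; have := gram_comb P tb; rewrite PE => /matrixP /(_ i j).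
  rewrite !mxE => ->.
  by have [->|_] := eqVneq i j; rewrite ?mulr1n ?mulr0n.
- exact: ps.
- exact: ns.
Qed.

Lemma frame_basis p E xi : frame_at A p E xi ->
  \forall q \near p, is_basis q (fun i => at_point (E i) q).
Proof.
move=> [vE sxi fE]; apply: filterS fE => q [dual dec]; split=> [i|v tv].
  exact: vfield_tangent.
exists (\row_i v (xi i)); split.
  rewrite {1}(dec v tv); apply/funext => h; apply: eq_bigr => i _.
  by rewrite mxE.
move=> a aE; apply/rowP => j; rewrite mxE {1}aE /lincomb (bigD1 j) //= /at_point.
rewrite dual eqxx mulr1 big1 ?addr0 // => i ij.
by rewrite dual (negbTE ij) mulr0.
Qed.

Lemma basis_ex q : exists b, is_basis q b.
Proof.
have [E [xi fE]] := frame_ex hA q; eexists.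
exact: nbhs_singleton (frame_basis fE).
Qed.

Lemma has_signature_ex q : exists s t, has_signature A g q s t.
Proof.
have [b bb] := basis_ex q; have [tb _] := bb.
have [s [t st]] := signature_ex (gram_sym tb).
by exists s, t; apply/(has_signatureP s t bb).
Qed.

Lemma has_signature_uniq q s t s' t' :
  has_signature A g q s t -> has_signature A g q s' t' -> s = s' /\ t = t'.
Proof.
have [b bb] := basis_ex q.
move=> /(has_signatureP _ _ bb) h /(has_signatureP _ _ bb); exact: signature_uniq.
Qed.

Lemma has_signature_le q s t : has_signature A g q s t -> (s + t <= n)%N.
Proof.
have [b bb] := basis_ex q.
by move=> /(has_signatureP _ _ bb); exact: signature_le.
Qed.

Lemma has_signature_near q s t : has_signature A g q s t ->
  \forall r \near q, forall s' t', has_signature A g r s' t' -> (s <= s')%N /\ (t <= t')%N.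
Proof.
have [E [xi fE]] := frame_ex hA q; have bE := frame_basis fE.
move=> /(has_signatureP _ _ (nbhs_singleton bE)) h.
have cG i j : {for q, continuous (fun r => gram r (fun i => at_point (E i) r) i j)}.
  have [vE _ _] := fE.
  have -> : (fun r => gram r (fun i => at_point (E i) r) i j) = inner g (E i) (E j).
    by apply/funext => r; rewrite mxE.
  by apply: (smooth_continuous hA); exact: smooth_inner.
apply: filterS (near_and bE (signature_near cG h)) => r [br k] s' t'.
by move=> /(has_signatureP _ _ br); exact: k.
Qed.

(* The rank takes a maximal value on every open set, and the signature is
   locally constant where it does, by semicontinuity of both indices. *)
Lemma regular_dense : dense_regular A g.
Proof.
move=> O p nO.
pose S k := `[< exists q s t,
  [/\ \forall r \near q, O r, has_signature A g q s t & (s + t)%N = k] >].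
have exS : exists k, S k.
  have [s [t st]] := has_signature_ex p.
  by exists (s + t)%N; apply/asboolP; exists p, s, t.
have leS k : S k -> (k <= n)%N.
  by move=> /asboolP [q [s [t [_ /has_signature_le + <-]]]].
have [k /asboolP [q [s [t [nq st <-]]]] kmax] := ex_maxnP exS leS.
exists q; first exact: nbhs_singleton nq.
exists s, t; apply: filterS (near_and (near_join nq) (has_signature_near st)).
move=> r [nr le]; have [s' [t' st']] := has_signature_ex r.
have [l1 l2] := le _ _ st'.
have l3 : (s' + t' <= s + t)%N by apply: kmax; apply/asboolP; exists r, s', t'.
have es : s' = s by apply/eqP; rewrite eqn_leq l1 andbT -(leq_add2r t') (leq_trans l3) // leq_add2l.
have et : t' = t by apply/eqP; rewrite eqn_leq l2 andbT -(leq_add2l s') (leq_trans l3) // leq_add2r.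
by rewrite -es -et.
Qed.

(** A row vector killed by the Gram matrix is the coordinate row of a radical vector. *)
Lemma nondegenerate_unit q b : nondegenerate_metric A g -> is_basis q b ->
  gram q b \in unitmx.
Proof.
move=> nd [tb bb]; rewrite -row_free_unit -kermx_eq0; apply/rowV0P => a /sub_kermxP aG.
have ta := tangent_comb a tb.
have z : lincomb a b = (fun=> 0).
  apply: (nd q) => // v tv; have [c [-> _]] := bb _ tv.
  rewrite /lincomb (metric_sumr hA hg) // big1 // => j _.
  rewrite (metric_suml hA hg) //.
  have /rowP /(_ j) := aG; rewrite !mxE => e.
  rewrite (eq_bigr (fun i => a 0 i * gram q b i j)) ?e ?mulr0 //.
  by move=> i _; rewrite mxE.
have [c [_ cU]] := bb _ (tangent0 hA q).
rewrite -(cU a) ?z // -(cU 0) //.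
by apply/funext => h; rewrite /lincomb big1 // => i _; rewrite mxE mul0r.
Qed.

Lemma nondegenerate_signature q s t : nondegenerate_metric A g ->
  has_signature A g q s t -> (s + t)%N = n.
Proof.
move=> nd; have [b bb] := basis_ex q => /(has_signatureP _ _ bb).
by apply: signature_unit; exact: nondegenerate_unit.
Qed.

Definition basis_diff b (f : M -> R) : 'rV[R]_n := \row_i b i f.

(** The gradient in coordinates: the row of derivatives of [f] times the inverse Gram matrix. *)
Lemma gradient_basis (f : M -> R) q b : nondegenerate_metric A g -> is_basis q b ->
  represents A g q (lincomb (basis_diff b f *m invmx (gram q b)) b) (differential f).
Proof.
move=> nd bb; have [tb dec] := bb.
have uG := nondegenerate_unit nd bb.
set c := basis_diff b f; split; first exact: tangent_comb.
move=> X vX; have [a [aE _]] := dec _ (vfield_tangent q vX).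
rewrite /differential -[LHS]/(at_point X q f) aE /lincomb.
rewrite (metric_sumr hA hg) //; last exact: tangent_lincomb.
apply: eq_bigr => j _; congr (_ * _).
rewrite (metric_suml hA hg) //.
rewrite (eq_bigr (fun i => (c *m invmx (gram q b)) 0 i * gram q b i j)); last first.
  by move=> i _; congr (_ * _); rewrite mxE.
have : (c *m invmx (gram q b) *m gram q b) 0 j = b j f by rewrite mulmxKV // mxE.
by rewrite mxE => ->.
Qed.

Lemma gradient_ex (f : M -> R) q : nondegenerate_metric A g ->
  exists u, represents A g q u (differential f).
Proof.
by move=> nd; have [b bb] := basis_ex q; eexists; exact: gradient_basis nd bb.
Qed.

(** Cramer's form: after multiplication by the determinant, the squared length of the gradient is a
    polynomial in derivatives of [f] and inner products, whose smoothness is visible. *)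
Lemma cometric_differential (f : M -> R) q b : nondegenerate_metric A g -> is_basis q b ->
  cometric A g (differential f) (differential f) q * \det (gram q b) =
  (basis_diff b f *m \adj (gram q b) *m (basis_diff b f)^T) 0 0.
Proof.
move=> nd bb; have rf := gradient_basis f nd bb; have [tb _] := bb.
have uG := nondegenerate_unit nd bb.
rewrite (cometricE hA hg rf rf).
set u := lincomb _ b in rf *; have [tu uE] := rf.
have [X vX Xu] := vfield_extend hA tu.
have -> : g q u u = u f by rewrite -{2}Xu -uE // -[RHS]/(u f) -Xu.
have -> : u f = (basis_diff b f *m invmx (gram q b) *m (basis_diff b f)^T) 0 0.
  by rewrite [RHS]mxE; apply: eq_bigr => i _; congr (_ * _); rewrite !mxE.
rewrite /invmx uG -scalemxAr -scalemxAl [X in X * _]mxE mulrAC mulVf ?mul1r //.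
by rewrite -unitfE -unitmxE.
Qed.

Lemma smooth_det k (G : 'I_k -> 'I_k -> M -> R) : (forall i j, smooth A (G i j)) ->
  smooth A (fun q => \det (\matrix_(i, j) G i j q)).
Proof.
move=> sG; rewrite (_ : (fun q => _) =
    (fun q => \sum_(s : {perm 'I_k}) (-1) ^+ s * \prod_i G i (s i) q)).
  apply: (smooth_sum hA) => s _; apply: (smooth_mul hA); first exact: smooth_cst.
  exact: smooth_prod.
apply/funext => q; apply: eq_bigr => s _; congr (_ * _).
by apply: eq_bigr => i _; rewrite mxE.
Qed.

Lemma smooth_adj k (G : 'I_k -> 'I_k -> M -> R) i j : (forall i j, smooth A (G i j)) ->
  smooth A (fun q => (\adj (\matrix_(i, j) G i j q)) i j).
Proof.
case: k G i j => [G []//|k] G i j sG.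
rewrite (_ : (fun q => _) = (fun q => (-1) ^+ (j + i) *
    \det (\matrix_(a, b) G (lift j a) (lift i b) q))).
  by apply: (smooth_mul hA); [exact: smooth_cst|exact: smooth_det].
apply/funext => q; rewrite mxE /cofactor; congr (_ * \det _).
by apply/matrixP => a b; rewrite !mxE.
Qed.

(** Locally this is a quotient by the Gram determinant of a frame. That determinant is known to be
    nonzero only near [p], so the quotient is replaced by a global one that agrees with it there. *)
Lemma smooth_cometric_differential (f : M -> R) : nondegenerate_metric A g -> smooth A f ->
  smooth A (cometric A g (differential f) (differential f)).
Proof.
move=> nd sf; apply: smooth_nearP => // p.
have [E [xi fE]] := frame_ex hA p; have bE := frame_basis fE; have [vE _ _] := fE.
pose G i j := inner g (E i) (E j).
have sG i j : smooth A (G i j) by exact: smooth_inner.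
pose D q := \det (\matrix_(i, j) G i j q).
have sD : smooth A D by exact: smooth_det.
pose N q := \sum_i (\sum_j E j f q * (\adj (\matrix_(i, j) G i j q)) j i) * E i f q.
have sE i : smooth A (E i f) by exact: vfield_smooth.
have sN : smooth A N.
  apply: (smooth_sum hA) => i _; apply: (smooth_mul hA) => //.
  by apply: (smooth_sum hA) => j _; apply: (smooth_mul hA) => //; exact: smooth_adj.
have key : \forall q \near p, D q != 0 /\
    cometric A g (differential f) (differential f) q * D q = N q.
  apply: filterS bE => q bq.
  have GE : gram q (fun i => at_point (E i) q) = \matrix_(i, j) G i j q.
    by apply/matrixP => i j; rewrite !mxE.
  split; first by rewrite -unitfE -unitmxE -GE; exact: nondegenerate_unit.
  rewrite /D -GE cometric_differential // mxE; apply: eq_bigr => i _.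
  rewrite [X in _ * X]mxE [X in _ * X]mxE; congr (_ * _).
  by rewrite mxE; apply: eq_bigr => j _; rewrite mxE GE.
have [rho [srho rho1 rho0]] := bump hA key.
(* A positive smooth function equal to [D ^ 2] near [p]. *)
pose D2 q := (rho q * D q) * (rho q * D q) + (1 - rho q) * (1 - rho q).
have sD2 : smooth A D2.
  have s1 : smooth A (fun q => rho q * D q) by exact: smooth_mul.
  have s2 : smooth A (fun q => 1 - rho q) by apply: (smooth_sub hA) => //; exact: smooth_cst.
  by apply: (smooth_add hA); exact: smooth_mul.
(* If both squares vanish then [rho q] is 1, so [q] lies in the region where [D] is nonzero. *)
have D20 q : D2 q != 0.
  rewrite /D2 -!expr2 paddr_eq0 ?sqr_ge0 // !sqrf_eq0 subr_eq0 negb_and.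
  have [//|/=] := eqVneq 1 (rho q); last by rewrite orbT.
  move=> r1; rewrite orbF mulf_neq0 // -?r1 ?oner_neq0 //.
  have [[]//|/nbhs_singleton r0] := rho0 q.
  by move/eqP: r1; rewrite r0 oner_eq0.
exists (fun q => N q * D q * (D2 q)^-1).
  by apply: (smooth_mul hA); [exact: smooth_mul|exact: smooth_inv].
apply: filterS (near_and key rho1) => q [[Dq e] r1].
rewrite /D2 r1 !mul1r subrr mul0r addr0 -e; field.
exact: Dq.
Qed.

End Regular.

(** * Products of manifolds *)

Section Product.
Context {R : realType} {B F : topologicalType} {m n : nat}.
Context (AB : set (chart R B m)) (AF : set (chart R F n)).
Context (hB : atlas AB) (hF : atlas AF).
Local Notation AP := (prod_atlas AB AF).
Implicit Types (c : chart R B m) (d : chart R F n).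

Lemma near_fst (x : B * F) (P : set B) :
  (\forall b \near x.1, P b) -> \forall y \near x, P y.1.
Proof. by move=> nP; exact: (cvg_fst nP). Qed.

Lemma near_snd (x : B * F) (P : set F) :
  (\forall b \near x.2, P b) -> \forall y \near x, P y.2.
Proof. by move=> nP; exact: (cvg_snd nP). Qed.

Lemma near_prod (x : B * F) (P : set B) (Q : set F) :
  (\forall b \near x.1, P b) -> (\forall q \near x.2, Q q) ->
  \forall y \near x, P y.1 /\ Q y.2.
Proof. by move=> nP nQ; apply: near_and; [exact: near_fst|exact: near_snd]. Qed.

Lemma open_nearP (T : topologicalType) (O : set T) :
  (forall x, O x -> \forall y \near x, O y) -> open O.
Proof. by move=> H; rewrite openE => x /H. Qed.

Lemma lsubmx_continuous : continuous (lsubmx : 'rV[R]_(m + n) -> 'rV[R]_m).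
Proof.
move=> x; apply: rV_continuous => j.
have -> : (fun y : 'rV[R]_(m + n) => lsubmx y 0 j) = (fun y => y 0 (lshift n j)).
  by apply/funext => y; rewrite mxE.
exact: coord_continuous.
Qed.

Lemma rsubmx_continuous : continuous (rsubmx : 'rV[R]_(m + n) -> 'rV[R]_n).
Proof.
move=> x; apply: rV_continuous => j.
have -> : (fun y : 'rV[R]_(m + n) => rsubmx y 0 j) = (fun y => y 0 (rshift m j)).
  by apply/funext => y; rewrite mxE.
exact: coord_continuous.
Qed.

Lemma prod_chart_img c d : chart_img (prod_chart c d) =
  [set y | chart_img c (lsubmx y) /\ chart_img d (rsubmx y)].
Proof.
apply/seteqP; split=> [y [[b q] [/= cb dq] <-]|y [[b cb be] [q dq qe]]].
  by rewrite /= row_mxKl row_mxKr; split; [exists b|exists q].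
exists (b, q) => //=; by rewrite be qe hsubmxK.
Qed.

Lemma overlap_open (M : topologicalType) k (A : set (chart R M k)) (c d : chart R M k) :
  atlas A -> A c -> A d -> open (chart_map c @` (chart_dom c `&` chart_dom d)).
Proof.
by move=> hA Ac Ad; apply: open_nearP => x [p [cp dp] <-]; exact: (near_overlap hA).
Qed.

Lemma Ck_lsub (O : set 'rV[R]_m) (h : 'rV[R]_m -> R) k : open O -> Ck k O h ->
  Ck k ((lsubmx : 'rV_(m + n) -> _) @^-1` O) (fun x : 'rV[R]_(m + n) => h (lsubmx x)).
Proof.
move=> oO ckh; have oO' : open ((lsubmx : 'rV_(m + n) -> _) @^-1` O).
  by apply: open_comp => // x _; exact: lsubmx_continuous.
apply: (Ck_comp oO' oO) ckh _ => // j.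
apply: (Ck_eq oO' (f := fun x => x 0 (lshift n j))); last exact: Ck_coord.
by move=> x _; rewrite mxE.
Qed.

Lemma Ck_rsub (O : set 'rV[R]_n) (h : 'rV[R]_n -> R) k : open O -> Ck k O h ->
  Ck k ((rsubmx : 'rV_(m + n) -> _) @^-1` O) (fun x : 'rV[R]_(m + n) => h (rsubmx x)).
Proof.
move=> oO ckh; have oO' : open ((rsubmx : 'rV_(m + n) -> _) @^-1` O).
  by apply: open_comp => // x _; exact: rsubmx_continuous.
apply: (Ck_comp oO' oO) ckh _ => // j.
apply: (Ck_eq oO' (f := fun x => x 0 (rshift m j))); last exact: Ck_coord.
by move=> x _; rewrite mxE.
Qed.

Lemma prod_hausdorff : hausdorff_space (B * F)%type.
Proof.
have [h1 _ _ _] := hB; have [h2 _ _ _] := hF.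
move=> [b q] [b' q'] cl; congr (_, _).
  apply: h1 => U V nU nV.
  have [[x y] [/= Ux Vx]] := cl (fst @^-1` U) (fst @^-1` V)
    (@near_fst (b, q) U nU) (@near_fst (b', q') V nV).
  by exists x.
apply: h2 => U V nU nV.
have [[x y] [/= Ux Vx]] := cl (snd @^-1` U) (snd @^-1` V)
  (@near_snd (b, q) U nU) (@near_snd (b', q') V nV).
by exists y.
Qed.

Lemma prod_atlasP : atlas AP.
Proof.
split; first exact: prod_hausdorff.
- move=> [b q]; have [c Ac cb] := chart_ex hB b; have [d Ad dq] := chart_ex hF q.
  by exists (prod_chart c d) => //; exists c, d.
- move=> _ [c [d [Ac Ad ->]]]; split.
  + apply: open_nearP => x [cx dx].
    have := near_prod (near_chart_dom hB Ac cx) (near_chart_dom hF Ad dx).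
    exact: filterS.
  + rewrite prod_chart_img; apply: open_nearP => y [cy dy].
    apply: near_and.
      by apply: lsubmx_continuous; apply: open_near cy; exact: (chart_imgo hB Ac).
    by apply: rsubmx_continuous; apply: open_near dy; exact: (chart_imgo hF Ad).
  + move=> [b q] [/= cb dq]; rewrite row_mxKl row_mxKr.
    by rewrite (chart_mapK hB Ac) // (chart_mapK hF Ad).
  + move=> x [cx dx]; apply: rV_continuous => j.
    case: (split_ordP j) => i ->.
      have -> : (fun y => chart_map (prod_chart c d) y 0 (lshift n i)) =
          (fun y => chart_map c y.1 0 i).
        by apply/funext => y; rewrite /= row_mxEl.
      apply: (@continuous_comp _ _ _ fst (fun b => chart_map c b 0 i)).
        exact: cvg_fst.
      apply: (@continuous_comp _ _ _ (chart_map c) (fun z : 'rV[R]_m => z 0 i)).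
        exact: (chart_map_continuous hB Ac).
      exact: coord_continuous.
    have -> : (fun y => chart_map (prod_chart c d) y 0 (rshift m i)) =
        (fun y => chart_map d y.2 0 i).
      by apply/funext => y; rewrite /= row_mxEr.
    apply: (@continuous_comp _ _ _ snd (fun b => chart_map d b 0 i)).
      exact: cvg_snd.
    apply: (@continuous_comp _ _ _ (chart_map d) (fun z : 'rV[R]_n => z 0 i)).
      exact: (chart_map_continuous hF Ad).
    exact: coord_continuous.
  + rewrite prod_chart_img => y [cy dy].
    have c1 : {for y, continuous (chart_inv c \o (lsubmx : 'rV[R]_(m + n) -> _))}.
      apply: continuous_comp; first exact: lsubmx_continuous.
      exact: (chart_inv_continuous hB Ac).
    have c2 : {for y, continuous (chart_inv d \o (rsubmx : 'rV[R]_(m + n) -> _))}.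
      apply: continuous_comp; first exact: rsubmx_continuous.
      exact: (chart_inv_continuous hF Ad).
    exact: cvg_pair c1 c2.
move=> _ _ [c [d [Ac Ad ->]]] [c' [d' [Ac' Ad' ->]]] j k.
case: (split_ordP j) => i ->.
  have oO := overlap_open hB Ac Ac'.
  have ck := Ck_lsub oO (transition_smooth hB i k Ac Ac').
  have -> : (fun x => chart_map (prod_chart c' d') (chart_inv (prod_chart c d) x) 0 (lshift n i)) =
     (fun x => chart_map c' (chart_inv c (lsubmx x)) 0 i).
    by apply/funext => x; rewrite /= row_mxEl.
  apply: Ck_sub ck => x [[b q] [[/= cb dq] [/= cb' dq']] <-] /=.
  by rewrite row_mxKl; exists b.
have oO := overlap_open hF Ad Ad'.
have ck := Ck_rsub oO (transition_smooth hF i k Ad Ad').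
have -> : (fun x => chart_map (prod_chart c' d') (chart_inv (prod_chart c d) x) 0 (rshift m i)) =
   (fun x => chart_map d' (chart_inv d (rsubmx x)) 0 i).
  by apply/funext => x; rewrite /= row_mxEr.
apply: Ck_sub ck => x [[b q] [[/= cb dq] [/= cb' dq']] <-] /=.
by rewrite row_mxKr; exists q.
Qed.

Lemma smooth_fst phi : smooth AB phi -> smooth AP (fun p => phi p.1).
Proof.
move=> sphi _ [c [d [Ac Ad ->]]] k.
apply: Ck_sub (Ck_lsub (chart_imgo hB Ac) (smooth_chart k sphi Ac)).
by rewrite prod_chart_img => x [].
Qed.

Lemma smooth_snd psi : smooth AF psi -> smooth AP (fun p => psi p.2).
Proof.
move=> spsi _ [c [d [Ac Ad ->]]] k.
apply: Ck_sub (Ck_rsub (chart_imgo hF Ad) (smooth_chart k spsi Ad)).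
by rewrite prod_chart_img => x [].
Qed.

Lemma smooth_slice1 h q : smooth AP h -> smooth AB (fun b => h (b, q)).
Proof.
move=> sh c Ac k; have [d Ad dq] := chart_ex hF q.
have APcd : AP (prod_chart c d) by exists c, d.
have oB := chart_imgo hB Ac.
apply: (Ck_eq oB (f := (h \o chart_inv (prod_chart c d)) \o (fun x => row_mx x (chart_map d q)))).
  by move=> x _ /=; rewrite row_mxKl row_mxKr (chart_mapK hF Ad).
apply: (Ck_comp oB (chart_imgo prod_atlasP APcd)) (smooth_chart k sh APcd) _.
  move=> x cx; rewrite prod_chart_img /= row_mxKl row_mxKr; split=> //.
  exact: chart_img_map.
move=> j; case: (split_ordP j) => i ->.
  by apply: (Ck_eq oB (f := fun x => x 0 i)) (Ck_coord _ _ oB) => x _; rewrite row_mxEl.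
apply: (Ck_eq oB (f := fun x => chart_map d q 0 i)) (Ck_cst _ _ oB) => x _.
by rewrite row_mxEr.
Qed.

Lemma smooth_slice2 h b : smooth AP h -> smooth AF (fun q => h (b, q)).
Proof.
move=> sh d Ad k; have [c Ac cb] := chart_ex hB b.
have APcd : AP (prod_chart c d) by exists c, d.
have oF := chart_imgo hF Ad.
apply: (Ck_eq oF (f := (h \o chart_inv (prod_chart c d)) \o (fun x => row_mx (chart_map c b) x))).
  by move=> x _ /=; rewrite row_mxKl row_mxKr (chart_mapK hB Ac).
apply: (Ck_comp oF (chart_imgo prod_atlasP APcd)) (smooth_chart k sh APcd) _.
  move=> x dx; rewrite prod_chart_img /= row_mxKl row_mxKr; split=> //.
  exact: chart_img_map.
move=> j; case: (split_ordP j) => i ->.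
  apply: (Ck_eq oF (f := fun x => chart_map c b 0 i)) (Ck_cst _ _ oF) => x _.
  by rewrite row_mxEl.
by apply: (Ck_eq oF (f := fun x => x 0 i)) (Ck_coord _ _ oF) => x _; rewrite row_mxEr.
Qed.

(** The difference quotients on both sides coincide for every increment, because the second
    component stays at [q]. *)
Lemma pd_lshift c d i h b q : AF d -> chart_dom d q ->
  pd (prod_chart c d) (lshift n i) h (b, q) = pd c i (fun b' => h (b', q)) b.
Proof.
move=> Ad dq; rewrite /pd /derive.
apply: (congr1 (fun u : R -> R => lim (u @ 0^'))); apply/funext => t /=.
have -> : t *: 'e_(lshift n i) + row_mx (chart_map c b) (chart_map d q) =
    row_mx (t *: 'e_i + chart_map c b) (chart_map d q) :> 'rV[R]_(m + n).
  apply/rowP => j; case: (split_ordP j) => k ->.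
    rewrite row_mxEl [LHS]mxE row_mxEl [RHS]mxE; congr (_ + _).
    by rewrite !mxE !eqxx (inj_eq (@lshift_inj _ _)).
  rewrite row_mxEr [LHS]mxE row_mxEr -[RHS]add0r; congr (_ + _).
  by rewrite !mxE eqxx eq_rlshift mulr0.
by rewrite !row_mxKl !row_mxKr (chart_mapK hF Ad).
Qed.

Lemma pd_rshift c d i h b q : AB c -> chart_dom c b ->
  pd (prod_chart c d) (rshift m i) h (b, q) = pd d i (fun q' => h (b, q')) q.
Proof.
move=> Ac cb; rewrite /pd /derive.
apply: (congr1 (fun u : R -> R => lim (u @ 0^'))); apply/funext => t /=.
have -> : t *: 'e_(rshift m i) + row_mx (chart_map c b) (chart_map d q) =
    row_mx (chart_map c b) (t *: 'e_i + chart_map d q) :> 'rV[R]_(m + n).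
  apply/rowP => j; case: (split_ordP j) => k ->.
    rewrite row_mxEl [LHS]mxE row_mxEl -[RHS]add0r; congr (_ + _).
    by rewrite !mxE eqxx eq_lrshift mulr0.
  rewrite row_mxEr [LHS]mxE row_mxEr [RHS]mxE; congr (_ + _).
  by rewrite !mxE !eqxx (inj_eq (@rshift_inj _ _)).
by rewrite !row_mxKl !row_mxKr (chart_mapK hB Ac).
Qed.

End Product.

(** * Lifts of vector fields *)

Section Lift.
Context {R : realType} {B F : topologicalType} {m n : nat}.
Context (AB : set (chart R B m)) (AF : set (chart R F n)).
Context (hB : atlas AB) (hF : atlas AF).
Local Notation AP := (prod_atlas AB AF).
Local Notation push1 v := (Defs.pushforward fst v).
Local Notation push2 v := (Defs.pushforward snd v).
Local Notation lB := (liftB AB AF).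
Local Notation lF := (liftF AB AF).
Implicit Types (X Y Z : operator R B) (U V W : operator R F) (x : B * F).
Implicit Types (u v : functional R (B * F)%type).

Let hP : atlas AP := prod_atlasP hB hF.

Lemma smooth_fstP (phi : B -> R) (q : F) :
  smooth AP (fun p => phi p.1) <-> smooth AB phi.
Proof.
by split=> [/(smooth_slice1 hB hF q)|]; [|exact: smooth_fst].
Qed.

Lemma smooth_sndP (psi : F -> R) (b : B) :
  smooth AP (fun p => psi p.2) <-> smooth AF psi.
Proof.
by split=> [/(smooth_slice2 hB hF b)|]; [|exact: smooth_snd].
Qed.

Lemma liftBE X h x : smooth AP h -> lB X h x = X (fun b => h (b, x.2)) x.1.
Proof. by move=> sh; rewrite /liftB asboolT. Qed.

Lemma liftFE V h x : smooth AP h -> lF V h x = V (fun q => h (x.1, q)) x.2.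
Proof. by move=> sh; rewrite /liftF asboolT. Qed.

(** A derivative along slices does not visibly depend smoothly on the other factor. Near a point the
    lift is the combination of the first [m] coordinate fields of a product chart with coefficients
    [X (xi i)], which settles it. *)
Lemma vfield_liftB X : vfield AB X -> vfield AP (lB X).
Proof.
move=> vX; split=> [[b q]|h sh].
  have [c Ac cb] := chart_ex hB b; have [d Ad dq] := chart_ex hF q.
  have APcd : AP (prod_chart c d) by exists c, d.
  have [a aE] := tangentE hB Ac cb (vfield_tangent b vX).
  have := @tangentI _ _ _ AP (prod_chart c d) (b, q) (row_mx a 0) APcd (conj cb dq).
  congr tangent; apply/funext => h; rewrite /at_point /liftB; case: asboolP => // sh.
  rewrite big_split_ord /= [X in _ + X]big1 ?addr0; last first.
    by move=> j _; rewrite row_mxEr mxE mul0r.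
  transitivity (at_point X b (fun b' => h (b', q))); last by [].
  rewrite aE asboolT; last exact: (smooth_slice1 hB hF).
  by apply: eq_bigr => i _; rewrite row_mxEl (pd_lshift hF).
apply: (smooth_nearP hP) => -[b q].
have [c Ac cb] := chart_ex hB b; have [d Ad dq] := chart_ex hF q.
have APcd : AP (prod_chart c d) by exists c, d.
have [E [xi [[vE sxi fE] nE]]] := chart_frame hB Ac cb.
have [G [zeta [[vG _ _] nG]]] := @chart_frame _ _ _ AP hP (prod_chart c d) (b, q) APcd (conj cb dq).
exists (fun x => \sum_i X (xi i) x.1 * G (lshift n i) h x).
  apply: (smooth_sum hP) => i _; apply: (smooth_mul hP); last exact: vfield_smooth.
  by apply: smooth_fst => //; exact: vfield_smooth.
have n1 : \forall y \near (b, q),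
    (forall v : functional R B, tangent AB y.1 v -> v = (fun h => \sum_i v (xi i) * E i h y.1)) /\
   (chart_dom c y.1 /\ forall i h, smooth AB h -> E i h y.1 = pd c i h y.1).
  apply: (@near_fst _ _ (b, q) (fun b =>
    (forall v : functional R B, tangent AB b v -> v = (fun h => \sum_i v (xi i) * E i h b)) /\
   (chart_dom c b /\ forall i h, smooth AB h -> E i h b = pd c i h b))).
  apply: near_and => //.
  by apply: filterS fE => b' [].
apply: filterS (near_and n1 nG) => -[b' q'] [[/= dec [cb' EE]] [[_ dq'] GE]].
rewrite liftBE //= -[LHS]/(at_point X b' _) (dec _ (vfield_tangent b' vX)).
apply: eq_bigr => i _; rewrite /at_point EE; last exact: (smooth_slice1 hB hF).
by rewrite GE // (pd_lshift hF).
Qed.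

Lemma vfield_liftF V : vfield AF V -> vfield AP (lF V).
Proof.
move=> vV; split=> [[b q]|h sh].
  have [c Ac cb] := chart_ex hB b; have [d Ad dq] := chart_ex hF q.
  have APcd : AP (prod_chart c d) by exists c, d.
  have [a aE] := tangentE hF Ad dq (vfield_tangent q vV).
  have := @tangentI _ _ _ AP (prod_chart c d) (b, q) (row_mx 0 a) APcd (conj cb dq).
  congr tangent; apply/funext => h; rewrite /at_point /liftF; case: asboolP => // sh.
  rewrite big_split_ord /= [X in X + _]big1 ?add0r; last first.
    by move=> j _; rewrite row_mxEl mxE mul0r.
  transitivity (at_point V q (fun q' => h (b, q'))); last by [].
  rewrite aE asboolT; last exact: (smooth_slice2 hB hF).
  by apply: eq_bigr => i _; rewrite row_mxEr (pd_rshift hB).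
apply: (smooth_nearP hP) => -[b q].
have [c Ac cb] := chart_ex hB b; have [d Ad dq] := chart_ex hF q.
have APcd : AP (prod_chart c d) by exists c, d.
have [E [xi [[vE sxi fE] nE]]] := chart_frame hF Ad dq.
have [G [zeta [[vG _ _] nG]]] := @chart_frame _ _ _ AP hP (prod_chart c d) (b, q) APcd (conj cb dq).
exists (fun x => \sum_i V (xi i) x.2 * G (rshift m i) h x).
  apply: (smooth_sum hP) => i _; apply: (smooth_mul hP); last exact: vfield_smooth.
  by apply: smooth_snd => //; exact: vfield_smooth.
have n1 : \forall y \near (b, q),
    (forall v : functional R F, tangent AF y.2 v -> v = (fun h => \sum_i v (xi i) * E i h y.2)) /\
   (chart_dom d y.2 /\ forall i h, smooth AF h -> E i h y.2 = pd d i h y.2).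
  apply: (@near_snd _ _ (b, q) (fun b =>
    (forall v : functional R F, tangent AF b v -> v = (fun h => \sum_i v (xi i) * E i h b)) /\
   (chart_dom d b /\ forall i h, smooth AF h -> E i h b = pd d i h b))).
  apply: near_and => //.
  by apply: filterS fE => b' [].
apply: filterS (near_and n1 nG) => -[b' q'] [[/= dec [dq' EE]] [[cb' _] GE]].
rewrite liftFE //= -[LHS]/(at_point V q' _) (dec _ (vfield_tangent q' vV)).
apply: eq_bigr => i _; rewrite /at_point EE; last exact: (smooth_slice2 hB hF).
by rewrite GE // (pd_rshift hB).
Qed.

(** Pulling back preserves smoothness, so where the lift is 0 by convention [X phi] is 0 as well.
    Validity for every [phi] is what equality of pushforwards requires. *)
Lemma liftB_fst X phi : vfield AB X -> lB X (fun p => phi p.1) = (fun p => X phi p.1).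
Proof.
move=> vX; apply/funext => x; rewrite /liftB; case: asboolP => // nh.
by rewrite (vfield_nonsmooth _ vX) // => sphi; apply: nh; exact: smooth_fst.
Qed.

Lemma liftB_snd X psi : vfield AB X -> lB X (fun p => psi p.2) = (fun=> 0).
Proof.
move=> vX; apply/funext => x; rewrite /liftB; case: asboolP => // sh.
exact: (vfield_cst (psi x.2) x.1 vX).
Qed.

Lemma liftF_snd V psi : vfield AF V -> lF V (fun p => psi p.2) = (fun p => V psi p.2).
Proof.
move=> vV; apply/funext => x; rewrite /liftF; case: asboolP => // nh.
by rewrite (vfield_nonsmooth _ vV) // => spsi; apply: nh; exact: smooth_snd.
Qed.

Lemma liftF_fst V phi : vfield AF V -> lF V (fun p => phi p.1) = (fun=> 0).
Proof.
move=> vV; apply/funext => x; rewrite /liftF; case: asboolP => // sh.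
exact: (vfield_cst (phi x.1) x.2 vV).
Qed.

Lemma liftB_mul X phi psi : vfield AB X -> smooth AB phi -> smooth AF psi ->
  lB X (fun x => phi x.1 * psi x.2) = (fun x => X phi x.1 * psi x.2).
Proof.
move=> vX sphi spsi; apply/funext => x.
rewrite (vfield_mul hP x (vfield_liftB vX)); do ?[exact: smooth_fst|exact: smooth_snd].
by rewrite liftB_fst // liftB_snd // mulr0 add0r mulrC.
Qed.

Lemma liftF_mul V phi psi : vfield AF V -> smooth AB phi -> smooth AF psi ->
  lF V (fun x => phi x.1 * psi x.2) = (fun x => phi x.1 * V psi x.2).
Proof.
move=> vV sphi spsi; apply/funext => x.
rewrite (vfield_mul hP x (vfield_liftF vV)); do ?[exact: smooth_fst|exact: smooth_snd].
by rewrite liftF_snd // liftF_fst // mulr0 addr0.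
Qed.

(** The maps [D] and [D'] are the coordinate derivatives of a product chart. They do not depend on
    [v], so a tangent vector is determined by its two pushforwards. *)
Lemma tangent_prodE x : exists (xi : 'I_m -> B -> R) (zeta : 'I_n -> F -> R)
    (D : 'I_m -> (B * F -> R) -> R) (D' : 'I_n -> (B * F -> R) -> R),
  forall v, tangent AP x v -> forall h, v h = if `[< smooth AP h >] then
    \sum_i push1 v (xi i) * D i h + \sum_j push2 v (zeta j) * D' j h
    else 0.
Proof.
case: x => b q.
have [c Ac cb] := chart_ex hB b; have [d Ad dq] := chart_ex hF q.
have APcd : AP (prod_chart c d) by exists c, d.
have [E [xi [[_ sxi fE] nE]]] := chart_frame hB Ac cb.
have [G [zeta [[_ szeta fG] nG]]] := chart_frame hF Ad dq.
have pxi i j : pd c i (xi j) b = (i == j)%:R.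
  by have [_ <- //] := nbhs_singleton nE; have [-> _] := nbhs_singleton fE.
have pzeta i j : pd d i (zeta j) q = (i == j)%:R.
  by have [_ <- //] := nbhs_singleton nG; have [-> _] := nbhs_singleton fG.
exists xi, zeta, (fun i h => pd (prod_chart c d) (lshift n i) h (b, q)),
  (fun j h => pd (prod_chart c d) (rshift m j) h (b, q)).
move=> v tv h.
have [a aE] := @tangentE _ _ _ AP hP (prod_chart c d) (b, q) v APcd (conj cb dq) tv.
rewrite aE; case: asboolP => // sh; rewrite big_split_ord /=.
congr (_ + _); apply: eq_bigr => i _; congr (_ * _); rewrite /Defs.pushforward aE.
  rewrite asboolT; last exact: (smooth_fst hB (sxi i)).
  rewrite big_split_ord /= (bigD1 i) //= (pd_lshift hF) //= pxi eqxx mulr1.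
  rewrite !big1 ?addr0 // => j ji.
    by rewrite (pd_rshift hB) //= [X in _ * X]pd_cst mulr0.
  by rewrite (pd_lshift hF) //= pxi (negbTE ji) mulr0.
rewrite asboolT; last exact: (smooth_snd hF (szeta i)).
rewrite big_split_ord /= [X in _ + X](bigD1 i) //= (pd_rshift hB) //= pzeta eqxx mulr1.
rewrite !big1 ?addr0 ?add0r // => j ji.
  by rewrite (pd_rshift hB) //= pzeta (negbTE ji) mulr0.
by rewrite (pd_lshift hF) //= [X in _ * X]pd_cst mulr0.
Qed.

Lemma tangent_prod_ext x u v : tangent AP x u -> tangent AP x v ->
  push1 u = push1 v -> push2 u = push2 v ->
  u = v.
Proof.
move=> tu tv e1 e2; have [xi [zeta [D [D' key]]]] := tangent_prodE x.
by apply/funext => h; rewrite (key u tu) (key v tv) e1 e2.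
Qed.

Lemma tangent_push_fst x v : tangent AP x v -> tangent AB x.1 (push1 v).
Proof.
case: x => b q tv.
have [c Ac cb] := chart_ex hB b; have [d Ad dq] := chart_ex hF q.
have APcd : AP (prod_chart c d) by exists c, d.
have [a aE] := @tangentE _ _ _ AP hP (prod_chart c d) (b, q) v APcd (conj cb dq) tv.
have := tangentI (lsubmx a) Ac cb; congr tangent; apply/funext => phi.
rewrite /Defs.pushforward aE; case: asboolP => sphi; last first.
  by rewrite asboolF // => /(smooth_fstP phi q).
rewrite asboolT; last exact: (smooth_fst hB sphi).
rewrite big_split_ord /= [X in _ + X]big1 ?addr0; last first.
  by move=> j _; rewrite (pd_rshift hB) //= [X in _ * X]pd_cst mulr0.
by apply: eq_bigr => i _; rewrite (pd_lshift hF) // mxE.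
Qed.

Lemma tangent_push_snd x v : tangent AP x v -> tangent AF x.2 (push2 v).
Proof.
case: x => b q tv.
have [c Ac cb] := chart_ex hB b; have [d Ad dq] := chart_ex hF q.
have APcd : AP (prod_chart c d) by exists c, d.
have [a aE] := @tangentE _ _ _ AP hP (prod_chart c d) (b, q) v APcd (conj cb dq) tv.
have := tangentI (rsubmx a) Ad dq; congr tangent; apply/funext => phi.
rewrite /Defs.pushforward aE; case: asboolP => sphi; last first.
  by rewrite asboolF // => /(smooth_sndP phi b).
rewrite asboolT; last exact: (smooth_snd hF sphi).
rewrite big_split_ord /= [X in X + _]big1 ?add0r; last first.
  by move=> j _; rewrite (pd_lshift hF) //= [X in _ * X]pd_cst mulr0.
by apply: eq_bigr => i _; rewrite (pd_rshift hB) // mxE.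
Qed.

Lemma push_fst_liftB X x : vfield AB X ->
  push1 (at_point (lB X) x) = at_point X x.1.
Proof.
by move=> vX; apply/funext => phi; have := liftB_fst phi vX => /(congr1 (@^~ x)).
Qed.

Lemma push_snd_liftB X x : vfield AB X ->
  push2 (at_point (lB X) x) = (fun=> 0).
Proof.
by move=> vX; apply/funext => phi; have := liftB_snd phi vX => /(congr1 (@^~ x)).
Qed.

Lemma push_fst_liftF V x : vfield AF V ->
  push1 (at_point (lF V) x) = (fun=> 0).
Proof.
by move=> vV; apply/funext => phi; have := liftF_fst phi vV => /(congr1 (@^~ x)).
Qed.

Lemma push_snd_liftF V x : vfield AF V ->
  push2 (at_point (lF V) x) = at_point V x.2.
Proof.
by move=> vV; apply/funext => phi; have := liftF_snd phi vV => /(congr1 (@^~ x)).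
Qed.

Lemma push_fst_sum X V x : vfield AB X -> vfield AF V ->
  push1 (at_point (vadd (lB X) (lF V)) x) = at_point X x.1.
Proof.
move=> vX vV; apply/funext => phi.
have e1 := congr1 (@^~ phi) (push_fst_liftB x vX).
have e2 := congr1 (@^~ phi) (push_fst_liftF x vV).
rewrite /Defs.pushforward /at_point /= in e1 e2 *.
by rewrite /vadd e1 e2 addr0.
Qed.

Lemma push_snd_sum X V x : vfield AB X -> vfield AF V ->
  push2 (at_point (vadd (lB X) (lF V)) x) = at_point V x.2.
Proof.
move=> vX vV; apply/funext => phi.
have e1 := congr1 (@^~ phi) (push_snd_liftB x vX).
have e2 := congr1 (@^~ phi) (push_snd_liftF x vV).
rewrite /Defs.pushforward /at_point /= in e1 e2 *.
by rewrite /vadd e1 e2 add0r.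
Qed.

Lemma tangent_prod_ex x (u : functional R B) (w : functional R F) :
  tangent AB x.1 u -> tangent AF x.2 w ->
  exists v, [/\ tangent AP x v, push1 v = u & push2 v = w].
Proof.
move=> tu tw; have [X vX <-] := vfield_extend hB tu; have [V vV <-] := vfield_extend hF tw.
exists (at_point (vadd (lB X) (lF V)) x); split.
- by apply: vfield_tangent; apply: (vfield_vadd hP); [exact: vfield_liftB|exact: vfield_liftF].
- exact: push_fst_sum.
- exact: push_snd_sum.
Qed.

Lemma tangent_prod_lift x v : tangent AP x v ->
  exists X V, [/\ vfield AB X, vfield AF V & v = at_point (vadd (lB X) (lF V)) x].
Proof.
move=> tv; have [X vX eX] := vfield_extend hB (tangent_push_fst tv).
have [V vV eV] := vfield_extend hF (tangent_push_snd tv).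
exists X, V; split=> //; apply: (tangent_prod_ext tv).
- by apply: vfield_tangent; apply: (vfield_vadd hP); [exact: vfield_liftB|exact: vfield_liftF].
- by rewrite push_fst_sum.
- by rewrite push_snd_sum.
Qed.

(** Brackets of lifts are identified through this: their effect on functions pulled back from one
    factor is immediate. *)
Lemma operator_prod_ext (S T : operator R (B * F)%type) : vfield AP S -> vfield AP T ->
  (forall phi, S (fun p => phi p.1) = T (fun p => phi p.1)) ->
  (forall psi, S (fun p => psi p.2) = T (fun p => psi p.2)) -> S = T.
Proof.
move=> vS vT e1 e2; apply/funext => h; apply/funext => x.
suff e : at_point S x = at_point T x by have := congr1 (@^~ h) e.
apply: tangent_prod_ext (vfield_tangent x vS) (vfield_tangent x vT) _ _.
  by apply/funext => phi; have := congr1 (@^~ x) (e1 phi).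
by apply/funext => phi; have := congr1 (@^~ x) (e2 phi).
Qed.

Lemma bracket_liftBB X Y : vfield AB X -> vfield AB Y ->
  bracket (lB X) (lB Y) = lB (bracket X Y).
Proof.
move=> vX vY; have vXY := vfield_bracket hB vX vY.
apply: operator_prod_ext => [|||].
- by apply: (vfield_bracket hP); exact: vfield_liftB.
- exact: vfield_liftB.
- by move=> phi; apply/funext => x; rewrite /bracket !liftB_fst.
- move=> psi; apply/funext => x; rewrite /bracket !liftB_snd // (vfield_cst _ _ (vfield_liftB vX)).
  by rewrite (vfield_cst _ _ (vfield_liftB vY)) subr0.
Qed.

Lemma bracket_liftFF V W : vfield AF V -> vfield AF W ->
  bracket (lF V) (lF W) = lF (bracket V W).
Proof.
move=> vV vW; have vVW := vfield_bracket hF vV vW.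
apply: operator_prod_ext => [|||].
- by apply: (vfield_bracket hP); exact: vfield_liftF.
- exact: vfield_liftF.
- move=> psi; apply/funext => x; rewrite /bracket !liftF_fst // (vfield_cst _ _ (vfield_liftF vV)).
  by rewrite (vfield_cst _ _ (vfield_liftF vW)) subr0.
- by move=> phi; apply/funext => x; rewrite /bracket !liftF_snd.
Qed.

Lemma vfield0 : vfield AP (fun _ _ => 0).
Proof. by split=> [x|h _]; [exact: tangent0|exact: smooth_cst]. Qed.

Lemma bracket_liftBF X V : vfield AB X -> vfield AF V ->
  bracket (lB X) (lF V) = (fun _ _ => 0).
Proof.
move=> vX vV; have vlX := vfield_liftB vX; have vlV := vfield_liftF vV.
apply: operator_prod_ext => [|||].
- exact: (vfield_bracket hP).
- exact: vfield0.
- move=> phi; apply/funext => x; rewrite /bracket liftF_fst // liftB_fst //.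
  by rewrite liftF_fst // (vfield_cst _ _ vlX) subr0.
- move=> psi; apply/funext => x; rewrite /bracket liftF_snd // !liftB_snd //.
  by rewrite (vfield_cst _ _ vlV) subr0.
Qed.

Lemma bracket_liftFB X V : vfield AB X -> vfield AF V ->
  bracket (lF V) (lB X) = (fun _ _ => 0).
Proof.
move=> vX vV; rewrite bracketC bracket_liftBF //.
by apply/funext => h; apply/funext => x; rewrite /vscale mulr0.
Qed.

End Lift.

(** * Warped products *)

Section Warped.
Context {R : realType} {B F : topologicalType} {m n : nat}.
Context (AB : set (chart R B m)) (AF : set (chart R F n)).
Context (hB : atlas AB) (hF : atlas AF).
Context (gB : tensor02 R B) (gF : tensor02 R F) (f : B -> R).
Context (hgB : sing_metric AB gB) (hgF : sing_metric AF gF) (sf : smooth AB f).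
Local Notation AP := (prod_atlas AB AF).
Local Notation push1 v := (Defs.pushforward fst v).
Local Notation push2 v := (Defs.pushforward snd v).
Local Notation lB := (liftB AB AF).
Local Notation lF := (liftF AB AF).
Local Notation gP := (warped_metric gB gF f).
Implicit Types (X Y Z T P : operator R B) (U V W : operator R F) (x : B * F).
Implicit Types (u v : functional R (B * F)%type).

Let hP : atlas AP := prod_atlasP hB hF.
Let vlB X : vfield AB X -> vfield AP (lB X) := fun h => vfield_liftB hB hF h.
Let vlF V : vfield AF V -> vfield AP (lF V) := fun h => vfield_liftF hB hF h.

Lemma smooth_sqr_f : smooth AB (fun b => f b ^+ 2).
Proof. exact: (smooth_mul hB). Qed.

Lemma smooth_prod_mul (phi : B -> R) (psi : F -> R) : smooth AB phi -> smooth AF psi ->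
  smooth AP (fun x => phi x.1 * psi x.2).
Proof.
by move=> s1 s2; apply: (smooth_mul hP); [exact: smooth_fst|exact: smooth_snd].
Qed.

(** Smoothness has to be checked for arbitrary fields, not only for sums of lifts. The pushforwards
    are expanded in frames of the factors, and the coefficients are values of the fields on the
    pulled-back [xi] and [zeta]. *)
Lemma warped_sing_metric : sing_metric AP gP.
Proof.
split=> [x u v tu tv|x a u u' v tu tu' tv|S T vS vT].
- rewrite /warped_metric.
  rewrite (metricC hgB (tangent_push_fst hB hF tu) (tangent_push_fst hB hF tv)).
  by rewrite (metricC hgF (tangent_push_snd hB hF tu) (tangent_push_snd hB hF tv)).
- rewrite /warped_metric.
  have := metric_linl hgB a (tangent_push_fst hB hF tu) (tangent_push_fst hB hF tu')
    (tangent_push_fst hB hF tv).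
  have := metric_linl hgF a (tangent_push_snd hB hF tu) (tangent_push_snd hB hF tu')
    (tangent_push_snd hB hF tv).
  rewrite /Defs.pushforward /= => -> ->; ring.
apply: (smooth_nearP hP) => -[b q].
have [E [xi fE]] := frame_ex hB b; have [G [zeta fG]] := frame_ex hF q.
have [vE sxi dE] := fE; have [vG szeta dG] := fG.
exists (fun x =>
   \sum_i \sum_j (S (fun p => xi i p.1) x * T (fun p => xi j p.1) x * inner gB (E i) (E j) x.1)
   + f x.1 ^+ 2 * \sum_i \sum_j (S (fun p => zeta i p.2) x * T (fun p => zeta j p.2) x
      * inner gF (G i) (G j) x.2)).
  have s1 (V : operator R (B * F)%type) i : vfield AP V -> smooth AP (V (fun p => xi i p.1)).
    by move=> vV; apply: vfield_smooth => //; exact: smooth_fst.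
  have s2 (V : operator R (B * F)%type) i : vfield AP V -> smooth AP (V (fun p => zeta i p.2)).
    by move=> vV; apply: vfield_smooth => //; exact: smooth_snd.
  apply: (smooth_add hP).
    do 2![apply: (smooth_sum hP) => ? _]; apply: (smooth_mul hP).
      by apply: (smooth_mul hP); exact: s1.
    by apply: (smooth_fst hB); exact: smooth_inner.
  apply: (smooth_mul hP); first exact: (smooth_fst hB smooth_sqr_f).
  do 2![apply: (smooth_sum hP) => ? _]; apply: (smooth_mul hP).
    by apply: (smooth_mul hP); exact: s2.
  by apply: (smooth_snd hF); exact: smooth_inner.
have n1 := @near_fst _ _ (b, q) _ dE; have n2 := @near_snd _ _ (b, q) _ dG.
apply: filterS (near_and n1 n2) => x [[_ k1] [_ k2]].
have tS := vfield_tangent x vS; have tT := vfield_tangent x vT.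
have e1 v : tangent AP x v -> push1 v =
    (fun h => \sum_i v (fun p => xi i p.1) * at_point (E i) x.1 h).
  by move=> tv; rewrite {1}(k1 _ (tangent_push_fst hB hF tv)).
have e2 v : tangent AP x v -> push2 v =
    (fun h => \sum_i v (fun p => zeta i p.2) * at_point (G i) x.2 h).
  by move=> tv; rewrite {1}(k2 _ (tangent_push_snd hB hF tv)).
rewrite /inner /warped_metric (e1 _ tS) (e1 _ tT) (e2 _ tS) (e2 _ tT).
have tE i := vfield_tangent x.1 (vE i); have tG i := vfield_tangent x.2 (vG i).
congr (_ + _ * _).
  rewrite (metric_suml hB hgB) //; last exact: tangent_lincomb.
  apply: eq_bigr => i _; rewrite (metric_sumr hB hgB) // mulr_sumr.
  by apply: eq_bigr => j _; rewrite mulrA.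
rewrite (metric_suml hF hgF) //; last exact: tangent_lincomb.
apply: eq_bigr => i _; rewrite (metric_sumr hF hgF) // mulr_sumr.
by apply: eq_bigr => j _; rewrite mulrA.
Qed.

Let hgP : sing_metric AP gP := warped_sing_metric.

Lemma inner_BB X Y : vfield AB X -> vfield AB Y ->
  inner gP (lB X) (lB Y) = (fun x => inner gB X Y x.1).
Proof.
move=> vX vY; apply/funext => x; rewrite /inner /warped_metric.
rewrite !push_fst_liftB // !push_snd_liftB // (metric0l hF hgF) ?mulr0 ?addr0 //.
exact: tangent0.
Qed.

Lemma inner_BF X V : vfield AB X -> vfield AF V -> inner gP (lB X) (lF V) = (fun=> 0).
Proof.
move=> vX vV; apply/funext => x; rewrite /inner /warped_metric.
rewrite push_fst_liftB // push_snd_liftB // push_fst_liftF // push_snd_liftF //.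
rewrite (metric0l hF hgF) ?(metric0r hB hgB) ?mulr0 ?addr0 //; exact: vfield_tangent.
Qed.

Lemma inner_FB X V : vfield AB X -> vfield AF V -> inner gP (lF V) (lB X) = (fun=> 0).
Proof.
by move=> vX vV; rewrite (innerC hgP (vlF vV) (vlB vX)) inner_BF.
Qed.

Lemma inner_FF V W : vfield AF V -> vfield AF W ->
  inner gP (lF V) (lF W) = (fun x => f x.1 ^+ 2 * inner gF V W x.2).
Proof.
move=> vV vW; apply/funext => x; rewrite /inner /warped_metric.
rewrite !push_fst_liftF // !push_snd_liftF // (metric0l hB hgB) ?add0r //.
exact: tangent0.
Qed.

Lemma inner0r (S : operator R (B * F)%type) : vfield AP S ->
  inner gP S (fun _ _ => 0) = (fun=> 0).
Proof.
move=> vS; apply/funext => x; exact: (metric0r hP hgP (vfield_tangent x vS)).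
Qed.

Lemma liftB_cst X (a : R) : vfield AB X -> lB X (fun=> a) = (fun=> 0).
Proof. by move=> vX; apply/funext => x; apply: vfield_cst (vlB vX). Qed.

Lemma liftF_cst V (a : R) : vfield AF V -> lF V (fun=> a) = (fun=> 0).
Proof. by move=> vV; apply/funext => x; apply: vfield_cst (vlF vV). Qed.

Lemma derive_sqr_f X b : vfield AB X -> X (fun b => f b ^+ 2) b = 2 * f b * X f b.
Proof. by move=> vX; rewrite (vfield_mul hB b vX sf sf); ring. Qed.

Lemma liftB_innerFF X V W : vfield AB X -> vfield AF V -> vfield AF W ->
  lB X (fun x => f x.1 ^+ 2 * inner gF V W x.2) =
  (fun x => 2 * f x.1 * X f x.1 * inner gF V W x.2).
Proof.
move=> vX vV vW; rewrite (liftB_mul hB hF vX smooth_sqr_f) //; last exact: smooth_inner.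
by apply/funext => x; rewrite derive_sqr_f.
Qed.

Lemma liftF_innerFF U V W : vfield AF U -> vfield AF V -> vfield AF W ->
  lF U (fun x => f x.1 ^+ 2 * inner gF V W x.2) =
  (fun x => f x.1 ^+ 2 * U (inner gF V W) x.2).
Proof.
move=> vU vV vW; rewrite (liftF_mul hB hF vU smooth_sqr_f) //; exact: smooth_inner.
Qed.

(** * Koszul forms of lifted fields *)

Section KoszulTable.
Context (X Y Z : operator R B) (U V W : operator R F).
Context (vX : vfield AB X) (vY : vfield AB Y) (vZ : vfield AB Z).
Context (vU : vfield AF U) (vV : vfield AF V) (vW : vfield AF W).

Let vbB (S S' : operator R B) : vfield AB S -> vfield AB S' -> vfield AB (bracket S S') :=
  fun vS vT => vfield_bracket hB vS vT.
Let vbF (S S' : operator R F) : vfield AF S -> vfield AF S' -> vfield AF (bracket S S') :=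
  fun vS vT => vfield_bracket hF vS vT.

Ltac koszul_lift :=
  apply/funext => x; rewrite /koszul;
  rewrite ?bracket_liftBB ?bracket_liftBF ?bracket_liftFB ?bracket_liftFF //;
  rewrite ?inner_BB ?inner_BF ?inner_FB ?inner_FF ?inner0r //;
    do ?[by apply: vbB|by apply: vbF|by apply: vlB|by apply: vlF];
  rewrite ?liftB_innerFF ?liftF_innerFF ?liftB_cst ?liftF_cst //;
  rewrite ?liftB_fst ?liftF_fst //.

Lemma koszul_BBB : koszul gP (lB X) (lB Y) (lB Z) = (fun x => koszul gB X Y Z x.1).
Proof. by koszul_lift. Qed.

Lemma koszul_BBF : koszul gP (lB X) (lB Y) (lF W) = (fun=> 0).
Proof. koszul_lift; ring. Qed.

Lemma koszul_BFB : koszul gP (lB X) (lF W) (lB Y) = (fun=> 0).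
Proof. koszul_lift; ring. Qed.

Lemma koszul_FBB : koszul gP (lF W) (lB X) (lB Y) = (fun=> 0).
Proof. koszul_lift; ring. Qed.

Lemma koszul_BFF : koszul gP (lB X) (lF V) (lF W) =
  (fun x => f x.1 * X f x.1 * inner gF V W x.2).
Proof. by koszul_lift; rewrite ?(innerC hgF vW vV); field. Qed.

Lemma koszul_FBF : koszul gP (lF V) (lB X) (lF W) =
  (fun x => f x.1 * X f x.1 * inner gF V W x.2).
Proof. by koszul_lift; rewrite ?(innerC hgF vW vV); field. Qed.

Lemma koszul_FFB : koszul gP (lF V) (lF W) (lB X) =
  (fun x => - (f x.1 * X f x.1 * inner gF V W x.2)).
Proof. by koszul_lift; field. Qed.

Lemma koszul_FFF : koszul gP (lF U) (lF V) (lF W) =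
  (fun x => f x.1 ^+ 2 * koszul gF U V W x.2).
Proof. koszul_lift; rewrite /koszul; ring. Qed.

End KoszulTable.

(** At a single point every tangent vector is the value of a sum of two lifts, and a linear form
    depends only on that value, so testing on lifts is enough. *)
Lemma represents_lift (w : form1 R (B * F)%type) x v : linear_form AP w ->
  tangent AP x v ->
  (forall X, vfield AB X -> w (lB X) x = gB x.1 (push1 v) (at_point X x.1)) ->
  (forall V, vfield AF V -> w (lF V) x = f x.1 ^+ 2 * gF x.2 (push2 v) (at_point V x.2)) ->
  represents AP gP x v w.
Proof.
move=> lw tv w1 w2; split=> // S vS.
have [X [V [vX vV e]]] := tangent_prod_lift hB hF (vfield_tangent x vS).
have vXV : vfield AP (vadd (lB X) (lF V)).
  by apply: (vfield_vadd hP); [exact: vlB|exact: vlF].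
rewrite (linear_form_at hP lw vS vXV e) e.
have [wD _] := lw; rewrite wD; [|exact: vlB|exact: vlF].
by rewrite w1 // w2 // /warped_metric push_fst_sum // push_snd_sum.
Qed.

(** Lifting a basis of each factor makes the Gram matrix block diagonal, from which the signature of
    the warped metric is read off. *)
Lemma prod_basis b q (bB : 'I_m -> functional R B) (bF : 'I_n -> functional R F) :
  is_basis AB b bB -> is_basis AF q bF ->
  exists bP, is_basis AP (b, q) bP /\
    gram gP (b, q) bP = block_mx (gram gB b bB) 0 0 (f b ^+ 2 *: gram gF q bF).
Proof.
move=> [tB dB] [tF dF].
have /choice [eB eBE] : forall i, exists v,
    [/\ tangent AP (b, q) v, push1 v = bB i & push2 v = (fun=> 0)].
  by move=> i; apply: (tangent_prod_ex hB hF) => //=; exact: tangent0.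
have /choice [eF eFE] : forall i, exists v,
    [/\ tangent AP (b, q) v, push1 v = (fun=> 0) & push2 v = bF i].
  by move=> i; apply: (tangent_prod_ex hB hF) => //=; exact: tangent0.
pose bP (k : 'I_(m + n)) := match fintype.split k with inl i => eB i | inr j => eF j end.
have bPl i : bP (lshift n i) = eB i by rewrite /bP; case: split_ordP => k /eqP;
  rewrite ?eq_lshift ?eq_lrshift // => /eqP ->.
have bPr j : bP (rshift m j) = eF j by rewrite /bP; case: split_ordP => k /eqP;
  rewrite ?eq_rshift ?eq_rlshift // => /eqP ->.
have tP k : tangent AP (b, q) (bP k).
  by case: (split_ordP k) => i ->; rewrite ?bPl ?bPr; [case: (eBE i)|case: (eFE i)].
have pc1 a : push1 (lincomb a bP) = lincomb (lsubmx a) bB.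
  apply/funext => h; rewrite /Defs.pushforward /lincomb big_split_ord /= [X in _ + X]big1 ?addr0.
    apply: eq_bigr => i _; rewrite mxE bPl; have [_ <- _] := eBE i.
    by [].
  move=> j _; rewrite bPr; have [_ e _] := eFE j.
  by have := congr1 (@^~ h) e; rewrite /Defs.pushforward /= => ->; rewrite mulr0.
have pc2 a : push2 (lincomb a bP) = lincomb (rsubmx a) bF.
  apply/funext => h; rewrite /Defs.pushforward /lincomb big_split_ord /= [X in X + _]big1 ?add0r.
    apply: eq_bigr => i _; rewrite mxE bPr; have [_ _ <-] := eFE i.
    by [].
  move=> j _; rewrite bPl; have [_ _ e] := eBE j.
  by have := congr1 (@^~ h) e; rewrite /Defs.pushforward /= => ->; rewrite mulr0.
exists bP; split.
  split=> // v tv.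
  have [a1 [a1E a1U]] := dB _ (tangent_push_fst hB hF tv).
  have [a2 [a2E a2U]] := dF _ (tangent_push_snd hB hF tv).
  exists (row_mx a1 a2); split.
    apply: (tangent_prod_ext hB hF tv); first exact: tangent_comb.
      by rewrite pc1 row_mxKl.
    by rewrite pc2 row_mxKr.
  move=> a aE; rewrite -[a]hsubmxK; congr row_mx.
    by apply: a1U; rewrite aE pc1.
  by apply: a2U; rewrite aE pc2.
apply/matrixP => k l; rewrite mxE /warped_metric.
case: (split_ordP k) => i ->; case: (split_ordP l) => j ->; rewrite ?bPl ?bPr.
- rewrite block_mxEul mxE; have [_ -> ->] := eBE i; have [_ -> ->] := eBE j.
  by rewrite (metric0l hF hgF) ?mulr0 ?addr0 //; exact: tangent0.
- rewrite block_mxEur mxE; have [_ -> ->] := eBE i; have [_ -> ->] := eFE j.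
  by rewrite (metric0l hF hgF) // (metric0r hB hgB) // mulr0 addr0.
- rewrite block_mxEdl mxE; have [_ -> ->] := eFE i; have [_ -> ->] := eBE j.
  by rewrite (metric0r hF hgF) // (metric0l hB hgB) // mulr0 addr0.
- rewrite block_mxEdr !mxE; have [_ -> ->] := eFE i; have [_ -> ->] := eFE j.
  by rewrite (metric0l hB hgB) ?add0r //; exact: tangent0.
Qed.

Lemma warped_signature b q s t s' t' : f b != 0 ->
  has_signature AB gB b s t -> has_signature AF gF q s' t' ->
  has_signature AP gP (b, q) (s + s') (t + t').
Proof.
move=> fb; have [bB bbB] := basis_ex hB b; have [bF bbF] := basis_ex hF q.
move=> /(has_signatureP hB hgB _ _ bbB) h1 /(has_signatureP hF hgF _ _ bbF) h2.
have [bP [bbP GE]] := prod_basis bbB bbF.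
apply/(has_signatureP hP hgP _ _ bbP); rewrite GE; apply: signature_block => //.
by apply: signature_scale => //; rewrite exprn_even_gt0.
Qed.

Lemma warped_signature0 b q s t : f b = 0 -> has_signature AB gB b s t ->
  has_signature AP gP (b, q) s t.
Proof.
move=> fb; have [bB bbB] := basis_ex hB b; have [bF bbF] := basis_ex hF q.
move=> /(has_signatureP hB hgB _ _ bbB) h1.
have [bP [bbP GE]] := prod_basis bbB bbF.
apply/(has_signatureP hP hgP _ _ bbP); rewrite GE fb expr0n scale0r.
by have := signature_block h1 (@signature0 R n); rewrite !addn0.
Qed.

Lemma near_slice2 (b : B) (q : F) (P : set (B * F)) :
  (\forall x \near (b, q), P x) -> \forall q' \near q, P (b, q').
Proof.
move=> nP; have c : (fun q' => (b, q')) q' @[q' --> q] --> (b, q).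
  by apply: cvg_pair; [exact: cvg_cst|exact: cvg_id].
exact: c nP.
Qed.

Lemma near_slice1 (b : B) (q : F) (P : set (B * F)) :
  (\forall x \near (b, q), P x) -> \forall b' \near b, P (b', q).
Proof.
move=> nP; have c : (fun b' => (b', q)) b' @[b' --> b] --> (b, q).
  by apply: cvg_pair; [exact: cvg_id|exact: cvg_cst].
exact: c nP.
Qed.

(** Along the slice over [b] the signature of [gB] is fixed, so constancy of the total signature
    forces constancy of that of [gF]. *)
Lemma regular_fiber (b : B) (q : F) : f b != 0 -> regular_point AP gP (b, q) ->
  regular_point AF gF q.
Proof.
move=> fb [s [t nst]].
have [sB [tB stB]] := has_signature_ex hB hgB b.
exists (s - sB)%N, (t - tB)%N; apply: filterS (near_slice2 nst) => q' st.
have [s' [t' st']] := has_signature_ex hF hgF q'.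
have [-> ->] := has_signature_uniq hP hgP st (warped_signature fb stB st').
by rewrite !addKn.
Qed.

(* At a zero of [f] the warped metric has rank [m]; by regularity it still has
   rank [m] at nearby points where [f] does not vanish, so [gF] vanishes. *)
Lemma regular_zero (b : B) (q : F) X V W : nondegenerate_metric AB gB -> f b = 0 ->
  regular_point AP gP (b, q) -> vfield AB X -> vfield AF V -> vfield AF W ->
  X f b * inner gF V W q = 0.
Proof.
move=> nd fb [s [t nst]] vX vV vW.
have [nz|nz] := pselect (\forall b' \near b, f b' = 0).
  rewrite (vfield_near hB vX sf (smooth_cst hB 0) nz).
  by rewrite (vfield_cst _ _ vX) mul0r.
have [sB [tB stB]] := has_signature_ex hB hgB b.
have e0 := has_signature_uniq hP hgP (nbhs_singleton nst) (warped_signature0 q fb stB).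
have [b' [fb' st']] : exists b', f b' != 0 /\ has_signature AP gP (b', q) s t.
  apply: contrapT => H; apply: nz; apply: filterS (near_slice1 nst) => b' st'.
  by apply/eqP/negPn/negP => fb'; apply: H; exists b'.
have [sB' [tB' stB']] := has_signature_ex hB hgB b'.
have [sF [tF stF]] := has_signature_ex hF hgF q.
have [e1 e2] := has_signature_uniq hP hgP st' (warped_signature fb' stB' stF).
have r1 := nondegenerate_signature hB hgB nd stB.
have r2 := nondegenerate_signature hB hgB nd stB'.
have [e3 e4] := e0.
have [sF0 tF0] : sF = 0%N /\ tF = 0%N.
  have : (sF + tF)%N = 0%N.
    apply/eqP; rewrite -(eqn_add2l m) addn0 -{1}r2 -r1 -e3 -e4 e1 e2.
    by rewrite addnACA.
  by move/eqP; rewrite addn_eq0 => /andP[/eqP -> /eqP ->].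
have [bF bbF] := basis_ex hF q; have [tb dec] := bbF.
rewrite sF0 tF0 in stF; have /(has_signatureP hF hgF _ _ bbF) /signature_eq0 G0 := stF.
suff -> : inner gF V W q = 0 by rewrite mulr0.
have [a [aE _]] := dec _ (vfield_tangent q vV).
have [a' [a'E _]] := dec _ (vfield_tangent q vW).
rewrite /inner aE a'E /lincomb (metric_suml hF hgF) //; last exact: tangent_lincomb.
rewrite big1 // => i _; rewrite (metric_sumr hF hgF) // big1 ?mulr0 // => j _.
by have /matrixP /(_ i j) := G0; rewrite !mxE => ->; rewrite mulr0.
Qed.

End Warped.

(** * The semi-symmetric connection built from a Levi-Civita connection *)

Section LeviCivita.
Context {R : realType} {M : topologicalType} {n : nat}.
Context (A : set (chart R M n)) (hA : atlas A).
Context (g : tensor02 R M) (hg : sing_metric A g).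
Context (D : operator R M -> operator R M -> operator R M) (hD : levi_civita A g D).
Implicit Types X Y Z P : operator R M.

Lemma levi_civita_vfield X Y : vfield A X -> vfield A Y -> vfield A (D X Y).
Proof. by case: hD => + _; exact. Qed.

(** The Koszul formula: metric compatibility expands the derivatives, vanishing torsion the
    brackets. *)
Lemma koszul_levi_civita X Y Z p : vfield A X -> vfield A Y -> vfield A Z ->
  koszul g X Y Z p = inner g (D X Y) Z p.
Proof.
have [_ [_ [_ [_ [_ [tor met]]]]]] := hD.
move=> vX vY vZ.
have vD S T := @levi_civita_vfield S T.
have br S T V : vfield A S -> vfield A T -> vfield A V ->
    inner g V (bracket S T) p = inner g V (D S T) p - inner g V (D T S) p.
  move=> vS vT vV.
  have -> : bracket S T = vadd (D S T) (vscale (fun=> -1) (D T S)).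
    apply/funext => h; apply/funext => q; rewrite -tor // /vadd /vscale; ring.
  have s1 := smooth_cst hA (-1).
  have v1 := vfield_vscale hA s1 (vD _ _ vT vS).
  rewrite (inner_vaddr hA hg (vD _ _ vS vT) v1 vV) (inner_vscaler hA hg s1 (vD _ _ vT vS) vV).
  by rewrite mulN1r.
rewrite /koszul !met // !br //.
rewrite (innerC hg (vD _ _ vX vY) vZ) (innerC hg (vD _ _ vY vZ) vX) (innerC hg (vD _ _ vZ vX) vY).
by field.
Qed.

(** The vector-valued derivative whose lower form is [koszul_hat]. *)
Definition semi_symmetric P X Y := vadd (D X Y) (vscale (inner g Y P) X).

Lemma vfield_semi_symmetric P X Y : vfield A P -> vfield A X -> vfield A Y ->
  vfield A (semi_symmetric P X Y).
Proof.
move=> vP vX vY; apply: (vfield_vadd hA); first exact: levi_civita_vfield.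
by apply: (vfield_vscale hA) => //; exact: smooth_inner.
Qed.

Lemma koszul_hatE P X Y Z p : vfield A P -> vfield A X -> vfield A Y -> vfield A Z ->
  koszul_hat g P X Y Z p = inner g (semi_symmetric P X Y) Z p.
Proof.
move=> vP vX vY vZ; have s := smooth_inner hg vY vP.
rewrite (inner_vaddl hg (levi_civita_vfield vX vY) (vfield_vscale hA s vX) vZ).
by rewrite (inner_vscalel hA hg _ vX vZ) /koszul_hat koszul_levi_civita.
Qed.

Lemma represents_koszul_hat P X Y p : vfield A P -> vfield A X -> vfield A Y ->
  represents A g p (at_point (semi_symmetric P X Y) p) (koszul_hat g P X Y).
Proof.
move=> vP vX vY; split; first by apply: vfield_tangent; exact: vfield_semi_symmetric.
by move=> Z vZ; rewrite koszul_hatE.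
Qed.

(** Both outcomes of the choice give [h p]: an extension agrees with [h] at regular points, and the
    fallback is [h] itself. *)
Lemma smooth_extension_regular (h : M -> R) p : regular_point A g p ->
  smooth_extension A g h p = h p.
Proof.
by move=> rp; rewrite /smooth_extension; case: xgetP => // k _ [_ ->].
Qed.

Definition cov_hat P X Y Z T p : R :=
  X (koszul_hat g P Y Z T) p
  - inner g (semi_symmetric P X T) (semi_symmetric P Y Z) p.

Lemma smooth_cov_hat P X Y Z T : vfield A P -> vfield A X -> vfield A Y ->
  vfield A Z -> vfield A T -> smooth A (cov_hat P X Y Z T).
Proof.
move=> vP vX vY vZ vT; apply: (smooth_sub hA).
  by apply: vfield_smooth => //; exact: smooth_koszul_hat.
by apply: smooth_inner => //; exact: vfield_semi_symmetric.
Qed.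

(** The expression to be extended is already smooth everywhere here, so the extension changes
    nothing. *)
Lemma cov_der_hat P X Y Z T : vfield A P -> vfield A X -> vfield A Y ->
  vfield A Z -> vfield A T ->
  cov_der A g (koszul_hat g P) X (koszul_hat g P Y Z) T = cov_hat P X Y Z T.
Proof.
move=> vP vX vY vZ vT; apply: (smooth_extensionE hA (regular_dense hA hg)).
  exact: smooth_cov_hat.
move=> p _; congr (_ - _).
by rewrite (cometricE hA hg (represents_koszul_hat p vP vX vT) (represents_koszul_hat p vP vY vZ)).
Qed.

End LeviCivita.

Section Scaling.
Context {R : realType}.

Lemma metric_scalel (M : topologicalType) k (A : set (chart R M k)) (g : tensor02 R M)
    p (a : R) (u v : functional R M) : atlas A -> sing_metric A g ->
  tangent A p u -> tangent A p v -> g p (fun h => a * u h) v = a * g p u v.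
Proof.
move=> hA hg tu tv; have := metric_linl hg a tu (tangent0 hA p) tv.
rewrite (metric0l hA hg) // addr0 => <-.
by congr (g p _ v); apply/funext => h; rewrite addr0.
Qed.

Lemma tangent_scalel (M : topologicalType) k (A : set (chart R M k)) p (a : R)
    (u : functional R M) : atlas A -> tangent A p u -> tangent A p (fun h => a * u h).
Proof.
move=> hA tu; have := tangent_lin hA a tu (tangent0 hA p).
by congr tangent; apply/funext => h; rewrite addr0.
Qed.

End Scaling.

(** * Covariant derivatives on warped products *)

Section CovDer.
Context {R : realType} {B F : topologicalType} {m n : nat}.
Context (AB : set (chart R B m)) (AF : set (chart R F n)).
Context (hB : atlas AB) (hF : atlas AF).
Context (gB : tensor02 R B) (gF : tensor02 R F) (f : B -> R).
Context (hgB : sing_metric AB gB) (nd : nondegenerate_metric AB gB).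
Context (hgF : sing_metric AF gF) (srF : semi_regular AF gF) (sf : smooth AB f).
Context (DB : operator R B -> operator R B -> operator R B).
Context (hDB : levi_civita AB gB DB).
Context (P : operator R B) (vP : vfield AB P).
Local Notation AP := (prod_atlas AB AF).
Local Notation push1 v := (Defs.pushforward fst v).
Local Notation push2 v := (Defs.pushforward snd v).
Local Notation lB := (liftB AB AF).
Local Notation lF := (liftF AB AF).
Local Notation gP := (warped_metric gB gF f).
Local Notation Kh := (koszul_hat gP (lB P)).
Local Notation N a b c d := (cov_der AP gP Kh a (Kh b c) d).
Local Notation DH := (semi_symmetric gB DB P).
Local Notation gf := (differential f).
Implicit Types (x : B * F).

Let hP : atlas AP := prod_atlasP hB hF.
Let hgP : sing_metric AP gP := warped_sing_metric hB hF hgB hgF sf.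

Let vlB S : vfield AB S -> vfield AP (lB S) := fun h => vfield_liftB hB hF h.
Let vlF S : vfield AF S -> vfield AP (lF S) := fun h => vfield_liftF hB hF h.

(** * Koszul forms of lifts with the term in [P] *)

Section Table.
Context (X Y Z T : operator R B) (U V W Q : operator R F).
Context (vX : vfield AB X) (vY : vfield AB Y) (vZ : vfield AB Z) (vT : vfield AB T).
Context (vU : vfield AF U) (vV : vfield AF V) (vW : vfield AF W) (vQ : vfield AF Q).

Lemma koszul_hat_BBB : Kh (lB X) (lB Y) (lB Z) = (fun x => koszul_hat gB P X Y Z x.1).
Proof.
apply/funext => x; rewrite /koszul_hat koszul_BBB //.
by rewrite !inner_BB.
Qed.

Lemma koszul_hat_BBF : Kh (lB X) (lB Y) (lF W) = (fun=> 0).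
Proof.
apply/funext => x; rewrite /koszul_hat (koszul_BBF hB hF hgB hgF sf) //.
by rewrite (inner_BF hB hF _ hgB hgF vX vW) mulr0 addr0.
Qed.

Lemma koszul_hat_BFB : Kh (lB X) (lF W) (lB Y) = (fun=> 0).
Proof.
apply/funext => x; rewrite /koszul_hat (koszul_BFB hB hF hgB hgF sf) //.
by rewrite (inner_FB hB hF hgB hgF sf vP vW) mul0r addr0.
Qed.

Lemma koszul_hat_FBB : Kh (lF W) (lB X) (lB Y) = (fun=> 0).
Proof.
apply/funext => x; rewrite /koszul_hat (koszul_FBB hB hF hgB hgF sf) //.
by rewrite (inner_FB hB hF hgB hgF sf vY vW) mulr0 addr0.
Qed.

Lemma koszul_hat_BFF : Kh (lB X) (lF V) (lF W) =
  (fun x => (f x.1 * X f x.1) * inner gF V W x.2).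
Proof.
apply/funext => x; rewrite /koszul_hat (koszul_BFF hB hF hgB hgF sf) //.
by rewrite (inner_FB hB hF hgB hgF sf vP vV) mul0r addr0.
Qed.

Lemma koszul_hat_FBF : Kh (lF V) (lB X) (lF W) =
  (fun x => (f x.1 * X f x.1 + inner gB X P x.1 * f x.1 ^+ 2) * inner gF V W x.2).
Proof.
apply/funext => x; rewrite /koszul_hat (koszul_FBF hB hF hgB hgF sf) //.
rewrite inner_BB // inner_FF //; ring.
Qed.

Lemma koszul_hat_FFB : Kh (lF V) (lF W) (lB X) =
  (fun x => (- (f x.1 * X f x.1)) * inner gF V W x.2).
Proof.
apply/funext => x; rewrite /koszul_hat (koszul_FFB hB hF hgB hgF sf) //.
by rewrite (inner_FB hB hF hgB hgF sf vP vW) mul0r addr0 mulNr.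
Qed.

Lemma koszul_hat_FFF : Kh (lF U) (lF V) (lF W) =
  (fun x => f x.1 ^+ 2 * koszul gF U V W x.2).
Proof.
apply/funext => x; rewrite /koszul_hat (koszul_FFF hB hF hgB hgF sf) //.
by rewrite (inner_FB hB hF hgB hgF sf vP vV) mul0r addr0.
Qed.

End Table.

(** A representative is recorded through its two components, in terms of which the warped metric
    splits. *)
Definition rep x (w : form1 R (B * F)%type) (u : functional R B) (v : functional R F) :=
  exists2 z, represents AP gP x z w & push1 z = u /\ push2 z = v.

Lemma cometric_rep x w w' u u' v v' : rep x w u v -> rep x w' u' v' ->
  cometric AP gP w w' x = gB x.1 u u' + f x.1 ^+ 2 * gF x.2 v v'.
Proof.
move=> [z zw [<- <-]] [z' zw' [<- <-]].
by rewrite (cometricE hP hgP zw zw').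
Qed.

Lemma rep_intro x w u v : linear_form AP w -> tangent AB x.1 u -> tangent AF x.2 v ->
  (forall S, vfield AB S -> w (lB S) x = gB x.1 u (at_point S x.1)) ->
  (forall S, vfield AF S -> w (lF S) x = f x.1 ^+ 2 * gF x.2 v (at_point S x.2)) ->
  rep x w u v.
Proof.
move=> lw tu tv wB wF; have [z [tz zu zv]] := tangent_prod_ex hB hF tu tv.
exists z => //; apply: (represents_lift hB hF) => // S vS.
  by rewrite zu wB.
by rewrite zv wF.
Qed.

Let linK S S' : vfield AP S -> vfield AP S' -> linear_form AP (Kh S S') :=
  fun vS vS' => linear_koszul_hat hP hgP (vlB vP) vS vS'.

Lemma rep_BB S S' x : vfield AB S -> vfield AB S' ->
  rep x (Kh (lB S) (lB S')) (at_point (DH S S') x.1) (fun=> 0).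
Proof.
move=> vS vS'; apply: rep_intro => [||| S0 vS0|S0 vS0].
- by apply: linK; exact: vlB.
- by apply: vfield_tangent; exact: (vfield_semi_symmetric hB hgB hDB).
- exact: tangent0.
- by rewrite koszul_hat_BBB // (koszul_hatE hB hgB hDB).
- by rewrite koszul_hat_BBF // (metric0l hF hgF) ?mulr0 //; exact: vfield_tangent.
Qed.

(** At a zero of [f] the quotient is 0 by convention, and the form itself is 0 because it carries
    the factor [f]; hence the same expression is a representative at every point. *)
Lemma rep_BF S V x : vfield AB S -> vfield AF V ->
  rep x (Kh (lB S) (lF V)) (fun=> 0) (fun h => S f x.1 / f x.1 * at_point V x.2 h).
Proof.
move=> vS vV; have tV := vfield_tangent x.2 vV; apply: rep_intro => [||| S0 vS0|S0 vS0].
- by apply: linK; [exact: vlB|exact: vlF].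
- exact: tangent0.
- exact: tangent_scalel.
- by rewrite koszul_hat_BFB // (metric0l hB hgB) //; exact: vfield_tangent.
- rewrite koszul_hat_BFF // (metric_scalel _ hF hgF tV) //; last exact: vfield_tangent.
  rewrite -/(inner gF V S0 x.2).
  have [->|f0] := eqVneq (f x.1) 0; first by ring.
  by field.
Qed.

Lemma rep_FB S V x : vfield AB S -> vfield AF V ->
  rep x (Kh (lF V) (lB S)) (fun=> 0)
    (fun h => (S f x.1 / f x.1 + inner gB S P x.1) * at_point V x.2 h).
Proof.
move=> vS vV; have tV := vfield_tangent x.2 vV; apply: rep_intro => [||| S0 vS0|S0 vS0].
- by apply: linK; [exact: vlF|exact: vlB].
- exact: tangent0.
- exact: tangent_scalel.
- by rewrite koszul_hat_FBB // (metric0l hB hgB) //; exact: vfield_tangent.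
- rewrite koszul_hat_FBF // (metric_scalel _ hF hgF tV) //; last exact: vfield_tangent.
  rewrite -/(inner gF V S0 x.2).
  have [->|f0] := eqVneq (f x.1) 0; first by ring.
  by field.
Qed.

(** The vertical part needs no scaling, since the vertical Koszul form and the warped metric both
    carry [f ^+ 2]. The gradient appears because horizontal fields enter the form only through their
    derivative of [f]. *)
Lemma rep_FF V V' x gr w : vfield AF V -> vfield AF V' ->
  represents AB gB x.1 gr gf -> represents AF gF x.2 w (koszul gF V V') ->
  rep x (Kh (lF V) (lF V')) (fun h => - f x.1 * inner gF V V' x.2 * gr h) w.
Proof.
move=> vV vV' [tgr grE] [tw wE]; apply: rep_intro => [||| S0 vS0|S0 vS0] //.
- by apply: linK; exact: vlF.
- exact: tangent_scalel.
- rewrite koszul_hat_FFB // (metric_scalel _ hB hgB tgr) //; last exact: vfield_tangent.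
  rewrite -grE // /differential; ring.
- by rewrite koszul_hat_FFF // wE.
Qed.

Lemma cov_derE a b c d k : smooth AP k ->
  (forall x, regular_point AP gP x -> k x = a (Kh b c d) x - cometric AP gP (Kh a d) (Kh b c) x) ->
  N a b c d = k.
Proof. by move=> sk kE; apply: (smooth_extensionE hP (regular_dense hP hgP)). Qed.

Lemma cometricC_rep x w w' u u' v v' : rep x w u v -> rep x w' u' v' ->
  cometric AP gP w w' x = cometric AP gP w' w x.
Proof.
move=> [z zw _] [z' zw' _]; rewrite (cometricE hP hgP zw zw') (cometricE hP hgP zw' zw).
by apply: (metricC hgP); [case: zw|case: zw'].
Qed.

Lemma gradient_apply b gr S : represents AB gB b gr gf -> vfield AB S ->
  S f b = gB b gr (at_point S b).
Proof. by move=> [_ grE] vS; rewrite -grE. Qed.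

Lemma koszul_represented S S' q : vfield AF S -> vfield AF S' ->
  exists w, represents AF gF q w (koszul gF S S').
Proof. by move=> vS vS'; have [KA _] := srF; have [_] := KA _ _ vS vS'; exact. Qed.

(** * Pairings of the lower derivatives of lifts *)

Section Cometric.
Context (S S' S0 S0' : operator R B) (G G' G0 G0' : operator R F) (x : B * F).
Context (vS : vfield AB S) (vS' : vfield AB S') (vS0 : vfield AB S0) (vS0' : vfield AB S0').
Context (vG : vfield AF G) (vG' : vfield AF G') (vG0 : vfield AF G0) (vG0' : vfield AF G0').

Let tG := vfield_tangent x.2 vG.
Let tG0 := vfield_tangent x.2 vG0.
Let tD (S S' : operator R B) (vS : vfield AB S) (vS' : vfield AB S') :
    tangent AB x.1 (at_point (DH S S') x.1) :=
  vfield_tangent x.1 (vfield_semi_symmetric hB hgB hDB vP vS vS').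
Let t0B := tangent0 hB x.1.
Let t0F := tangent0 hF x.2.

Lemma cometric_BB_BB :
  cometric AP gP (Kh (lB S) (lB S')) (Kh (lB S0) (lB S0')) x = inner gB (DH S S') (DH S0 S0') x.1.
Proof.
rewrite (cometric_rep (rep_BB x vS vS') (rep_BB x vS0 vS0')).
by rewrite (metric0l hF hgF t0F) mulr0 addr0.
Qed.

Lemma cometric_BF_BB : cometric AP gP (Kh (lB S0) (lF G)) (Kh (lB S) (lB S')) x = 0.
Proof.
rewrite (cometric_rep (rep_BF x vS0 vG) (rep_BB x vS vS')).
rewrite (metric0l hB hgB (tD vS vS')) (metric0r hF hgF) ?mulr0 ?addr0 //.
exact: tangent_scalel.
Qed.

Lemma cometric_FB_BB : cometric AP gP (Kh (lF G) (lB S0)) (Kh (lB S) (lB S')) x = 0.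
Proof.
rewrite (cometric_rep (rep_FB x vS0 vG) (rep_BB x vS vS')).
rewrite (metric0l hB hgB (tD vS vS')) (metric0r hF hgF) ?mulr0 ?addr0 //.
exact: tangent_scalel.
Qed.

(** The quotients are left uncancelled: at a zero of [f] the right side is 0, whereas its simplified
    form would be [S f * S' f] times the fibre metric. *)
Lemma cometric_BF_BF : cometric AP gP (Kh (lB S) (lF G)) (Kh (lB S') (lF G0)) x =
  f x.1 ^+ 2 * (S f x.1 / f x.1 * (S' f x.1 / f x.1) * inner gF G G0 x.2).
Proof.
rewrite (cometric_rep (rep_BF x vS vG) (rep_BF x vS' vG0)).
rewrite (metric0l hB hgB t0B) add0r (metric_scalel _ hF hgF tG); last exact: tangent_scalel.
rewrite (metricC hgF tG); last exact: tangent_scalel.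
rewrite (metric_scalel _ hF hgF tG0 tG) (metricC hgF tG0 tG) /inner; ring.
Qed.

Lemma cometric_FB_FB : cometric AP gP (Kh (lF G) (lB S)) (Kh (lF G0) (lB S')) x =
  f x.1 ^+ 2 * ((S f x.1 / f x.1 + inner gB S P x.1) *
    (S' f x.1 / f x.1 + inner gB S' P x.1) * inner gF G G0 x.2).
Proof.
rewrite (cometric_rep (rep_FB x vS vG) (rep_FB x vS' vG0)).
rewrite (metric0l hB hgB t0B) add0r (metric_scalel _ hF hgF tG); last exact: tangent_scalel.
rewrite (metricC hgF tG); last exact: tangent_scalel.
rewrite (metric_scalel _ hF hgF tG0 tG) (metricC hgF tG0 tG) /inner; ring.
Qed.

Lemma cometric_FB_BF : cometric AP gP (Kh (lF G) (lB S)) (Kh (lB S') (lF G0)) x =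
  f x.1 ^+ 2 * ((S f x.1 / f x.1 + inner gB S P x.1) *
    (S' f x.1 / f x.1) * inner gF G G0 x.2).
Proof.
rewrite (cometric_rep (rep_FB x vS vG) (rep_BF x vS' vG0)).
rewrite (metric0l hB hgB t0B) add0r (metric_scalel _ hF hgF tG); last exact: tangent_scalel.
rewrite (metricC hgF tG); last exact: tangent_scalel.
rewrite (metric_scalel _ hF hgF tG0 tG) (metricC hgF tG0 tG) /inner; ring.
Qed.

Lemma cometric_FF_BB : cometric AP gP (Kh (lF G) (lF G')) (Kh (lB S) (lB S')) x =
  - f x.1 * inner gF G G' x.2 * DH S S' f x.1.
Proof.
have [gr grP] := gradient_ex hB hgB f x.1 nd; have [w wP] := koszul_represented x.2 vG vG'.
rewrite (cometric_rep (rep_FF vG vG' grP wP) (rep_BB x vS vS')).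
have [tgr _] := grP; have [tw _] := wP.
rewrite (metric0r hF hgF tw) mulr0 addr0 (metric_scalel _ hB hgB tgr); last exact: tD.
by rewrite -(gradient_apply grP) //; exact: (vfield_semi_symmetric hB hgB hDB).
Qed.

(** Only one factor [1 / f] meets [f ^+ 2], so the cancelled formula is also correct at zeros of
    [f], where both sides are 0. *)
Lemma cometric_FF_BF : cometric AP gP (Kh (lF G) (lF G')) (Kh (lB S) (lF G0)) x =
  f x.1 * S f x.1 * koszul gF G G' G0 x.2.
Proof.
have [gr grP] := gradient_ex hB hgB f x.1 nd; have [w wP] := koszul_represented x.2 vG vG'.
rewrite (cometric_rep (rep_FF vG vG' grP wP) (rep_BF x vS vG0)).
have [tgr _] := grP; have [tw wE] := wP.
rewrite (metric0r hB hgB) ?add0r; last exact: tangent_scalel.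
rewrite (metricC hgF tw); last exact: tangent_scalel.
rewrite (metric_scalel _ hF hgF tG0 tw) (metricC hgF tG0 tw) -wE //.
have [->|f0] := eqVneq (f x.1) 0; first by ring.
by field.
Qed.

Lemma cometric_FF_FB : cometric AP gP (Kh (lF G) (lF G')) (Kh (lF G0) (lB S)) x =
  (f x.1 * S f x.1 + inner gB S P x.1 * f x.1 ^+ 2) * koszul gF G G' G0 x.2.
Proof.
have [gr grP] := gradient_ex hB hgB f x.1 nd; have [w wP] := koszul_represented x.2 vG vG'.
rewrite (cometric_rep (rep_FF vG vG' grP wP) (rep_FB x vS vG0)).
have [tgr _] := grP; have [tw wE] := wP.
rewrite (metric0r hB hgB) ?add0r; last exact: tangent_scalel.
rewrite (metricC hgF tw); last exact: tangent_scalel.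
rewrite (metric_scalel _ hF hgF tG0 tw) (metricC hgF tG0 tw) -wE //.
have [->|f0] := eqVneq (f x.1) 0; first by ring.
by field.
Qed.

Lemma cometric_FF_FF : cometric AP gP (Kh (lF G) (lF G')) (Kh (lF G0) (lF G0')) x =
  f x.1 ^+ 2 * (inner gF G G' x.2 * inner gF G0 G0' x.2 * cometric AB gB gf gf x.1 +
    cometric AF gF (koszul gF G G') (koszul gF G0 G0') x.2).
Proof.
have [gr grP] := gradient_ex hB hgB f x.1 nd; have [w wP] := koszul_represented x.2 vG vG'.
have [w' wP'] := koszul_represented x.2 vG0 vG0'.
rewrite (cometric_rep (rep_FF vG vG' grP wP) (rep_FF vG0 vG0' grP wP')).
rewrite (cometricE hB hgB grP grP) (cometricE hF hgF wP wP').
have [tgr _] := grP.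
rewrite (metric_scalel _ hB hgB tgr); last exact: tangent_scalel.
rewrite (metricC hgB tgr); last exact: tangent_scalel.
rewrite (metric_scalel _ hB hgB tgr tgr); ring.
Qed.

Lemma cometric_BB_FF : cometric AP gP (Kh (lB S) (lB S')) (Kh (lF G) (lF G')) x =
  - f x.1 * inner gF G G' x.2 * DH S S' f x.1.
Proof.
have [gr grP] := gradient_ex hB hgB f x.1 nd; have [w wP] := koszul_represented x.2 vG vG'.
by rewrite (cometricC_rep (rep_BB x vS vS') (rep_FF vG vG' grP wP)) cometric_FF_BB.
Qed.

Lemma cometric_BF_FF : cometric AP gP (Kh (lB S) (lF G0)) (Kh (lF G) (lF G')) x =
  f x.1 * S f x.1 * koszul gF G G' G0 x.2.
Proof.
have [gr grP] := gradient_ex hB hgB f x.1 nd; have [w wP] := koszul_represented x.2 vG vG'.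
by rewrite (cometricC_rep (rep_BF x vS vG0) (rep_FF vG vG' grP wP)) cometric_FF_BF.
Qed.

Lemma cometric_FB_FF : cometric AP gP (Kh (lF G0) (lB S)) (Kh (lF G) (lF G')) x =
  (f x.1 * S f x.1 + inner gB S P x.1 * f x.1 ^+ 2) * koszul gF G G' G0 x.2.
Proof.
have [gr grP] := gradient_ex hB hgB f x.1 nd; have [w wP] := koszul_represented x.2 vG vG'.
by rewrite (cometricC_rep (rep_FB x vS vG0) (rep_FF vG vG' grP wP)) cometric_FF_FB.
Qed.

Lemma cometric_BF_FB : cometric AP gP (Kh (lB S') (lF G0)) (Kh (lF G) (lB S)) x =
  f x.1 ^+ 2 * ((S f x.1 / f x.1 + inner gB S P x.1) *
    (S' f x.1 / f x.1) * inner gF G G0 x.2).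
Proof.
by rewrite (cometricC_rep (rep_BF x vS' vG0) (rep_FB x vS vG)) cometric_FB_BF.
Qed.

End Cometric.

(** * Covariant derivatives of the lower derivatives of lifts *)

Section CovTable.
Context (X Y Z T : operator R B) (U V W Q : operator R F).
Context (vX : vfield AB X) (vY : vfield AB Y) (vZ : vfield AB Z) (vT : vfield AB T).
Context (vU : vfield AF U) (vV : vfield AF V) (vW : vfield AF W) (vQ : vfield AF Q).

Let sD S : vfield AB S -> smooth AB (S f).
Proof. by move=> vS; exact: vfield_smooth. Qed.

Let sfD S : vfield AB S -> smooth AB (fun b => f b * S f b).
Proof. by move=> vS; apply: (smooth_mul hB) => //; exact: sD. Qed.

Let sP S : vfield AB S -> smooth AB (inner gB S P).
Proof. by move=> vS; exact: smooth_inner. Qed.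

Let sfP S : vfield AB S -> smooth AB (fun b => f b * S f b + inner gB S P b * f b ^+ 2).
Proof.
move=> vS; apply: (smooth_add hB); first exact: sfD.
by apply: (smooth_mul hB); [exact: sP|exact: smooth_sqr_f].
Qed.

Let sI S S' : vfield AF S -> vfield AF S' -> smooth AF (inner gF S S').
Proof. exact: smooth_inner. Qed.

Let sK S S' S0 : vfield AF S -> vfield AF S' -> vfield AF S0 -> smooth AF (koszul gF S S' S0).
Proof. exact: smooth_koszul. Qed.

Let derive_fD S S' b : vfield AB S -> vfield AB S' ->
  S (fun b => f b * S' f b) b = f b * S (S' f) b + S' f b * S f b.
Proof. by move=> vS vS'; rewrite (vfield_mul hB b vS sf (sD vS')). Qed.

Let sprod (phi : B -> R) (psi : F -> R) : smooth AB phi -> smooth AF psi ->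
  smooth AP (fun x => phi x.1 * psi x.2).
Proof. exact: smooth_prod_mul. Qed.

Lemma cov_BBBB : N (lB X) (lB Y) (lB Z) (lB T) = (fun x => cov_hat gB DB P X Y Z T x.1).
Proof.
apply: cov_derE => [|x _].
  apply: (smooth_fst hB); exact: (smooth_cov_hat hB hgB hDB).
by rewrite koszul_hat_BBB // liftB_fst // cometric_BB_BB.
Qed.

Lemma cov_BBBF : N (lB X) (lB Y) (lB Z) (lF Q) = (fun=> 0).
Proof.
apply: cov_derE => [|x _]; first exact: (smooth_cst hP).
by rewrite koszul_hat_BBF // (liftB_cst hB hF) // cometric_BF_BB // subrr.
Qed.

Lemma cov_BFBB : N (lB Z) (lF Q) (lB X) (lB Y) = (fun=> 0).
Proof.
apply: cov_derE => [|x _]; first exact: (smooth_cst hP).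
rewrite koszul_hat_FBB // (liftB_cst hB hF) //.
by rewrite (cometricC_rep (rep_BB x vZ vY) (rep_FB x vX vQ)) cometric_FB_BB // subrr.
Qed.

Lemma cov_FBBB : N (lF Q) (lB Z) (lB X) (lB Y) = (fun=> 0).
Proof.
apply: cov_derE => [|x _]; first exact: (smooth_cst hP).
by rewrite koszul_hat_BBB // liftF_fst // cometric_FB_BB // subrr.
Qed.

Lemma cov_BBFB : N (lB X) (lB Y) (lF Q) (lB Z) = (fun=> 0).
Proof.
apply: cov_derE => [|x _]; first exact: (smooth_cst hP).
rewrite koszul_hat_BFB // (liftB_cst hB hF) //.
by rewrite (cometricC_rep (rep_BB x vX vZ) (rep_BF x vY vQ)) cometric_BF_BB // subrr.
Qed.

Let regular0 (b : B) (q : F) S G G' : f b = 0 -> regular_point AP gP (b, q) -> vfield AB S ->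
  vfield AF G -> vfield AF G' -> S f b * inner gF G G' q = 0.
Proof. by move=> *; exact: (regular_zero hB hF hgB hgF sf nd). Qed.

(** The derivative of [f * Y f] contains [X f * Y f], which the pairing cancels where [f] is
    nonzero. At a regular zero of [f] the pairing is 0 and the extra term vanishes by [regular0]. *)
Lemma cov_BBFF : N (lB X) (lB Y) (lF W) (lF Q) =
  (fun x => (f x.1 * X (Y f) x.1) * inner gF W Q x.2).
Proof.
apply: cov_derE => [|[b q] rx].
  apply: (@sprod (fun b => f b * X (Y f) b) _ _ (sI vW vQ)).
  by apply: (smooth_mul hB) => //; apply: vfield_smooth => //; exact: sD.
rewrite koszul_hat_BFF // (liftB_mul hB hF vX (sfD vY) (sI vW vQ)) cometric_BF_BF //=.
rewrite derive_fD // (innerC hgF vQ vW).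
have [f0|f0] := eqVneq (f b) 0; last by field.
have h := regular0 f0 rx vX vW vQ.
rewrite f0 expr0n /= !mul0r add0r subr0 -mulrA h mulr0 //.
Qed.

Lemma cov_FFBB : N (lF W) (lF Q) (lB X) (lB Y) =
  (fun x => (- ((Y f x.1 + f x.1 * inner gB Y P x.1) * (X f x.1 + f x.1 * inner gB X P x.1)))
     * inner gF W Q x.2).
Proof.
have s S : vfield AB S -> smooth AB (fun b => S f b + f b * inner gB S P b).
  move=> vS; apply: (smooth_add hB); first exact: sD.
  by apply: (smooth_mul hB) => //; exact: sP.
apply: cov_derE => [|[b q] rx].
  apply: (@sprod (fun b => - ((Y f b + f b * inner gB Y P b) * (X f b + f b * inner gB X P b)))
    _ _ (sI vW vQ)).
  by apply: (smooth_opp hB); apply: (smooth_mul hB); exact: s.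
rewrite koszul_hat_FBB // (liftF_cst hB hF) // cometric_FB_FB //=.
have [f0|f0] := eqVneq (f b) 0; last by field.
(* At a zero of [f] the pairing is 0 by the convention on division, while the claimed value reduces
   to [Y f * X f] times the fibre metric, up to sign. *)
have h := regular0 f0 rx vX vW vQ.
by rewrite f0 expr0n /= !mul0r !addr0 subr0 mulNr -mulrA h mulr0 oppr0.
Qed.

Let sDH S S' : vfield AB S -> vfield AB S' -> smooth AB (DH S S' f).
Proof.
by move=> vS vS'; apply: vfield_smooth => //; exact: (vfield_semi_symmetric hB hgB hDB).
Qed.

Let sDD S S' : vfield AB S -> vfield AB S' -> smooth AB (S (S' f)).
Proof. by move=> vS vS'; apply: vfield_smooth => //; exact: sD. Qed.

Let derive_fDN S S' b : vfield AB S -> vfield AB S' ->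
  S (fun b => - (f b * S' f b)) b = - (f b * S (S' f) b + S' f b * S f b).
Proof.
move=> vS vS'; rewrite -derive_fD //.
exact: (tangent_opp hB (vfield_tangent b vS) (sfD vS')).
Qed.

(** Pairing a horizontal form with a vertical one involves no quotient, so one computation covers
    zeros of [f] as well. *)
Lemma cov_BFFB : N (lB X) (lF V) (lF W) (lB T) =
  (fun x => (f x.1 * DH X T f x.1 - (f x.1 * X (T f) x.1 + T f x.1 * X f x.1)) * inner gF V W x.2).
Proof.
apply: cov_derE => [|x _].
  apply: (@sprod (fun b => f b * DH X T f b - (f b * X (T f) b + T f b * X f b)) _ _ (sI vV vW)).
  apply: (smooth_sub hB); first by apply: (smooth_mul hB) => //; exact: sDH.
  exact: (smooth_add hB (smooth_mul hB sf (sDD vX vT)) (smooth_mul hB (sD vT) (sD vX))).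
rewrite koszul_hat_FFB // (liftB_mul hB hF vX (smooth_opp hB (sfD vT)) (sI vV vW)).
rewrite cometric_BB_FF // derive_fDN //; ring.
Qed.

Lemma cov_FBFB : N (lF V) (lB X) (lF W) (lB T) =
  (fun x => (- (X f x.1 * (T f x.1 + f x.1 * inner gB T P x.1))) * inner gF V W x.2).
Proof.
apply: cov_derE => [|[b q] rx].
  apply: (@sprod (fun b => - (X f b * (T f b + f b * inner gB T P b))) _ _ (sI vV vW)).
  apply: (smooth_opp hB); apply: (smooth_mul hB); first exact: sD.
  by apply: (smooth_add hB); [exact: sD|apply: (smooth_mul hB) => //; exact: sP].
rewrite koszul_hat_BFB // (liftF_cst hB hF) // cometric_FB_BF //=.
have [f0|f0] := eqVneq (f b) 0; last by field.
have h := regular0 f0 rx vX vV vW.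
rewrite f0 expr0n /= !mul0r addr0 subr0.
by transitivity (- (T f b * (X f b * inner gF V W q))); [ring|rewrite h mulr0 oppr0].
Qed.

Let derive_fP S S' b : vfield AB S -> vfield AB S' ->
  S (fun b => f b * S' f b + inner gB S' P b * f b ^+ 2) b =
  f b * S (S' f) b + S' f b * S f b +
    (inner gB S' P b * (2 * f b * S f b) + f b ^+ 2 * S (inner gB S' P) b).
Proof.
move=> vS vS'; have s2 := smooth_mul hB (sP vS') (smooth_sqr_f hB sf).
rewrite (vfield_add hB b vS (sfD vS') s2) derive_fD //.
by rewrite (vfield_mul hB b vS (sP vS') (smooth_sqr_f hB sf)) (derive_sqr_f hB sf).
Qed.

Lemma cov_BFBF : N (lB X) (lF V) (lB T) (lF W) =
  (fun x => (f x.1 * X (T f) x.1 + inner gB T P x.1 * (f x.1 * X f x.1)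
    + f x.1 ^+ 2 * X (inner gB T P) x.1) * inner gF V W x.2).
Proof.
apply: cov_derE => [|[b q] rx].
  apply: (@sprod (fun b => f b * X (T f) b + inner gB T P b * (f b * X f b)
    + f b ^+ 2 * X (inner gB T P) b) _ _ (sI vV vW)).
  apply: (smooth_add hB); last first.
    by apply: (smooth_mul hB); [exact: smooth_sqr_f|apply: vfield_smooth => //; exact: sP].
  exact: (smooth_add hB (smooth_mul hB sf (sDD vX vT)) (smooth_mul hB (sP vT) (sfD vX))).
rewrite koszul_hat_FBF // (liftB_mul hB hF vX (sfP vT) (sI vV vW)) cometric_BF_FB //=.
rewrite derive_fP //.
have [f0|f0] := eqVneq (f b) 0; last by field.
have h := regular0 f0 rx vX vV vW.
rewrite f0 expr0n /=.
by transitivity (T f b * (X f b * inner gF V W q)); [rewrite h; ring|ring].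
Qed.

Lemma cov_FBBF : N (lF V) (lB X) (lB T) (lF W) =
  (fun x => (f x.1 * DH X T f x.1) * inner gF V W x.2).
Proof.
apply: cov_derE => [|x _].
  apply: (@sprod (fun b => f b * DH X T f b) _ _ (sI vV vW)).
  by apply: (smooth_mul hB) => //; exact: sDH.
rewrite koszul_hat_BBF // (liftF_cst hB hF) // cometric_FF_BB //; ring.
Qed.

Let sVI S S0 S1 : vfield AF S -> vfield AF S0 -> vfield AF S1 -> smooth AF (S (inner gF S0 S1)).
Proof. by move=> vS vS0 vS1; apply: vfield_smooth => //; exact: sI. Qed.

Lemma cov_FFBF : N (lF U) (lF V) (lB Z) (lF Q) =
  (fun x => (f x.1 * Z f x.1 + inner gB Z P x.1 * f x.1 ^+ 2) *
    (U (inner gF V Q) x.2 - koszul gF U Q V x.2)).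
Proof.
apply: cov_derE => [|x _].
  apply: (@sprod _ (fun q => U (inner gF V Q) q - koszul gF U Q V q) (sfP vZ)).
  by apply: (smooth_sub hF); [exact: sVI|exact: sK].
rewrite koszul_hat_FBF // (liftF_mul hB hF vU (sfP vZ) (sI vV vQ)) cometric_FF_FB //; ring.
Qed.

Lemma cov_BFFF : N (lB Z) (lF Q) (lF U) (lF V) =
  (fun x => (f x.1 * Z f x.1) * koszul gF Q U V x.2).
Proof.
apply: cov_derE => [|x _]; first exact: (sprod (sfD vZ) (sK vQ vU vV)).
rewrite koszul_hat_FFF // (liftB_mul hB hF vZ (smooth_sqr_f hB sf) (sK vQ vU vV)).
rewrite cometric_BF_FF // (derive_sqr_f hB sf) //; ring.
Qed.

Lemma cov_FBFF : N (lF Q) (lB Z) (lF U) (lF V) =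
  (fun x => (f x.1 * Z f x.1) * (Q (inner gF U V) x.2 - koszul gF Q V U x.2)).
Proof.
apply: cov_derE => [|x _].
  apply: (@sprod _ (fun q => Q (inner gF U V) q - koszul gF Q V U q) (sfD vZ)).
  by apply: (smooth_sub hF); [exact: sVI|exact: sK].
rewrite koszul_hat_BFF // (liftF_mul hB hF vQ (sfD vZ) (sI vU vV)) cometric_FF_BF //; ring.
Qed.

Lemma cov_FFFB : N (lF U) (lF V) (lF Q) (lB Z) =
  (fun x => (- (f x.1 * Z f x.1)) * U (inner gF V Q) x.2
    - (f x.1 * Z f x.1 + inner gB Z P x.1 * f x.1 ^+ 2) * koszul gF V Q U x.2).
Proof.
have sN := smooth_opp hB (sfD vZ).
apply: cov_derE => [|x _].
  apply: (smooth_sub hP); first exact: (sprod sN (sVI vU vV vQ)).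
  exact: (sprod (sfP vZ) (sK vV vQ vU)).
by rewrite koszul_hat_FFB // (liftF_mul hB hF vU sN (sI vV vQ)) cometric_FB_FF.
Qed.

(** This is the second-order half of semi-regularity: the covariant derivative is a 1-form, and
    1-forms have smooth values on fields. *)
Lemma smooth_cov_fiber : smooth AF (cov_der AF gF (koszul gF) U (koszul gF V W) Q).
Proof.
have [_ h] := srF; have [[+ _ _] _] := h _ _ _ vV vW vU.
exact.
Qed.

Lemma cov_FFFF : N (lF U) (lF V) (lF W) (lF Q) =
  (fun x => f x.1 ^+ 2 * cov_der AF gF (koszul gF) U (koszul gF V W) Q x.2
    - (f x.1 ^+ 2 * cometric AB gB gf gf x.1) * (inner gF U Q x.2 * inner gF V W x.2)).
Proof.
have s2 := smooth_sqr_f hB sf.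
apply: cov_derE => [|[b q] rx].
  apply: (smooth_sub hP); first exact: (sprod s2 smooth_cov_fiber).
  apply: (@sprod (fun b => f b ^+ 2 * cometric AB gB gf gf b)
    (fun q => inner gF U Q q * inner gF V W q)).
    by apply: (smooth_mul hB) => //; exact: smooth_cometric_differential.
  by apply: (smooth_mul hF); exact: sI.
rewrite koszul_hat_FFF // (liftF_mul hB hF vU s2 (sK vV vW vQ)) cometric_FF_FF //=.
(* At a zero of [f] every term has a factor [f ^+ 2]. Elsewhere the fibre point is regular too, so
   the extension built into [cov_der] on [F] takes the value of its defining expression. *)
have [->|f0] := eqVneq (f b) 0; first by ring.
have rq := regular_fiber hB hF hgB hgF sf f0 rx.
rewrite /cov_der (smooth_extension_regular _ rq); ring.
Qed.

End CovTable.

End CovDer.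

(** * The zero field as a lift *)

Section ZeroOperator.
Context {R : realType} {B F : topologicalType} {m n : nat}.
Context (AB : set (chart R B m)) (AF : set (chart R F n)).

Lemma vfield_zero (M : topologicalType) k (A : set (chart R M k)) : atlas A ->
  vfield A (fun _ _ => 0).
Proof.
by move=> hA; split=> [p|h _]; [exact: (tangent0 hA)|exact: (smooth_cst hA)].
Qed.

Lemma liftB_zero : liftB AB AF (fun _ _ => 0) = (fun _ _ => 0).
Proof. by apply/funext => h; apply/funext => x; rewrite /liftB; case: ifP. Qed.

Lemma liftF_zero : liftF AB AF (fun _ _ => 0) = (fun _ _ => 0).
Proof. by apply/funext => h; apply/funext => x; rewrite /liftF; case: ifP. Qed.

End ZeroOperator.

Unset Implicit Arguments.

Theorem theorem3p15 (R : realType) (B F : topologicalType) (m n : nat)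
  (AB : set (chart R B m)) (AF : set (chart R F n))
  (gB : tensor02 R B) (gF : tensor02 R F) (f : B -> R)
  (DB : operator R B -> operator R B -> operator R B)
  (X Y Z T P : operator R B) (U V W Q : operator R F)
  (hB : smooth_manifold AB) (hF : smooth_manifold AF)
  (hgB : sing_metric AB gB) (hgB_nondeg : nondegenerate_metric AB gB)
  (hgF : sing_metric AF gF) (hgF_semireg : semi_regular AF gF)
  (hf : smooth AB f)
  (hDB : levi_civita AB gB DB)
  (hX : vfield AB X) (hY : vfield AB Y) (hZ : vfield AB Z) (hT : vfield AB T)
  (hP : vfield AB P)
  (hU : vfield AF U) (hV : vfield AF V) (hW : vfield AF W) (hQ : vfield AF Q) :
  let lB := liftB AB AF in
  let lF := liftF AB AF in
  let Rhat := riemann_hat (prod_atlas AB AF) (warped_metric gB gF f) (lB P) in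
  let Hf := hessian DB f in
  (* (1) *)
  (forall b q, Rhat (lB X) (lB Y) (lB Z) (lB T) (b, q)
     = riemann_hat AB gB P X Y Z T b) /\
  (* (2) *)
  (forall b q,
     [/\ Rhat (lB X) (lB Y) (lB Z) (lF Q) (b, q) = 0,
         Rhat (lB Z) (lF Q) (lB X) (lB Y) (b, q) = 0 &
         Rhat (lB X) (lB Y) (lF Q) (lB Z) (b, q) = 0]) /\
  (* (3) *)
  (forall b q,
     Rhat (lB X) (lB Y) (lF W) (lF Q) (b, q) = 0 /\
     Rhat (lF W) (lF Q) (lB X) (lB Y) (b, q) = 0) /\
  (* (4) *)
  (forall b q, Rhat (lB X) (lF V) (lF W) (lB T) (b, q)
     = - (f b * Hf X T b * inner gF V W q)
       + 2 * f b * X f b * inner gF V W q * inner gB P T b) /\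
  (* (5) *)
  (forall b q, Rhat (lB X) (lF V) (lB T) (lF W) (b, q)
     = f b * Hf X T b * inner gF V W q
       + f b ^+ 2 * inner gF V W q * X (inner gB P T) b) /\
  (* (6) *)
  (forall b q,
     Rhat (lF U) (lF V) (lB Z) (lF Q) (b, q) = 0 /\
     Rhat (lB Z) (lF Q) (lF U) (lF V) (b, q) = 0) /\
  (* (7) *)
  (forall b q, Rhat (lF U) (lF V) (lF Q) (lB Z) (b, q)
     = f b ^+ 2 * inner gB P Z b
       * (koszul gF U Q V q - koszul gF V Q U q)) /\
  (* (8) *)
  (forall b q, Rhat (lF U) (lF V) (lF W) (lF Q) (b, q)
     = f b ^+ 2 * riemann AF gF U V W Q q
       + f b ^+ 2 * cometric AB gB (differential f) (differential f) b
         * (inner gF U W q * inner gF V Q q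
            - inner gF V W q * inner gF U Q q)).
Proof.
move: hB hF => /smooth_manifold_atlas aB /smooth_manifold_atlas aF lB lF Rhat Hf.
have vbB S S' := @vfield_bracket _ _ _ _ aB S S'.
have vbF S S' := @vfield_bracket _ _ _ _ aF S S'.
have z := vfield_zero aB.
have z' := vfield_zero aF.
pose Kh := koszul_hat (warped_metric gB gF f) (lB P).
have KBBF S S' G : vfield AB S -> vfield AB S' -> vfield AF G ->
    Kh (lB S) (lB S') (lF G) = (fun=> 0).
  by move=> *; exact: koszul_hat_BBF.
have KBFB S S' G : vfield AB S -> vfield AB S' -> vfield AF G ->
    Kh (lB S) (lF G) (lB S') = (fun=> 0).
  by move=> *; exact: koszul_hat_BFB.
have KFBB S S' G : vfield AB S -> vfield AB S' -> vfield AF G ->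
    Kh (lF G) (lB S) (lB S') = (fun=> 0).
  by move=> *; exact: koszul_hat_FBB.
(* The bracket of a horizontal and a vertical lift is the zero operator. It is the lift of the zero
   field of either factor, and the factor is chosen so that the entry of the table is 0. *)
have K0BB S S' : vfield AB S -> vfield AB S' -> Kh (fun _ _ => 0) (lB S) (lB S') = (fun=> 0).
  by move=> vS vS'; rewrite -(liftF_zero AB AF); exact: KFBB.
have K0BF S G : vfield AB S -> vfield AF G -> Kh (fun _ _ => 0) (lB S) (lF G) = (fun=> 0).
  by move=> vS vG; rewrite -(liftB_zero AB AF); exact: KBBF.
have K0FB S G : vfield AB S -> vfield AF G -> Kh (fun _ _ => 0) (lF G) (lB S) = (fun=> 0).
  by move=> vS vG; rewrite -(liftB_zero AB AF); exact: KBFB.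
have K0FF G G' : vfield AF G -> vfield AF G' -> Kh (fun _ _ => 0) (lF G) (lF G') = (fun=> 0).
  move=> vG vG'; rewrite -(liftB_zero AB AF) /Kh (koszul_hat_BFF aB aF) //.
  by apply/funext => x; rewrite mulr0 mul0r.
have gPT : inner gB P T = inner gB T P by exact: (innerC hgB).
rewrite /Rhat /riemann_hat /curvature; split=> [b q|]; last split=> [b q|]; last split=> [b q|];
  last split=> [b q|]; last split=> [b q|]; last split=> [b q|]; last split=> [b q|b q].
- rewrite !(cov_BBBB aB aF hgB hgF hf hDB) // (bracket_liftBB aB aF) //.
  rewrite (koszul_hat_BBB aB aF) //; last exact: vbB.
  by rewrite !(cov_der_hat aB hgB hDB).
- split.
  + rewrite !(cov_BBBF aB aF hgB hgF hf hDB) // (bracket_liftBB aB aF) //.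
    by rewrite -/Kh KBBF ?subr0 //; exact: vbB.
  + rewrite (cov_BFBB aB aF hgB hgF hf hDB) //.
    rewrite (cov_FBBB aB aF hgB hgF hf hDB) // (bracket_liftBF aB aF) //.
    by rewrite -/Kh K0BB ?subr0.
  + rewrite !(cov_BBFB aB aF hgB hgF hf hDB) // (bracket_liftBB aB aF) //.
    by rewrite -/Kh KBFB ?subr0 //; exact: vbB.
- split.
  + rewrite !(cov_BBFF aB aF hgB hgB_nondeg hgF hf) // (bracket_liftBB aB aF) //.
    rewrite (koszul_hat_BFF aB aF) //; last exact: vbB.
    (* The commutator of [X] and [Y] on [f] cancels against the bracket term. *)
    rewrite /bracket /=; ring.
  + rewrite !(cov_FFBB aB aF hgB hgB_nondeg hgF hf) // (bracket_liftFF aB aF) //.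
    rewrite -/Kh KFBB ?subr0 //; last exact: vbF.
    (* The value given by [cov_FFBB] is symmetric in [W] and [Q], so the two derivatives cancel. *)
    rewrite (innerC hgF hQ hW) /=; ring.
- rewrite (cov_BFFB aB aF hgB hgB_nondeg hgF hgF_semireg hf hDB) //.
  rewrite (cov_FBFB aB aF hgB hgB_nondeg hgF hf) // (bracket_liftBF aB aF) //.
  (* Of the two equal terms in [P], one comes from the [P] part of [semi_symmetric] in the first
     derivative and one from the second derivative; the products [X f * T f] cancel. *)
  rewrite -/Kh K0FB // /Hf /hessian /semi_symmetric /vadd /vscale gPT /=; ring.
- rewrite (cov_BFBF aB aF hgB hgB_nondeg hgF hf) //.
  rewrite (cov_FBBF aB aF hgB hgB_nondeg hgF hgF_semireg hf hDB) // (bracket_liftBF aB aF) //.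
  (* Here the products of [X f] with the inner product of [T] and [P] cancel between the two
     derivatives, and only the derivative of that inner product survives. *)
  rewrite -/Kh K0BF // /Hf /hessian /semi_symmetric /vadd /vscale gPT /=; ring.
- split.
  + rewrite !(cov_FFBF aB aF hgB hgB_nondeg hgF hgF_semireg hf) // (bracket_liftFF aB aF) //.
    rewrite (koszul_hat_FBF aB aF) //=; last exact: vbF.
    (* Metric compatibility replaces derivatives of [gF] by Koszul forms and the torsion identity
       does the same for the bracket; everything then cancels. *)
    rewrite (koszul_metric aF hgF q hU hV hQ) (koszul_metric aF hgF q hV hU hQ).
    rewrite -(koszul_torsion aF hgF q hU hV hQ); ring.
  + rewrite (cov_BFFF aB aF hgB hgB_nondeg hgF hgF_semireg hf) //.
    rewrite (cov_FBFF aB aF hgB hgB_nondeg hgF hgF_semireg hf) // (bracket_liftBF aB aF) //.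
    rewrite -/Kh K0FF //= (koszul_metric aF hgF q hQ hU hV); ring.
- rewrite !(cov_FFFB aB aF hgB hgB_nondeg hgF hgF_semireg hf) // (bracket_liftFF aB aF) //.
  rewrite (koszul_hat_FFB aB aF) //=; last exact: vbF.
  (* The same two identities cancel all terms in [f * Z f]; the terms in [P] have no counterpart in
     [koszul_hat_FFB] and remain. *)
  rewrite (koszul_metric aF hgF q hU hV hQ) (koszul_metric aF hgF q hV hU hQ).
  rewrite -(koszul_torsion aF hgF q hU hV hQ) (innerC hgB hP hZ); ring.
- rewrite !(cov_FFFF aB aF hgB hgB_nondeg hgF hgF_semireg hf) // (bracket_liftFF aB aF) //.
  rewrite (koszul_hat_FFF aB aF) //=; last exact: vbF.
  (* Pairings of vertical Koszul forms are already contained in [cov_der] on [F], so beyond the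
     curvature of [F] only the gradient terms are left. *)
  rewrite /riemann /curvature; ring.
Qed.
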